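(* Let $P$ be a positroid of rank $k$ on a totally ordered set of $n$ elements. The following are equivalent: (i) $P$ is graphic; (ii) $P$ is the unique matroid contained in $\Omega_P$; (iii) for every field $\mathbb{F}$, $\Pi^{\circ}_{\mathbb{F}}(P)=S_P(\mathbb{F})$; (iv) $\Pi_{\mathbb{R}}(P)$ is equal to a disjoint union of graphic matroid strata, i.e. of sets $S_M(\mathbb{R})$ with $M$ a graphic ordered matroid.
   Context: An ordered matroid is a finite matroid whose ground set is totally ordered. A positroid is an ordered matroid $M$ on $E=\{e_1<\dots<e_n\}$, of rank $k$ say, for which there is a real $k\times n$ matrix $A$ of rank $k$, whose $j$-th column corresponds to $e_j$, such that $A$ realizes $M$ (the independent sets of $M$ are the linearly independent sets of columns) and all maximal ($k\times k$) minors of $A$ are nonnegative. A matroid is graphic if it is isomorphic to the cycle matroid $M(G)$ of some graph $G$ (loops and multiple edges allowed). For $E=\{e_1<\dots<e_n\}$ let $\leq_i$ be the total order $e_i<_i e_{i+1}<_i\dots<_i e_n<_i e_1<_i\dots<_i e_{i-1}$. The Grassmann necklace of an ordered matroid $M$ on $E$ is $\mathcal{J}(M)=(J_1,\dots,J_n)$ where $J_i$ is the lexicographically minimal basis of $M$ with respect to $\leq_i$. For each ordered matroid $M$ on $E$ there is exactly one positroid $P$ on $E$ with $\mathcal{J}(P)=\mathcal{J}(M)$, called the positroid envelope of $M$. For a positroid $P$ on $E$, the envelope class $\Omega_P$ is the set of all ordered matroids on $E$ whose positroid envelope is $P$, i.e. $\Omega_P=\{M:\mathcal{J}(M)=\mathcal{J}(P)\}$.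 $\mathrm{Gr}(k,\mathbb{F}^n)$ is the Grassmannian of $k$-dimensional linear subspaces of $\mathbb{F}^n$. For $V\in\mathrm{Gr}(k,\mathbb{F}^n)$, $M_V$ is the ordered matroid realized by the columns of any full-rank $k\times n$ matrix over $\mathbb{F}$ with row space $V$ (the $j$-th column corresponding to the $j$-th element $e_j$ of the ground set). For a rank-$k$ ordered matroid $M$ on $n$ elements, the matroid stratum is $S_M(\mathbb{F})=\{V\in \mathrm{Gr}(k,\mathbb{F}^n): M_V=M\}$; it is a graphic matroid stratum if $M$ is graphic. The open positroid variety of $P$ is $\Pi^{\circ}_{\mathbb{F}}(P)=\{V\in\mathrm{Gr}(k,\mathbb{F}^n): M_V\in\Omega_P\}=\bigsqcup_{M\in\Omega_P}S_M(\mathbb{F})$, and the positroid variety $\Pi_{\mathbb{F}}(P)=\overline{\Pi^{\circ}_{\mathbb{F}}(P)}$ is its (Zariski) closure in $\mathrm{Gr}(k,\mathbb{F}^n)$. It is known (Knutson--Lam--Speyer) that, as sets, $\Pi_{\mathbb{R}}(P)=\{V\in\mathrm{Gr}(k,\mathbb{R}^n): \Delta_I(V)=0 \text{ for every } k\text{-subset } I\notin\mathcal{I}(P)\}$, where $\Delta_I$ are the Plücker coordinates and $\mathcal{I}(P)$ the independent sets of $P$. *)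

(* Defs.v *)
From HB Require Import structures.
From mathcomp Require Import all_boot all_order all_algebra.
From mathcomp Require Import boolp classical_sets reals mpoly.

Set Implicit Arguments.
Unset Strict Implicit.
Unset Printing Implicit Defensive.

Import Order.TTheory GRing.Theory Num.Theory.
Local Open Scope ring_scope.

(** * Matroids on a finite type *)

Definition matroid_axiom (T : finType) (I : {set {set T}}) : bool :=
  [&& finset.set0 \in I,
      [forall A : {set T}, forall B : {set T},
         (A \in I) && (B \subset A) ==> (B \in I)]
    & [forall A : {set T}, forall B : {set T},
         [&& A \in I, B \in I & (#|A| < #|B|)%N] ==>
         [exists x in B :\: A, x |: A \in I]]].

Record matroid (T : finType) := Matroid {
  indep : {set {set T}};
  indepP : matroid_axiom indep }.

HB.instance Definition _ (T : finType) := [isSub of matroid T for @indep T].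
HB.instance Definition _ (T : finType) := [Finite of matroid T by <:].

Definition bases (T : finType) (M : matroid T) : {set {set T}} :=
  [set B : {set T} | maxset (fun S => S \in indep M) B]%SET.

Definition mrank (T : finType) (M : matroid T) : nat :=
  (\max_(S in indep M) #|S|)%N.

(** * Graphic matroids *)

(* Loops are edges [e] with [ends e = (x, x)]; distinct edges may have the same
   ends. The orientation given by the pair is irrelevant, see [joins]. *)
Record multigraph := Multigraph {
  vertex : finType;
  edge : finType;
  ends : edge -> vertex * vertex }.

Definition joins (G : multigraph) (e : edge G) (x y : vertex G) : bool :=
  (ends e == (x, y)) || (ends e == (y, x)).

(* [ordS] is the cyclic successor on ['I_m.+1]. For [m = 0] the cycle is a loop,
   for [m = 1] it is a pair of parallel edges. *)
Definition is_cycle (G : multigraph) (C : {set edge G}) : Prop :=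
  exists (m : nat) (v : 'I_m.+1 -> vertex G) (e : 'I_m.+1 -> edge G),
    [/\ injective v, injective e,
        forall i, joins (e i) (v i) (v (ordS i))
      & C = [set e i | i : 'I_m.+1]%SET].

(* The independent sets of the cycle matroid M(G). *)
Definition acyclic (G : multigraph) (S : {set edge G}) : Prop :=
  forall C : {set edge G}, is_cycle C -> ~~ (C \subset S).

Definition graphic (T : finType) (M : matroid T) : Prop :=
  exists (G : multigraph) (f : T -> edge G), bijective f /\
    forall S : {set T}, S \in indep M <-> acyclic (f @: S)%SET.

(** * Matroids realized by matrices and by subspaces *)

(* [free] is a property of sequences, so distinct elements of [S] indexing equal
   columns make [S] dependent. *)
Definition col_indep (F : fieldType) (k n : nat) (A : 'M[F]_(k, n)) :
    {set {set 'I_n}} :=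
  [set S : {set 'I_n} | free [seq col j A | j <- enum S]]%SET.

Lemma mem_col_indep (F : fieldType) (k n : nat) (A : 'M[F]_(k, n)) S :
  (S \in col_indep A) = (\dim <<[seq col j A | j <- enum S]>> == #|S|).
Proof. by rewrite inE /free size_map -cardE. Qed.

Lemma col_indep_matroid (F : fieldType) (k n : nat) (A : 'M[F]_(k, n)) :
  matroid_axiom (col_indep A).
Proof.
pose X (S : {set 'I_n}) := [seq col j A | j <- enum S].
have memX (S : {set 'I_n}) j : j \in S -> col j A \in <<X S>>%VS.
  by move=> jS; apply/memv_span/map_f; rewrite mem_enum.
have freeU1 (S : {set 'I_n}) x : x \notin S ->
    free (X (x |: S)) = free (col x A :: X S).
  move=> xS; rewrite -[col x A :: X S]/[seq col j A | j <- x :: enum S].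
  apply/perm_free/perm_map.
  apply: uniq_perm; rewrite ?enum_uniq //= ?mem_enum ?xS ?enum_uniq //.
  by move=> y; rewrite inE !mem_enum !inE.
apply/and3P; split.
- by rewrite inE enum_set0 nil_free.
- apply/forallP => S; apply/forallP => S'; apply/implyP => /andP[].
  rewrite !inE => fS /fintype.subsetP sub.
  have p : perm_eq (X S) (X S' ++ X (S :\: S')).
    rewrite -map_cat; apply/perm_map/uniq_perm; rewrite ?enum_uniq //.
      rewrite cat_uniq !enum_uniq andbT /=; apply/hasPn => y.
      by rewrite !mem_enum inE => /andP[].
    move=> y; rewrite mem_cat !mem_enum inE.
    by case: (boolP (y \in S')) => //= /sub ->.
  by move: fS; rewrite -/(X S) (perm_free p) => /catl_free.
- apply/forallP => S; apply/forallP => S'; apply/implyP => /and3P[].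
  rewrite !mem_col_indep => /eqP dS /eqP dS' ltSS'.
  apply/existsP; apply: contrapT => nex.
  have subSS' : (<<X S'>> <= <<X S>>)%VS.
    apply/span_subvP => _ /mapP[j + ->]; rewrite mem_enum => jS'.
    apply: contrapT => /negP jnS; case: nex; exists j.
    have jS : j \notin S by apply: contra jnS => /memX.
    rewrite !inE jS jS' /= -/(X _) freeU1 // free_cons jnS /=.
    by rewrite /free /X dS size_map -cardE.
  by move: (dimvS subSS'); rewrite dS dS' leqNgt ltSS'.
Qed.

Definition col_matroid (F : fieldType) (k n : nat) (A : 'M[F]_(k, n)) :
    matroid 'I_n :=
  Matroid (col_indep_matroid A).

(* The maximal minor of [A] on the columns in [I], taken in increasing order
   (which is how [enum_val] lists a subset of ['I_n]); meaningful only when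
   [#|I| = k], in which case [conform_mx] is a mere cast. *)
Definition minor (F : fieldType) (k n : nat) (A : 'M[F]_(k, n))
    (I : {set 'I_n}) : F :=
  \det (conform_mx (0 : 'M[F]_k) (colsub (enum_val : 'I_#|I| -> 'I_n) A)).

(* The set of [k]-dimensional subspaces of F^n. *)
Definition Gr (F : fieldType) (k n : nat) : set {vspace 'rV[F]_n} :=
  [set V : {vspace 'rV[F]_n} | \dim V = k]%classic.
Arguments Gr F k n : clear implicits.

Definition space_mx (F : fieldType) (n : nat) (V : {vspace 'rV[F]_n}) :
    'M[F]_(\dim V, n) :=
  \matrix_(i < \dim V) (vbasis V)`_i.

Definition row_space (F : fieldType) (k n : nat) (A : 'M[F]_(k, n)) :
    {vspace 'rV[F]_n} :=
  <<[seq row i A | i <- enum 'I_k]>>%VS.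

(* M_V; [space_matroid_row_space] below shows that any matrix
   with row space [V] gives the same matroid. *)
Definition space_matroid (F : fieldType) (n : nat) (V : {vspace 'rV[F]_n}) :
    matroid 'I_n :=
  col_matroid (space_mx V).

Lemma space_mxK (F : fieldType) (n : nat) (V : {vspace 'rV[F]_n}) :
  row_space (space_mx V) = V.
Proof.
rewrite /row_space -[RHS](span_basis (vbasisP V)); congr (<<_>>%VS).
apply: (@eq_from_nth _ 0) => [|i]; rewrite size_map size_enum_ord ?size_tuple //.
move=> ltid; rewrite (nth_map (Ordinal ltid)) ?size_enum_ord //.
by rewrite rowK nth_enum_ord.
Qed.

Lemma row_space_mulmx (F : fieldType) (k l n : nat)
    (A : 'M[F]_(k, n)) (B : 'M[F]_(l, n)) :
  (row_space A <= row_space B)%VS -> exists Q : 'M[F]_(k, l), A = Q *m B.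
Proof.
move=> sAB; suff /submxP : (A <= B)%MS by [].
apply/row_subP => i; apply/submxP.
have BW : (row_space B <= limg (linfun (mulmxr B : 'rV[F]_l -> 'rV[F]_n)))%VS.
  apply/span_subvP => _ /mapP[j _ ->].
  have -> : row j B = linfun (mulmxr B) (delta_mx 0 j : 'rV_l).
    by rewrite lfunE /= -rowE.
  exact: memv_img (memvf _).
have /(subvP (subv_trans sAB BW)) : row i A \in row_space A.
  by apply/memv_span/map_f; rewrite mem_enum.
by case/memv_imgP => u _ ->; exists u; rewrite lfunE.
Qed.

Lemma col_indep_mulmx (F : fieldType) (k l n : nat)
    (Q : 'M[F]_(k, l)) (B : 'M[F]_(l, n)) :
  col_indep (Q *m B) \subset col_indep B.
Proof.
apply/fintype.subsetP => S; rewrite !mem_col_indep => /eqP dQ.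
have dB : (\dim <<[seq col j B | j <- enum S]>> <= #|S|)%N.
  by rewrite (leq_trans (dim_span _)) // size_map -cardE.
rewrite eqn_leq dB /= -[X in (X <= _)%N]dQ.
have -> : [seq col j (Q *m B) | j <- enum S] =
    map (linfun (mulmx Q : 'cV[F]_l -> 'cV[F]_k)) [seq col j B | j <- enum S].
  by rewrite -map_comp; apply/eq_map => j /=; rewrite lfunE /= !colE mulmxA.
by rewrite -limg_span -(limg_ker_dim (linfun (mulmx Q)) <<_>>) leq_addl.
Qed.

Lemma col_matroid_row_space (F : fieldType) (k l n : nat)
    (A : 'M[F]_(k, n)) (B : 'M[F]_(l, n)) :
  row_space A = row_space B -> col_matroid A = col_matroid B.
Proof.
move=> eAB; apply: val_inj => /=; apply/eqP; rewrite finset.eqEsubset.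
have [|Q eA] := @row_space_mulmx _ _ _ _ A B; first by rewrite eAB.
have [|Q' eB] := @row_space_mulmx _ _ _ _ B A; first by rewrite eAB.
by apply/andP; split; [rewrite eA | rewrite eB]; apply: col_indep_mulmx.
Qed.

Lemma space_matroid_row_space (F : fieldType) (k n : nat) (A : 'M[F]_(k, n)) :
  space_matroid (row_space A) = col_matroid A.
Proof. by apply: col_matroid_row_space; rewrite space_mxK. Qed.

Definition plucker (F : fieldType) (n : nat) (V : {vspace 'rV[F]_n})
    (I : {set 'I_n}) : F :=
  minor (space_mx V) I.

(** * Positroids and envelope classes *)

Definition positroid (R : realType) (n : nat) (M : matroid 'I_n) : Prop :=
  exists A : 'M[R]_(mrank M, n),
    [/\ \rank A = mrank M, col_matroid A = M
      & forall I : {set 'I_n}, #|I| = mrank M -> 0 <= minor A I].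

(* The (0-based) position of [x] in the order
   i <_i i+1 <_i ... <_i n-1 <_i 0 <_i ... <_i i-1. *)
Definition cyc_pos (n : nat) (i x : 'I_n) : nat := ((x + n - i) %% n)%N.

Definition cyc_word (n : nat) (i : 'I_n) (B : {set 'I_n}) : seqlexi nat :=
  sort leq [seq cyc_pos i x | x <- enum B].

(* J_i; all bases have the same cardinality, so there is exactly one
   lexicographically minimal one and [pick] selects it. *)
Definition necklace_entry (n : nat) (M : matroid 'I_n) (i : 'I_n) : {set 'I_n} :=
  odflt finset.set0
    [pick B in bases M |
       [forall B' in bases M, (cyc_word i B <= cyc_word i B')%O]].

Definition grassmann_necklace (n : nat) (M : matroid 'I_n) :
    {ffun 'I_n -> {set 'I_n}} :=
  [ffun i => necklace_entry M i].

Definition envelope_class (n : nat) (P : matroid 'I_n) : {set matroid 'I_n} :=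
  [set M | grassmann_necklace M == grassmann_necklace P]%SET.

(** * Matroid strata and positroid varieties *)

Local Open Scope classical_set_scope.

Definition matroid_stratum (F : fieldType) (n : nat) (M : matroid 'I_n) :
    set {vspace 'rV[F]_n} :=
  [set V | Gr F (mrank M) n V /\ space_matroid V = M].
Arguments matroid_stratum F {n} M.

Definition open_positroid_variety (F : fieldType) (n : nat) (P : matroid 'I_n) :
    set {vspace 'rV[F]_n} :=
  [set V | Gr F (mrank P) n V /\ space_matroid V \in envelope_class P].
Arguments open_positroid_variety F {n} P.

Definition ksubsets (k n : nat) : {set {set 'I_n}} :=
  [set I : {set 'I_n} | #|I| == k]%SET.

(* The value of a polynomial in the Pluecker coordinates at the Pluecker vector
   of [V]. As that vector is determined by [V] only up to a nonzero scalar, only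
   the vanishing of homogeneous polynomials is intrinsic. *)
Definition plucker_eval (F : fieldType) (k n : nat)
    (p : {mpoly F[#|ksubsets k n|]}) (V : {vspace 'rV[F]_n}) : F :=
  p.@[fun i => plucker V (enum_val i)].

(* Closed sets of the Zariski topology on Gr(k, F^n), induced by the Pluecker
   embedding. *)
Definition zariski_closed (F : fieldType) (k n : nat)
    (Z : set {vspace 'rV[F]_n}) : Prop :=
  exists2 S : set {mpoly F[#|ksubsets k n|]},
    forall p, S p -> exists d : nat, p \is d.-homog
    & Z = [set V | Gr F k n V /\ forall p, S p -> plucker_eval p V = 0].

Definition zariski_closure (F : fieldType) (k n : nat)
    (X : set {vspace 'rV[F]_n}) : set {vspace 'rV[F]_n} :=
  smallest (@zariski_closed F k n) X.

Definition positroid_variety (F : fieldType) (n : nat) (P : matroid 'I_n) :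
    set {vspace 'rV[F]_n} :=
  zariski_closure (mrank P) (open_positroid_variety F P).
Arguments positroid_variety F {n} P.

Definition is_disjoint_union_of_graphic_strata (F : fieldType) (n : nat)
    (X : set {vspace 'rV[F]_n}) : Prop :=
  exists Ms : set (matroid 'I_n),
    [/\ forall M, Ms M -> graphic M,
        trivIset Ms (matroid_stratum F)
      & X = \bigcup_(M in Ms) matroid_stratum F M].

(* Main.v *)
Require Import Defs.
From HB Require Import structures.
From mathcomp Require Import all_boot all_order all_algebra all_fingroup.
From mathcomp Require boolp.
From mathcomp Require Import zify ring lra.

Set Implicit Arguments.
Unset Strict Implicit.
Unset Printing Implicit Defensive.

(** The four conditions are all equivalent to the following: [P] arises from a set of
    loops by adding coloops and by repeatedly adding an element that is parallel to,
    or in series with, a neighbour in the order, where loops between the two are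
    ignored. The predicate [series_parallel] expresses this, its flag being the
    condition on neighbours.

    The Grassmann necklace of a matroid amounts to its ranks on cyclic intervals
    ([envelope_classE]). These ranks show the coloops and the consecutive parallel
    and series pairs, so a matroid with the necklace of [P] can be reduced in step
    with [P]: a series-parallel matroid built from neighbours is alone in its
    envelope class ([sp_unique]). It is graphic, since parallel and series elements
    double and subdivide edges ([sp_presented]).

    Conversely, the bases of a positroid are noncrossing, by the three-term Pluecker
    relation ([tnn_noncrossing]). In a noncrossing matroid call a corner a pair of
    consecutive elements [b], [c] of which some greedy basis takes [b] and omits
    [c]; then [b] can replace [c] in every basis ([corner_replace]). If subtracting
    a multiple of [c] from the vector [b] removes the [c]-component of [b] over all
    bases at once, the exchange graph of a basis loses the edge [bc] only and falls
    apart, along an interval, into pieces that do not cross ([corner_split]).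
    Uncrossing such intervals leads to two consecutive elements that are parallel
    or in series ([reduction_pair]), and these are reduced inductively
    ([sp_of_hereditary]). There are two reasons for such a multiple to exist. Over
    the field with two elements all nonzero ratios are 1, and graphic matroids are
    binary ([graphic_representable2]); hence a graphic positroid is alone in its
    envelope class. If [P] is merely the only matroid with its necklace that is
    representable over the reals, two different ratios would show in the ranks of
    nested arcs, which determine the ratio ([rigid_hereditary]).

    Real subspaces see this weaker uniqueness, so it remains to describe the closure
    of the stratum of a series-parallel [P]. At each of its points the Pluecker
    coordinates at non-bases of [P] vanish, so the matroid of the point is a weak
    image of [P] of the same rank, hence again series-parallel ([sp_weak_image]) and
    graphic. The subspaces with a given series-parallel matroid form a single orbit
    under scaling the coordinates ([sp_torus]), and the closure is invariant under
    scaling ([torus_positroid_variety]), so it is a union of graphic strata.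
    Conversely, if the positroid variety is such a union, then [P] is graphic
    because its own stratum has a real point. *)

(** * Rank functions of matroids *)

Section Rank.
Variable T : finType.
Implicit Types (M : matroid T) (S X Y B I : {set T}) (x y : T).

Lemma set2_sub X x y : x \in X -> y \in X -> [set x; y] \subset X.
Proof. by move=> xX yX; rewrite subUset !sub1set xX yX. Qed.

Lemma setD1_id x S : x \notin S -> S :\ x = S.
Proof. by move=> xS; apply/setDidPl; rewrite disjoint_sym disjoints1. Qed.

Definition rk M X : nat := \max_(S in indep M | S \subset X) #|S|.

Lemma indep0 M : set0 \in indep M.
Proof. by case/and3P: (indepP M). Qed.

Lemma indepS M A B : A \in indep M -> B \subset A -> B \in indep M.
Proof.
move=> iA sBA; case/and3P: (indepP M) => _ /forallP /(_ A) /forallP /(_ B).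
by rewrite iA sBA => /implyP ->.
Qed.

Lemma indep_exchange M A B : A \in indep M -> B \in indep M -> #|A| < #|B| ->
  exists2 x, x \in B :\: A & x |: A \in indep M.
Proof.
move=> iA iB lt; case/and3P: (indepP M) => _ _ /forallP /(_ A) /forallP /(_ B).
by rewrite iA iB lt => /existsP[x /andP[]]; exists x.
Qed.

Lemma matroid_eq M1 M2 : (forall S, (S \in indep M1) = (S \in indep M2)) -> M1 = M2.
Proof. by move=> e; apply: val_inj; apply/setP. Qed.

Lemma matroid_ex (p : pred {set T}) : p set0 -> (forall A B, p A -> B \subset A -> p B) ->
  (forall A B, p A -> p B -> #|A| < #|B| -> exists2 x, x \in B :\: A & p (x |: A)) ->
  exists M, forall S, (S \in indep M) = p S.
Proof.
move=> h0 h1 h2; have ax : matroid_axiom [set S | p S].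
  apply/and3P; split; first by rewrite inE.
    apply/forallP => A; apply/forallP => B; apply/implyP; rewrite !inE => /andP[]; exact: h1.
  apply/forallP => A; apply/forallP => B; apply/implyP; rewrite !inE => /and3P[pA pB lt].
  by have [x xBA px] := h2 A B pA pB lt; apply/existsP; exists x; rewrite xBA inE.
by exists (Matroid ax) => S; rewrite inE.
Qed.

Lemma card_le_rk M S X : S \in indep M -> S \subset X -> #|S| <= rk M X.
Proof.
move=> iS sS; rewrite /rk.
by apply: (@leq_bigmax_cond _ (fun S => (S \in indep M) && (S \subset X)) (fun S => #|S|)); rewrite iS.
Qed.

Lemma rk_wit M X : exists S, [/\ S \in indep M, S \subset X & #|S| = rk M X].
Proof.
have := @eq_bigmax_cond _ (fun S => (S \in indep M) && (S \subset X)) (fun S => #|S|).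
case; first by apply/card_gt0P; exists set0; rewrite unfold_in indep0 sub0set.
by move=> S; rewrite unfold_in => /andP[iS sS] e; exists S; split => //; rewrite /rk e.
Qed.

Lemma rk_le M X m : (forall S, S \in indep M -> S \subset X -> #|S| <= m) -> rk M X <= m.
Proof. by move=> H; have [S [iS sS <-]] := rk_wit M X; apply: H. Qed.

Lemma rkS M X Y : X \subset Y -> rk M X <= rk M Y.
Proof.
move=> s; apply: rk_le => S iS sS; apply: card_le_rk => //.
exact: subset_trans sS s.
Qed.

Lemma rk_le_card M X : rk M X <= #|X|.
Proof. by apply: rk_le => S _; apply: subset_leq_card. Qed.

Lemma rk0 M : rk M set0 = 0.
Proof. by apply/eqP; rewrite -leqn0 -(cards0 T) rk_le_card. Qed.

Lemma indep_rk M S : (S \in indep M) = (rk M S == #|S|).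
Proof.
apply/idP/eqP => [iS|e].
  by apply/eqP; rewrite eqn_leq rk_le_card card_le_rk.
have [S' [iS' sS' e']] := rk_wit M S.
suff <- : S' = S by [].
by apply/eqP; rewrite eqEcard sS' e' e leqnn.
Qed.

Lemma rk_indep M S : S \in indep M -> rk M S = #|S|.
Proof. by rewrite indep_rk => /eqP. Qed.

Lemma indep_extend M I X : I \in indep M -> I \subset X ->
  exists B, [/\ B \in indep M, I \subset B, B \subset X & #|B| = rk M X].
Proof.
move: {2}(rk M X - #|I|) (leqnn (rk M X - #|I|)) => m.
elim: m I => [|m IHm] I le iI sI.
  exists I; split => //; apply/eqP; rewrite eqn_leq card_le_rk //=.
  by move: le; rewrite leqn0 subn_eq0.
have [lt|ge] := ltnP #|I| (rk M X); last first.
  by exists I; split => //; apply/eqP; rewrite eqn_leq ge card_le_rk.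
have [S [iS sS eS]] := rk_wit M X.
have [|x] := indep_exchange iI iS; first by rewrite eS.
rewrite inE => /andP[xI xS] ixI.
have [|||B [iB sB sBX eB]] := IHm (x |: I).
- by rewrite cardsU1 xI; lia.
- exact: ixI.
- by rewrite subUset sub1set sI (subsetP sS).
exists B; split => //; apply: subset_trans sB; exact: subsetUr.
Qed.

Lemma rk_submod M X Y : rk M (X :|: Y) + rk M (X :&: Y) <= rk M X + rk M Y.
Proof.
have [I [iI sI eI]] := rk_wit M (X :&: Y).
have [|B [iB sIB sB eB]] := @indep_extend M I (X :|: Y) iI.
  by apply: subset_trans sI _; apply: subset_trans (subsetIl _ _) (subsetUl _ _).
have le1 : #|B :&: X| <= rk M X by apply: card_le_rk; [apply: indepS iB _|]; rewrite ?subsetIl ?subsetIr.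
have le2 : #|B :&: Y| <= rk M Y by apply: card_le_rk; [apply: indepS iB _|]; rewrite ?subsetIl ?subsetIr.
have e1 : #|B :&: X| + #|B :&: Y| = #|B| + #|B :&: (X :&: Y)|.
  by rewrite -cardsUI -setIUr -setIIr (setIidPl sB).
have : #|I| <= #|B :&: (X :&: Y)| by rewrite subset_leq_card // subsetI sIB sI.
by lia.
Qed.

Lemma rkU_le M X Y : rk M (X :|: Y) <= rk M X + rk M Y.
Proof. by have := rk_submod M X Y; lia. Qed.

Lemma rk1_le M x : rk M [set x] <= 1.
Proof. by rewrite -(cards1 x) rk_le_card. Qed.

Lemma rkU1_le M x X : rk M (x |: X) <= (rk M X).+1.
Proof. by have := rkU_le M [set x] X; have := rk1_le M x; lia. Qed.

Lemma rkU1_ge M x X : rk M X <= rk M (x |: X).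
Proof. by apply: rkS; apply: subsetUr. Qed.

Definition spans M X x : bool := rk M (x |: X) == rk M X.

Lemma clE M X x : spans M X x -> rk M (x |: X) = rk M X.
Proof. by move/eqP. Qed.

Lemma clN M X x : ~~ spans M X x -> rk M (x |: X) = (rk M X).+1.
Proof. by rewrite /spans => H; have := rkU1_le M x X; have := rkU1_ge M x X; lia. Qed.

Lemma mem_cl M X x : x \in X -> spans M X x.
Proof. by move=> xX; rewrite /spans (setUidPr _) ?sub1set. Qed.

Lemma clS M X Y x : X \subset Y -> spans M X x -> spans M Y x.
Proof.
move=> s /clE e; have := rk_submod M (x |: X) Y.
rewrite -setUA (setUidPr s) => H.
have : rk M X <= rk M ((x |: X) :&: Y) by apply: rkS; rewrite subsetI subsetUr s.
have := rkU1_ge M x Y; rewrite /spans; lia.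
Qed.

Lemma cl_rkU M X Y : (forall y, y \in Y -> spans M X y) -> rk M (X :|: Y) = rk M X.
Proof.
move: {2}#|Y| (leqnn #|Y|) => m; elim: m Y => [|m IHm] Y le H.
  by move: le; rewrite leqn0 cards_eq0 => /eqP ->; rewrite setU0.
have [->|[y yY]] := set_0Vmem Y; first by rewrite setU0.
rewrite -(setD1K yY) setUCA clE.
  apply: IHm => [|z]; first by rewrite (cardsD1 y) yY in le; lia.
  by rewrite inE => /andP[_]; apply: H.
by apply: clS (H y yY); apply: subsetUl.
Qed.

Lemma cl_sub_rk M X Y : X \subset Y -> (forall y, y \in Y -> spans M X y) -> rk M Y = rk M X.
Proof. by move=> s H; rewrite -(cl_rkU H) (setUidPr s). Qed.

Lemma rk_cl M X Y x : X \subset Y -> rk M X = rk M Y -> x \in Y -> spans M X x.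
Proof.
move=> s e xY; rewrite /spans eqn_leq rkU1_ge andbT e rkS //.
by rewrite subUset sub1set xY.
Qed.

Lemma cl_trans M X Y x : (forall y, y \in Y -> spans M X y) -> spans M Y x -> spans M X x.
Proof.
move=> H cY; have /clE e : spans M (X :|: Y) x by apply: clS cY; apply: subsetUr.
apply: (@rk_cl _ _ (x |: (X :|: Y))); last by rewrite setU11.
  by rewrite setUCA subsetUl.
by rewrite e cl_rkU.
Qed.

Lemma indepU1 M x S : S \in indep M -> x \notin S -> (x |: S \in indep M) = ~~ spans M S x.
Proof.
move=> iS xS; rewrite indep_rk cardsU1 xS /spans (rk_indep iS).
by have := rkU1_le M x S; rewrite (rk_indep iS); have := rkU1_ge M x S; rewrite (rk_indep iS); lia.
Qed.

Definition is_basis M B : bool := (B \in indep M) && (#|B| == rk M setT).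

Lemma isb_indep M B : is_basis M B -> B \in indep M. Proof. by case/andP. Qed.
Lemma isb_card M B : is_basis M B -> #|B| = rk M setT. Proof. by case/andP => _ /eqP. Qed.
Lemma isb_rk M B : is_basis M B -> rk M B = rk M setT.
Proof. by move=> b; rewrite (rk_indep (isb_indep b)) (isb_card b). Qed.

Lemma isb_cl M B x : is_basis M B -> spans M B x.
Proof. by move=> b; apply: (@rk_cl _ _ setT); rewrite ?subsetT ?isb_rk ?inE. Qed.

Lemma mrankE M : mrank M = rk M setT.
Proof. by apply: eq_bigl => S; rewrite subsetT andbT. Qed.

Lemma indep_sub_basis M I : I \in indep M -> exists2 B, is_basis M B & I \subset B.
Proof.
move=> iI; have [|B [iB sI _ eB]] := @indep_extend M I setT iI; first exact: subsetT.
by exists B => //; rewrite /is_basis iB eB eqxx.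
Qed.

Lemma rk_eqP M1 M2 : (forall X, rk M1 X = rk M2 X) -> M1 = M2.
Proof. by move=> H; apply: matroid_eq => S; rewrite !indep_rk H. Qed.

Lemma basesE M B : (B \in bases M) = is_basis M B.
Proof.
rewrite inE; apply/maxsetP/andP => [[iB mB]|[iB /eqP eB]].
  split; first exact: iB.
  have [B' /andP[iB' /eqP eB'] sB] := indep_sub_basis iB.
  by rewrite -(mB B' iB' sB) eB'.
split=> [|B' iB' sB]; first exact: iB.
apply/esym/eqP; rewrite eqEcard sB eB.
by apply: card_le_rk => //; apply: subsetT.
Qed.

Lemma isbI M B : B \in indep M -> rk M setT <= #|B| -> is_basis M B.
Proof. by move=> iB le; rewrite /is_basis iB eqn_leq le card_le_rk ?subsetT. Qed.

Lemma isb_exchange M B1 B2 x : is_basis M B1 -> is_basis M B2 -> x \in B1 :\: B2 ->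
  exists2 y, y \in B2 :\: B1 & is_basis M (y |: B1 :\ x).
Proof.
move=> b1 b2; rewrite inE => /andP[xB2 xB1].
have iB : B1 :\ x \in indep M by apply: indepS (isb_indep b1) _; apply: subD1set.
have e := isb_card b1; rewrite (cardsD1 x) xB1 in e.
have [|y] := indep_exchange iB (isb_indep b2).
  by rewrite (isb_card b2); lia.
rewrite !inE => /andP[]; rewrite negb_and negbK => H yB2 iy.
have yx : y != x by apply: contraNneq xB2 => <-.
move: H; rewrite (negPf yx) /= => yB1; exists y; rewrite ?inE ?yB1 //.
by apply: isbI iy _; rewrite cardsU1 !inE (negPf yB1) andbF; lia.
Qed.

Lemma isb_swap_cl M B x y : is_basis M B -> x \in B -> y \notin B ->
  is_basis M (y |: B :\ x) = ~~ spans M (B :\ x) y.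
Proof.
move=> bB xB yB; have iB : B :\ x \in indep M by apply: indepS (isb_indep bB) _; apply: subD1set.
rewrite -indepU1 ?inE ?(negPf yB) ?andbF // /is_basis.
have := isb_card bB; rewrite (cardsD1 x) xB cardsU1 !inE (negPf yB) andbF => -> /=.
by rewrite eqxx andbT.
Qed.

(** The spanning set is the fundamental circuit of [y] over [B], without [y]. *)
Lemma fund_circuit_cl M B y : is_basis M B -> y \notin B ->
  spans M [set s in B | is_basis M (y |: B :\ s)] y.
Proof.
move=> bB yB; set Z := [set s in B | _]; apply/negPn/negP => ncl.
have sZ : Z \subset B by apply/subsetP => s; rewrite inE => /andP[].
have iZ : Z \in indep M by apply: indepS sZ; apply: isb_indep.
have yZ : y \notin Z by apply: contra yB; apply: subsetP.
have iyZ : y |: Z \in indep M by rewrite indepU1.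
have [|B' [iB' sB' sB'B eB']] := @indep_extend M (y |: Z) (y |: B) iyZ; first exact: setUS.
have eB : rk M (y |: B) = rk M setT by rewrite clE ?isb_cl ?isb_rk.
have c : #|B :\: B'| = 1.
  have yB' : y \in B' by apply: (subsetP sB'); rewrite setU11.
  have := cardsID B' B; rewrite (isb_card bB).
  have -> : B :&: B' = B' :\ y.
    apply/setP => z; have := subsetP sB'B z; rewrite !inE.
    case: eqP => [->|_] /=; first by rewrite (negPf yB).
    by case: (z \in B') => [->|]; rewrite ?andbF.
  by have := cardsD1 y B'; rewrite yB' eB' eB => -> /(canRL (addKn _)) ->; rewrite subSnn.
have [s es] := cards1P (introT eqP c).
have : s \in B :\: B' by rewrite es inE.
rewrite inE => /andP[snB' sB].
have eBs : B' = y |: B :\ s.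
  apply/setP => z; have /setP/(_ z) := es.
  have := subsetP sB'B z; have := subsetP sB' z; rewrite !inE.
  case: (z =P y) => [->|_] /=; first by move=> ->.
  by case: (z \in B'); case: (z \in B); case: (z == s) => //= _ /(_ isT).
have : s \in Z by rewrite inE sB -eBs; apply: isbI iB' _; rewrite eB' eB.
by move=> sZ'; move: snB'; rewrite (subsetP sB') // inE sZ' orbT.
Qed.

Definition loop M x : bool := [set x] \notin indep M.
Definition coloop M x : bool := rk M (~: [set x]) < rk M setT.

Lemma loop_rk M x : loop M x = (rk M [set x] == 0).
Proof. by rewrite /loop indep_rk cards1; have := rk1_le M x; lia. Qed.

Lemma loop_cl M x X : loop M x -> spans M X x.
Proof.
rewrite loop_rk => /eqP e; apply: (@clS _ set0); first exact: sub0set.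
by rewrite /spans setU0 e rk0.
Qed.

Lemma loop_notin M x S : loop M x -> S \in indep M -> x \notin S.
Proof. by move=> l iS; apply: contra l => xS; apply: indepS iS _; rewrite sub1set. Qed.

Lemma rk_loops M X Y : X \subset Y -> (forall y, y \in Y -> y \notin X -> loop M y) -> rk M Y = rk M X.
Proof.
move=> s H; apply: cl_sub_rk s _ => y yY.
by have [/mem_cl-> //|yX] := boolP (y \in X); apply/loop_cl/H.
Qed.

Lemma rk_eq_loops M X Y : (forall y, ~~ loop M y -> (y \in X) = (y \in Y)) -> rk M X = rk M Y.
Proof.
move=> H; transitivity (rk M (X :&: Y)).
  apply: rk_loops (subsetIl _ _) _ => y yX; apply: contraNT => /H.
  by rewrite inE yX => <-.
apply/esym/rk_loops => [|y yY]; first exact: subsetIr.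
by apply: contraNT => /H; rewrite inE yY => ->.
Qed.

Lemma coloopN_basis M b c : ~~ loop M c -> ~~ coloop M b -> b != c ->
  exists B, [/\ is_basis M B, c \in B & b \notin B].
Proof.
rewrite negbK /coloop -leqNgt => ic le bc.
have [|B [iB sB sBb eB]] := @indep_extend M [set c] (~: [set b]) ic.
  by rewrite sub1set !inE eq_sym.
exists B; split.
- by apply: isbI iB _; rewrite eB.
- by rewrite -sub1set.
- by apply/negP => /(subsetP sBb); rewrite !inE eqxx.
Qed.

End Rank.

(** * Exchange graphs of bases *)

Section FundamentalGraph.
Variable T : finType.
Implicit Types (M : matroid T) (B S : {set T}) (x y z : T).

Definition toggle B x y : {set T} := [set z | (z \in B) (+) ((z == x) || (z == y))].

(** Edges of the exchange graph of the basis [B]. It is bipartite, with sides [B]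
    and its complement; the symmetric difference in [toggle] spares naming the sides. *)
Definition adj M B x y : bool := ((x \in B) (+) (y \in B)) && is_basis M (toggle B x y).

Lemma swC B x y : toggle B x y = toggle B y x.
Proof. by apply/setP => z; rewrite !inE orbC. Qed.

Lemma adjC M B x y : adj M B x y = adj M B y x.
Proof. by rewrite /adj addbC swC. Qed.

Lemma adj_sym M B : symmetric (adj M B).
Proof. by move=> x y; apply: adjC. Qed.

Lemma sw_in B x y : x \in B -> y \notin B -> toggle B x y = y |: B :\ x.
Proof.
move=> xB yB; apply/setP => z; rewrite !inE.
have xy : x != y by apply: contraNneq yB => <-.
case: (z =P x) => [->|_]; first by rewrite xB (negPf xy).
by case: (z =P y) => [->|_]; rewrite ?(negPf yB) ?addbF.
Qed.

Lemma adj_in M B x y : x \in B -> y \notin B -> adj M B x y = is_basis M (y |: B :\ x).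
Proof. by move=> xB yB; rewrite /adj xB (negPf yB) sw_in. Qed.

(** Pivoting on the edge [ab] keeps the edges [xy] whose ends are not joined to [a]:
    this is the exchange axiom between the bases to which [ab] and [xy] lead. *)
Lemma pivot_adj M B a b x y : is_basis M B -> adj M B a b -> adj M B x y ->
  x != a -> x != b -> y != a -> y != b -> ~~ adj M B a x -> ~~ adj M B a y ->
  is_basis M (toggle (toggle B a b) x y).
Proof.
move=> bB; wlog xB : x y / x \in B.
  move=> H ab xy xa xb ya yb nx ny; have [xB|xB] := boolP (x \in B); first exact: H.
  have yB : y \in B by move: xy; rewrite /adj (negPf xB) => /andP[].
  by rewrite swC; apply: H => //; rewrite adjC.
move=> ab xy xa xb ya yb nx ny.
have yB : y \notin B by move: xy; rewrite /adj xB => /andP[].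
have xny : x != y by apply: contraNneq yB => <-.
have b1 : is_basis M (toggle B a b) by case/andP: ab.
have b2 : is_basis M (toggle B x y) by case/andP: xy.
have [aB|aB] := boolP (a \in B).
  have bB' : b \notin B by move: ab; rewrite /adj aB => /andP[].
  have [|w] := @isb_exchange _ M (toggle B x y) (toggle B a b) a b2 b1.
    by rewrite !inE aB eqxx /= !(eq_sym a) (negPf xa) (negPf ya).
  rewrite !inE => ww; case/boolP: (w == b) => [/eqP-> bw|wb bw].
    suff <- : b |: toggle B x y :\ a = toggle (toggle B a b) x y by [].
    apply/setP => z; rewrite !inE.
    case: (z =P a) => [->|_]; rewrite ?(eq_sym a) ?(negPf xa) ?(negPf ya) /=.
      by rewrite aB /= orbF; apply/negbTE; apply: contraNneq bB' => ->.
    case: (z =P b) => [->|_] //=; last by rewrite addbF.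
    by rewrite (negPf bB') !(eq_sym b) (negPf xb) (negPf yb).
  have ex : w = x.
    move: ww; rewrite (negPf wb) orbF.
    case: (w =P x) => // _; case: (w =P y) => [->|_] /=; rewrite ?(negPf yB) ?addbF //=.
    by case: (w =P a) => [->|_]; rewrite ?aB ?addbF ?andNb.
  case/negP: ny; rewrite adj_in //; suff <- : w |: toggle B x y :\ a = y |: B :\ a by [].
  rewrite ex; apply/setP => z; rewrite !inE.
  case: (z =P x) => [->|_]; first by rewrite xa xB orbT.
  case: (z =P a) => [->|_]; first by rewrite eq_sym (negPf ya).
  by case: (z =P y) => [->|_]; rewrite ?(negPf yB) ?addbF.
have bB' : b \in B by move: ab; rewrite /adj (negPf aB) => /andP[].
have [|w] := @isb_exchange _ M (toggle B a b) (toggle B x y) x b1 b2.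
  by rewrite !inE xB eqxx /= (negPf xa) (negPf xb).
rewrite !inE => ww; case/boolP: (w == y) => [/eqP-> bw|wy bw].
  suff <- : y |: toggle B a b :\ x = toggle (toggle B a b) x y by [].
  apply/setP => z; rewrite !inE.
  case: (z =P x) => [->|_]; first by rewrite xB (negPf xa) (negPf xb) (negPf xny).
  case: (z =P y) => [->|_] /=; first by rewrite (negPf yB) (negPf ya) (negPf yb).
  by rewrite addbF.
have ex : w = b.
  move: ww; rewrite (negPf wy) orbF.
  case: (w =P b) => // _; case: (w =P x) => [->|_] /=; first by rewrite xB andbF.
  rewrite !orbF addbF; case: (w =P a) => [->|_]; first by rewrite (negPf aB).
  by rewrite addbF andNb.
case/negP: nx; rewrite adjC adj_in //; suff <- : w |: toggle B a b :\ x = a |: B :\ x by [].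
rewrite ex; apply/setP => z; rewrite !inE.
case: (z =P b) => [->|_]; first by rewrite bB' (eq_sym b) xb orbT.
case: (z =P a) => [->|_]; first by rewrite (eq_sym a) xa (negPf aB).
by rewrite addbF.
Qed.

(** Connected elements of an exchange graph lie on a common circuit: pivoting
    along a path between them shortens it until its ends become adjacent. *)
Lemma connect_common_circuit M B x y : is_basis M B -> connect (adj M B) x y -> x != y ->
  exists S, [/\ x \notin S, y \notin S, is_basis M (x |: S) & is_basis M (y |: S)].
Proof.
move=> bB /connectP[p pth ey]; move: {2}(size p) (leqnn (size p)) => m.
elim: m B p bB pth ey => [|m IHm] B p bB pth ey sz xy.
  by case: p sz pth ey => //= _ _ e; rewrite e eqxx in xy.
have [xp|xp] := boolP (x \in p).
  case/splitPr: p / xp pth ey sz => p1 p2.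
  rewrite cat_path last_cat size_cat /= => /and3P[_ _ pth] ey sz.
  by apply: (IHm B p2) => //; lia.
case: p pth ey sz xp => [|z1 p] /=; first by move=> _ e; rewrite e eqxx in xy.
move=> /andP[xz1 pth] ey sz; rewrite inE negb_or => /andP[xz1' xp].
have xz1n : x != z1 by [].
case: p pth ey sz xp => [|z2 p].
  move=> _ /= -> _ _; case/andP: (xz1) => xor bsw.
  have [xB|xB] := boolP (x \in B).
    have z1B : z1 \notin B by move: xor; rewrite xB.
    exists (B :\ x); rewrite !inE eqxx (negPf z1B) andbF setD1K //.
    by split => //; rewrite -sw_in.
  have z1B : z1 \in B by move: xor; rewrite (negPf xB).
  exists (B :\ z1); rewrite !inE eqxx (negPf xB) andbF setD1K //.
  by split => //; rewrite -sw_in // swC.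
move=> pth ey sz xp.
(* an edge from [x] to a later vertex is a shortcut *)
have [|nadj] := boolP (has (adj M B x) (z2 :: p)).
  case/hasP => z zp xz; move: pth ey sz.
  have [p1 [p2 ->]] : exists p1 p2, z2 :: p = p1 ++ z :: p2.
    by move: (z2 :: p) zp => q; case/splitPr=> p1 p2; exists p1, p2.
  rewrite cat_path last_cat size_cat /= => /and3P[_ _ pth] ey sz.
  apply: (IHm B (z :: p2)) => //=; first by rewrite xz.
  by lia.
have nadjP z : z \in z2 :: p -> ~~ adj M B x z by move=> zp; apply: contra nadj => h; apply/hasP; exists z.
have z1p : z1 \notin z2 :: p by apply/negP => /nadjP; rewrite xz1.
have inz z : z \in z2 :: p -> (z != x) && (z != z1).
  by move=> zp; apply/andP; split; [apply: contraNneq xp | apply: contraNneq z1p] => <-.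
(* after the pivot on [x z1] the path goes from [x] to [z2] directly *)
set B' := toggle B x z1.
have bB' : is_basis M B' by case/andP: xz1.
apply: (IHm B' (z2 :: p)) => //.
move: pth => /= /andP[z12 pth]; apply/andP; split.
  have /andP[z2x z2z1] := inz z2 (mem_head _ _).
  rewrite /adj !inE !eqxx (negPf xz1') (negPf z2x) (negPf z2z1) /= addbT addbF.
  have -> : toggle B' x z2 = toggle B z1 z2.
    apply/setP => z; rewrite !inE.
    case: (z =P x) => [->|_]; first by rewrite (negPf xz1n) (eq_sym x z2) (negPf z2x) -addbA.
    case: (z =P z1) => [->|_]; first by rewrite (eq_sym z1 z2) (negPf z2z1) addbF.
    by rewrite addbF.
  case/andP: xz1 z12 => xor _ /andP[xor2 ->]; rewrite andbT.
  by move: xor xor2; case: (x \in B); case: (z1 \in B).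
apply: (sub_in_path (P := mem (z2 :: p))) pth; last by apply/allP.
move=> u v up vp uv; have /andP[ux uz1] := inz u up; have /andP[vx vz1] := inz v vp.
rewrite /adj pivot_adj ?nadjP // andbT !inE.
rewrite (negPf ux) (negPf uz1) (negPf vx) (negPf vz1) /= !addbF.
by case/andP: uv.
Qed.

End FundamentalGraph.

(** * Crossing chords and the splitting of a corner *)

Definition within (p q r : nat) : bool := minn p q < r < maxn p q.
Definition crossing (p q r s : nat) : bool := within p q r (+) within p q s.

(* Arithmetic on positions, in a context cleared of what [lia] cannot use. *)
Ltac poslia := repeat match goal with
  | H : context [@in_mem] |- _ => clear H
  | H : context [@is_basis] |- _ => clear H
  | H : context [@spans] |- _ => clear H
  | H : context [@rk] |- _ => clear H
  | H : context [@adj] |- _ => clear H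
  | H : context [@connect] |- _ => clear H
  | H : context [@loop] |- _ => clear H
  | H : context [@indep] |- _ => clear H
  end; lia.

Section Crossing.
Variable n : nat.
Implicit Types (M : matroid 'I_n) (B S Q X : {set 'I_n}) (b c p q r s x y z w : 'I_n).

Definition replaces M b c : Prop :=
  forall S, b \notin S -> c \notin S -> is_basis M (c |: S) -> is_basis M (b |: S).

(** Around the circle the four elements come in the order p, r, q, s or p, s, q, r,
    so [pr] and [qs] are opposite sides of a quadrilateral and [pq], [rs] are its
    diagonals. The three-term Pluecker relation writes the product of the minors
    at the diagonals as the sum of the two products of minors at opposite sides. *)
Definition noncrossing M : Prop := forall Q p q r s,
  [/\ p != q, p != r, p != s & q != r] -> q != s -> r != s ->
  [&& p \notin Q, q \notin Q, r \notin Q & s \notin Q] ->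
  crossing p q r s ->
  is_basis M (p |: (r |: Q)) -> is_basis M (q |: (s |: Q)) ->
  is_basis M (p |: (q |: Q)) /\ is_basis M (r |: (s |: Q)).

(** The same condition on exchange graphs: when two edges cross, the edges that
    join their ends without crossing are present as well. *)
Lemma crossing_adj M B x y z w : noncrossing M -> is_basis M B -> adj M B x y -> adj M B z w ->
  x != z -> y != w -> x != w -> y != z ->
  (x \in B) = (z \in B) -> crossing x y z w -> adj M B x w /\ adj M B y z.
Proof.
move=> nc bB; wlog xB : x y z w / x \in B.
  move=> H xy zw xz yw xw yz e cr; have [xB|xB] := boolP (x \in B); first exact: H.
  have yB : y \in B by move: xy; rewrite /adj (negPf xB) => /andP[].
  have wB : w \in B by move: zw; rewrite /adj -e (negPf xB) => /andP[].
  have cr' : crossing y x w z by move: cr; rewrite /crossing /within !(minnC y) !(maxnC y) addbC.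
  rewrite adjC in xy; rewrite adjC in zw.
  have [|h1 h2] := H y x w z yB xy zw yw xz yz xw _ cr'; first by rewrite yB wB.
  by split; rewrite // adjC.
move=> xy zw xz yw xw yz e cr.
have zB : z \in B by rewrite -e.
have yB : y \notin B by move: xy; rewrite /adj xB => /andP[].
have wB : w \notin B by move: zw; rewrite /adj zB => /andP[].
have xny : x != y by apply: contraNneq yB => <-.
have znw : z != w by apply: contraNneq wB => <-.
pose Q := B :\ x :\ z.
have b1 : is_basis M (x |: (w |: Q)).
  move: zw; rewrite adj_in // => b; suff -> : x |: (w |: Q) = w |: B :\ z by [].
  apply/setP => u; rewrite !inE; case: (u =P x) => [->|_] //=.
  by rewrite xB xz orbT.
have b2 : is_basis M (y |: (z |: Q)).
  move: xy; rewrite adj_in // => b; suff -> : y |: (z |: Q) = y |: B :\ x by [].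
  apply/setP => u; rewrite !inE; case: (u =P z) => [->|_] //=.
  by rewrite zB (eq_sym z x) xz orbT.
have [|||||b3 b4] := nc Q x y w z _ _ _ _ _ b1 b2.
- by split; rewrite 1?eq_sym // eq_sym.
- by [].
- by rewrite eq_sym.
- by rewrite !inE !eqxx (negPf yB) (negPf wB) !andbF.
- by move: cr; rewrite /crossing addbC.
split.
  rewrite adj_in //; suff <- : w |: (z |: Q) = w |: B :\ x by [].
  apply/setP => u; rewrite !inE; case: (u =P z) => [->|_] //=.
  by rewrite zB (eq_sym z x) xz orbT.
rewrite adjC adj_in //; suff <- : x |: (y |: Q) = y |: B :\ z by [].
apply/setP => u; rewrite !inE; case: (u =P x) => [->|_] //=.
by rewrite xB xz !orbT.
Qed.

Definition consecutive M b c : bool := (b < c) && [forall x : 'I_n, (b < x < c) ==> loop M x].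

Lemma near_loop M b c x : consecutive M b c -> b < x -> x < c -> loop M x.
Proof. by case/andP => _ /forallP /(_ x) /implyP H bx xc; apply: H; rewrite bx xc. Qed.

Lemma near_sub N M b c : (forall x, loop M x -> loop N x) -> consecutive M b c -> consecutive N b c.
Proof.
move=> H /andP[bc /forallP h]; rewrite /consecutive bc; apply/forallP => x; apply/implyP => h'.
by apply/H/(implyP (h x)).
Qed.

Definition segment (i j : nat) : {set 'I_n} := [set x : 'I_n | i <= x < j].

(** The hypotheses say that the greedy basis from [i] on contains [b] but not [c].
    Suppose that [b] cannot replace [c] in some basis. Some [y0] before [b] can, and
    the edge from [c] to [y0] traps the fundamental circuit of [b]: an element
    of it on the other side would give a crossing edge, and with it an edge [bc].
    Hence [b] would be spanned by the elements before it. *)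
Lemma corner_replace M i b c : noncrossing M -> consecutive M b c ->
  ~~ spans M (segment i b) b -> spans M (b |: segment i b) c -> replaces M b c.
Proof.
move=> nc nr nb cc S bS cS bas; apply/negPn/negP => nbas.
have bc : b < c by case/andP: nr.
have bnc : b != c by rewrite -val_eqE /=; poslia.
set B := c |: S in bas.
have cB : c \in B by rewrite setU11.
have bB : b \notin B by rewrite !inE (negPf bnc).
have BcS : B :\ c = S by rewrite setU1K.
have bcl : spans M (B :\ c) b by apply/negPn; rewrite -isb_swap_cl ?BcS.
have [y0 y0Y ny0] : exists2 y0, y0 \in segment i b & ~~ spans M (B :\ c) y0.
  apply/exists_inP; rewrite -negb_forall_in; apply/negP => /forall_inP H.
  have : spans M (B :\ c) c.
    apply: cl_trans cc => y; rewrite !inE => /orP[/eqP -> //|yi]; apply: H; by rewrite inE.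
  have -> : spans M (B :\ c) c = false; last by [].
  apply/negbTE; rewrite -indepU1 ?setD11 ?setD1K ?(isb_indep bas) //.
  by apply: indepS (isb_indep bas) _; apply: subD1set.
have y0b : y0 < b by move: y0Y; rewrite inE => /andP[].
have y0B : y0 \notin B.
  have [|//] := boolP (y0 \in B) => y0B; case/negP: ny0; apply: mem_cl.
  by rewrite in_setD1 y0B andbT -val_eqE neq_ltn (ltn_trans y0b bc).
case/negP: nb; apply: clS (fund_circuit_cl bas bB).
apply/subsetP => s; rewrite inE => /andP[sB bs].
have sc : s != c.
  by apply: contraNneq nbas => es; rewrite -BcS -es.
have sl : ~~ loop M s by apply: contraL sB => l; apply: loop_notin l (isb_indep bas).
have sb : s != b by apply: contraNneq bB => <-.
have sy0 : s != y0 by apply: contraNneq y0B => <-.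
have [/andP[lo hi]|out] := boolP (y0 < s < c).
  have [lt|ge] := ltnP s b; first by move: y0Y; rewrite !inE; poslia.
  have sb' : b < s by move: sb; rewrite -val_eqE /=; poslia.
  by rewrite (near_loop nr sb' hi) in sl.
have [||||||||] := @crossing_adj M B c y0 s b nc bas.
- by rewrite adj_in // isb_swap_cl.
- by rewrite adj_in.
- by rewrite eq_sym.
- by rewrite -val_eqE /=; poslia.
- by rewrite eq_sym.
- by rewrite eq_sym.
- by rewrite cB sB.
- move: out sc sy0; rewrite /crossing /within -!val_eqE /=; poslia.
by rewrite adj_in // BcS (negPf nbas).
Qed.

End Crossing.

Section Conn.
Variable T : finType.
Implicit Types (M : matroid T) (B S X Y Z : {set T}) (x y s : T).

(** The connectivity function, shifted by the rank: its minimum is [rk M setT]. *)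
Definition connectivity M X : nat := rk M X + rk M (~: X).

Lemma connC M X : connectivity M (~: X) = connectivity M X.
Proof. by rewrite /connectivity setCK addnC. Qed.

Lemma connT M : connectivity M setT = rk M setT.
Proof. by rewrite /connectivity setCT rk0 addn0. Qed.

Lemma conn_submod M X Y : connectivity M (X :&: Y) + connectivity M (X :|: Y) <= connectivity M X + connectivity M Y.
Proof.
rewrite /connectivity setCI setCU; have := rk_submod M X Y.
by have := rk_submod M (~: X) (~: Y); poslia.
Qed.

Lemma conn_uncross M X Y a : connectivity M X + connectivity M Y <= a + connectivity M (X :|: Y) ->
  connectivity M (X :&: Y) <= a.
Proof. by have := conn_submod M X Y; lia. Qed.

Lemma conn_eq_loops M X Y : (forall y, ~~ loop M y -> (y \in X) = (y \in Y)) -> connectivity M X = connectivity M Y.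
Proof.
move=> H; congr (_ + _); first exact: rk_eq_loops.
by apply: rk_eq_loops => y /H; rewrite !inE => ->.
Qed.

(** [B :&: Z] spans [X], because it contains the fundamental circuits of the
    elements of [X]. *)
Lemma rk_le_graph M B X Z : is_basis M B -> (forall y, y \in X -> y \in B -> y \in Z) ->
  (forall y s, y \in X -> y \notin B -> s \in B -> adj M B s y -> s \in Z) ->
  rk M X <= #|B :&: Z|.
Proof.
move=> bB H1 H2; have iZ : B :&: Z \in indep M by apply: indepS (isb_indep bB) _; apply: subsetIl.
rewrite -(rk_indep iZ) -(@cl_rkU _ M (B :&: Z) X); first by apply: rkS; apply: subsetUr.
move=> y yX; have [yB|yB] := boolP (y \in B); first by apply: mem_cl; rewrite inE yB H1.
apply: clS (fund_circuit_cl bB yB); apply/subsetP => s; rewrite !inE => /andP[sB bs].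
by rewrite sB (H2 y) // adj_in.
Qed.

Lemma connect_cut (e : rel T) (f : pred T) p q : connect e p q -> f p != f q ->
  exists u w, [/\ connect e p u, e u w & f u != f w].
Proof.
case/connectP => l; elim: l p => [|z l IHl] p /=; first by move=> _ ->; rewrite eqxx.
case/andP => pz zl eq fpq; have [e1|ne] := eqVneq (f p) (f z).
  have [|u [w [c1 e2 f2]]] := IHl z zl eq; first by rewrite -e1.
  by exists u, w; split => //; apply: connect_trans c1; apply: connect1.
by exists p, z; split => //; apply: connect0.
Qed.

End Conn.

Section Split.
Variable n : nat.
Implicit Types (M : matroid 'I_n) (B S Q X : {set 'I_n}) (b c p q r s x y z w : 'I_n).

(** Models the replacement of the vector [b] by a combination [b - a c] that has no
    [c]-component over any basis containing [c]. This can only affect sets that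
    contain [b] but not [c]. *)
Definition corner_degen M M' b c : Prop :=
  (forall X, (b \notin X) || (c \in X) -> is_basis M' X = is_basis M X) /\
  (forall S, b \notin S -> c \notin S -> is_basis M' (b |: S) -> is_basis M' (c |: S) -> False).

Definition corner_side M b c E : Prop := [/\ connectivity M E <= (rk M setT).+1,
  connectivity M (b |: E) <= (rk M setT).+1 & connectivity M (E :\ c) <= (rk M setT).+1].

(** Passing to [M'] removes only the edge [bc] from the exchange graph of [B], and
    separates [b] from [c]: a path would put them on a common circuit. Components
    that cross would be joined by the edges of [crossing_adj], so the component of
    [c] or that of [b] spans an interval which is a union of components. The edge
    [bc] is the only one of [M] that leaves it, so its connectivity is at most one
    above the minimum, with or without [b] and [c]. *)
Lemma corner_split M M' B b c : noncrossing M -> consecutive M b c -> corner_degen M M' b c ->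
  is_basis M B -> c \in B -> b \notin B ->
  exists E : {set 'I_n},
   [/\ c \in E, b \notin E, corner_side M b c E &
     (exists2 j, c < j & E = segment n c j) \/ (exists2 j, j <= b & ~: E = segment n j b.+1)].
Proof.
move=> nc nr [h1 h2] bB cB bB'.
have bc : b < c by case/andP: nr.
have bnc : b != c by rewrite -val_eqE /=; poslia.
have bB1 : is_basis M' B by rewrite h1 ?bB'.
pose e := adj M' B.
have e_sym : connect_sym e by apply: sym_connect_sym; apply: adj_sym.
have ebc : ~~ e b c.
  apply/negP; rewrite /e adjC adj_in // => b1.
  by apply: (h2 (B :\ c)); rewrite ?setD11 ?setD1K // !inE (negPf bB') andbF.
have e_adj x y : e x y = adj M B x y && ~~ (((x == b) && (y == c)) || ((x == c) && (y == b))).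
  have [/andP[/eqP-> /eqP->]|n1] /= := boolP ((x == b) && (y == c)).
    by rewrite andbF (negPf ebc).
  have [/andP[/eqP-> /eqP->]|n2] /= := boolP ((x == c) && (y == b)).
    by rewrite andbF /e adjC -/(e b c) (negPf ebc).
  rewrite andbT /e /adj h1 // !inE (negPf bB') cB !(eq_sym b) !(eq_sym c) /=.
  case: (x =P b) n1 n2 => [->|_]; first by rewrite (negPf bnc) => /= ->.
  by case: (y =P b) => [->|_] //; rewrite (negPf bnc) andbT => _ /negPf ->.
have e_loop x y : e x y -> ~~ loop M x.
  rewrite e_adj => /andP[/andP[xor bs] _]; apply/negP => l.
  have xB := loop_notin l (isb_indep bB).
  by have := loop_notin l (isb_indep bs); rewrite !inE (negPf xB) eqxx.
have e_nl p q : connect e p q -> p != q -> ~~ loop M q.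
  move=> pq pnq; have [|u [w [_ uw]]] := @connect_cut _ e (pred1 q) p q pq.
    by rewrite /= eqxx (negPf pnq).
  rewrite /=; case: (u =P q) => [<- _|_]; first exact: e_loop uw.
  by case: (w =P q) => // <- _; apply: (@e_loop w u); rewrite /e adjC.
(* distinct components do not cross *)
have NC p q r s : connect e p q -> connect e r s -> ~~ connect e p r -> crossing p q r s -> False.
  move=> pq rs npr cr.
  have dst x y : connect e p x -> connect e r y -> (x : nat) <> y.
    move=> px ry /val_inj xy; case/negP: npr; apply: connect_trans px _.
    by rewrite xy e_sym.
  have [|u [w [pu uw cuw]]] := @connect_cut _ e (fun x => within r s x) p q pq.
    move: (dst p r (connect0 e p) (connect0 e r)) (dst p s (connect0 e p) rs).
    move: (dst q r pq (connect0 e r)) (dst q s pq rs) cr; rewrite /crossing /within.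
    by poslia.
  have pw : connect e p w by apply: connect_trans pu _; apply: connect1.
  have [|u' [w' [ru' uw' cuw']]] := @connect_cut _ e (fun x => within u w x) r s rs.
    move: (dst u r pu (connect0 e r)) (dst u s pu rs).
    move: (dst w r pw (connect0 e r)) (dst w s pw rs) cuw; rewrite /within.
    by poslia.
  have rw' : connect e r w' by apply: connect_trans ru' _; apply: connect1.
  have dn x y : connect e p x -> connect e r y -> x != y by move=> px ry; apply/eqP => xy; apply: (dst x y) => //; rewrite xy.
  have bad x y : connect e p x -> connect e r y -> ~~ e x y.
    move=> px ry; apply: contra npr => xy; apply: connect_trans px _.
    by apply: connect_trans (connect1 xy) _; rewrite e_sym.
  have au : adj M B u w by move: uw; rewrite e_adj => /andP[].
  have au' : adj M B u' w' by move: uw'; rewrite e_adj => /andP[].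
  have unw : u != w by apply: contraNneq cuw => ->.
  have fin x y : connect e r x -> connect e r y -> adj M B u x -> adj M B w y -> False.
    move=> rx ry ax ay.
    move: (bad u x pu rx) (bad w y pw ry); rewrite !e_adj ax ay /= !negbK.
    by case/orP => /andP[/eqP e1 /eqP e2] /orP[] /andP[/eqP e3 /eqP e4];
      move: unw (dn w x pw rx); rewrite e1 e2 e3 eqxx.
  have u'nw' : u' != w' by apply: contraNneq cuw' => ->.
  have [eB|nB] := eqVneq (u \in B) (u' \in B).
    have [|||||a1 a2] := crossing_adj nc bB au au' _ _ _ _ eB; rewrite ?dn //.
      by move: cuw'; rewrite /crossing; case: within; case: within.
    exact: (fin w' u').
  rewrite adjC in au'.
  have eB : (u \in B) = (w' \in B).
    by move: nB au'; rewrite /adj; case: (u \in B); case: (w' \in B); case: (u' \in B).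
  have [|||||a1 a2] := crossing_adj nc bB au au' _ _ _ _ eB; rewrite ?dn //.
    by move: cuw'; rewrite /crossing; case: within; case: within.
  exact: (fin u' w').
have ncb : ~~ connect e c b.
  apply/negP => cb; have [|S [cS bS i1 i2]] := connect_common_circuit bB1 cb; first by rewrite eq_sym.
  exact: (h2 S).
(* [E] is a union of components *)
have bounds (E : {set 'I_n}) : c \in E -> b \notin E -> (forall x y, e x y -> x \in E -> y \in E) ->
    corner_side M b c E.
  move=> cE bE clo.
  have clo' x y : e x y -> x \notin E -> y \notin E.
    by move=> xy; apply: contra; apply: clo; rewrite /e adjC.
  have cardB : #|B :&: E| + #|B :&: ~: E| = rk M setT by rewrite -(isb_card bB) -(cardsID E B) setDE.
  have r1 : rk M E <= #|B :&: E|.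
    apply: rk_le_graph => // y s yE yB sB sy; apply: clo (yE); rewrite /e adjC -/(e s y) e_adj sy /=.
    apply/norP; split; first by apply/nandP; left; apply: contraNneq bB' => <-.
    by apply/nandP; right; apply: contraNneq bE => <-.
  have r2 : rk M (c |: ~: E) <= #|B :&: ~: E|.+1.
    have -> : #|B :&: ~: E|.+1 = #|B :&: (c |: ~: E)|.
      have -> : B :&: (c |: ~: E) = c |: (B :&: ~: E).
        by apply/setP => z; rewrite !inE; case: (z =P c) => [->|]; rewrite ?cB.
      by rewrite cardsU1 !inE cE cB.
    apply: rk_le_graph => // y s; rewrite !inE => yE yB sB sy.
    have [//|sc] := eqVneq s c; apply: (clo' y).
      rewrite /e adjC -/(e s y) e_adj sy (negPf sc) /= orbF negb_and.
      by apply/orP; left; apply: contraNneq bB' => <-.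
    by move: yE; case: (y =P c) yB => // ->; rewrite cB.
  have r3 : rk M (~: (b |: E)) <= #|B :&: ~: E|.
    apply: rk_le_graph => // [y|y s].
      by rewrite !inE negb_or => /andP[].
    rewrite !inE negb_or => /andP[yb yE] yB sB sy; apply: (clo' y) (yE); rewrite /e adjC -/(e s y) e_adj sy (negPf yb) andbF orbF /=.
    by apply/nandP; left; apply: contraNneq bB' => <-.
  rewrite /corner_side /connectivity; split.
  - have : rk M (~: E) <= rk M (c |: ~: E) by apply: rkS; apply: subsetUr.
    by move: r1 r2 cardB; poslia.
  - apply: leq_trans (leq_add (rkU1_le _ _ _) r3) _.
    by rewrite addSn ltnS -cardB leq_add2r.
  - have -> : ~: (E :\ c) = c |: ~: E by rewrite setDE setCI setCK setUC.
    have : rk M (E :\ c) <= rk M E by apply: rkS; apply: subD1set.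
    by move: r1 r2 cardB; poslia.
have [/exists_inP[k0 ck0 k0c]|] := boolP [exists (k | connect e c k), k < c]; last first.
  move=> /exists_inPn nlt.
  have ccc : connect e c c by apply: connect0.
  have [j cj jmax] := @arg_maxnP _ c (fun i => connect e c i) (fun i => i : nat) ccc.
  have cle : c <= j by apply: jmax.
  exists (segment n c j.+1).
  have cE : c \in segment n c j.+1 by rewrite inE; poslia.
  have bE : b \notin segment n c j.+1 by rewrite inE; poslia.
  split=> //; last by left; exists j.+1 => //; poslia.
  apply: bounds => // x y xy xE; apply/negPn/negP => yE.
  have [cx|cx] := boolP (connect e c x).
    have cy : connect e c y by apply: connect_trans cx _; apply: connect1.
    by have := nlt y cy; have := jmax y cy; move: yE; rewrite inE; poslia.
  apply: (NC c j x y) => //; first exact: connect1.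
  have : (x : nat) <> c by move=> /val_inj xc; rewrite xc connect0 in cx.
  have : (x : nat) <> j by move=> /val_inj xc; rewrite xc cj in cx.
  by move: xE yE; rewrite !inE /crossing /within; poslia.
have k0b : k0 < b.
  have [//|ge] := ltnP k0 b.
  have k0nb : (k0 : nat) <> b by move=> /val_inj e0; rewrite -e0 ck0 in ncb.
  have : ~~ loop M k0 by apply: (e_nl c) => //; rewrite -val_eqE /=; poslia.
  by rewrite (near_loop nr) //; poslia.
have bmax k : connect e b k -> k <= b.
  move=> bk; have [//|lt] := leqP k b.
  have knc : (k : nat) <> c by move=> /val_inj e0; rewrite -e0 e_sym bk in ncb.
  have kc : c < k.
    have [//|ge] := ltnP c k.
    have : ~~ loop M k by apply: (e_nl b) => //; rewrite -val_eqE /=; poslia.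
    by rewrite (near_loop nr) //; poslia.
  exfalso; apply: (NC c k0 b k) => //.
  by rewrite /crossing /within; poslia.
have bbb : connect e b b by apply: connect0.
have [j bj jmin] := @arg_minnP _ b (fun i => connect e b i) (fun i => i : nat) bbb.
have jle : j <= b by apply: bmax.
exists (~: segment n j b.+1).
have cE : c \in ~: segment n j b.+1 by rewrite !inE; poslia.
have bE : b \notin ~: segment n j b.+1 by rewrite !inE; poslia.
split=> //; last by right; exists j; rewrite ?setCK.
apply: bounds => // x y xy xE; apply/negPn/negP => yE.
have [bx|bx] := boolP (connect e b y).
  have by' : connect e b x by apply: connect_trans bx _; rewrite e_sym; apply: connect1.
  by have := bmax x by'; have := jmin x by'; move: xE; rewrite !inE; poslia.
apply: (NC b j y x) => //; first by rewrite e_sym; apply: connect1.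
have : (y : nat) <> b by move=> /val_inj xc; rewrite xc connect0 in bx.
have : (y : nat) <> j by move=> /val_inj xc; rewrite xc bj in bx.
by move: xE yE; rewrite !inE /crossing /within; poslia.
Qed.

End Split.

Section Reduction.
Variable n : nat.
Variable M : matroid 'I_n.
Implicit Types (B S Q X Y : {set 'I_n}) (b c p q r s x y z w : 'I_n).

(** By [corner_replace] the hypotheses hold wherever a greedy basis takes [b] and
    omits [c]. *)
Definition degenerate_corners (N : matroid 'I_n) : Prop := forall b c,
  consecutive N b c -> ~~ loop N b -> ~~ loop N c -> ~~ coloop N b ->
  replaces N b c ->
  exists N', corner_degen N N' b c.

Definition tight_pair : Prop := exists b c,
  [/\ consecutive M b c, ~~ loop M b, ~~ loop M c & connectivity M [set b; c] <= (rk M setT).+1].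

Definition nonloops X : {set 'I_n} := [set x in X | ~~ loop M x].

Lemma nlP X x : (x \in nonloops X) = (x \in X) && ~~ loop M x.
Proof. by rewrite inE. Qed.

Lemma rk_nl X : rk M (nonloops X) = rk M X.
Proof. by apply: rk_eq_loops => y ly; rewrite inE ly andbT. Qed.

Lemma near_prev (i : nat) x y0 : y0 \in nonloops (segment n i x) ->
  exists b, [/\ b \in nonloops (segment n i x), consecutive M b x &
    forall y, ~~ loop M y -> (y \in segment n i x) = (y \in b |: segment n i b)].
Proof.
move=> y0i.
have [b bi bmax] := @arg_maxnP _ y0 (fun z => z \in nonloops (segment n i x)) (fun z => z : nat) y0i.
have bx : i <= b < x by move: bi; rewrite !inE => /andP[].
have mx z : ~~ loop M z -> i <= z < x -> z <= b by move=> lz zi; apply: bmax; rewrite !inE zi lz.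
exists b; split=> //.
  apply/andP; split; first by case/andP: bx.
  apply/forallP => z; apply/implyP => bzx; apply: contraT => lz.
  have := mx z lz; move: bx bzx; clear; lia.
move=> y ly; rewrite !inE -val_eqE /=; have := mx y ly; move: bx; clear; lia.
Qed.

Lemma cl_eq_loops X Y x : ~~ loop M x -> (forall y, ~~ loop M y -> (y \in X) = (y \in Y)) -> spans M X x = spans M Y x.
Proof.
move=> lx H; rewrite /spans (rk_eq_loops H); congr (_ == _); apply: rk_eq_loops => y ly.
by rewrite !inE H.
Qed.

(** If the greedy basis from [i] on never takes an element and omits the next one,
    it takes all nonloops of the interval. *)
Lemma no_corner_indep (i j : nat) :
  (forall b c, consecutive M b c -> b \in nonloops (segment n i j) -> c \in nonloops (segment n i j) ->
     ~~ spans M (segment n i b) b -> ~~ spans M (b |: segment n i b) c) ->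
  nonloops (segment n i j) \in indep M.
Proof.
move=> H.
have jump m x : x < m -> x \in nonloops (segment n i j) -> ~~ spans M (segment n i x) x.
  elim: m x => // m IHm x xm xj.
  have lx : ~~ loop M x by move: xj; rewrite inE => /andP[].
  have [/set0Pn [y yi]|/negPn/eqP nlx] := boolP (nonloops (segment n i x) != set0).
    have [b [bi nr eqb]] := near_prev yi.
    rewrite (cl_eq_loops lx eqb).
    have bj : b \in nonloops (segment n i j) by move: bi xj; rewrite !inE => /andP[h ->] /andP[h1 _]; move: h h1; clear; lia.
    apply: H => //; apply: IHm => //.
    by case/andP: nr => bx _; move: bx xm; clear; lia.
  have e0 : rk M (segment n i x) = 0 by rewrite -rk_nl nlx rk0.
  apply: contra lx; rewrite loop_rk /spans e0 => /eqP e1.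
  by rewrite -leqn0 -e1; apply: rkS; rewrite sub1set setU11.
suff K m : m <= j -> nonloops (segment n i m) \in indep M by apply: K.
elim: m => [|m IHm] mj.
  suff -> : nonloops (segment n i 0) = set0 by apply: indep0.
  by apply/setP => x; rewrite !inE ltn0 andbF.
have im := IHm (ltnW mj).
have [/existsP[x /andP[/eqP xm xi]]|] := boolP [exists x : 'I_n, (x == m :> nat) && (x \in nonloops (segment n i m.+1))].
  have -> : nonloops (segment n i m.+1) = x |: nonloops (segment n i m).
    apply/setP => y; rewrite !inE; have [->|yx] := eqVneq y x.
      by move: xi; rewrite !inE.
    move: yx; rewrite -val_eqE /= xm => yx; congr (_ && _).
    by move: yx; clear; lia.
  rewrite indepU1 //; last by rewrite !inE xm ltnn andbF.
  have -> : spans M (nonloops (segment n i m)) x = spans M (segment n i x) x.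
    apply: cl_eq_loops; first by move: xi; rewrite inE => /andP[].
    by move=> y ly; rewrite !inE ly andbT xm.
  apply: (jump x.+1) => //; move: xi; rewrite !inE => /andP[h ->]; move: h mj xm; clear; lia.
move/existsPn => H'; suff -> : nonloops (segment n i m.+1) = nonloops (segment n i m) by [].
apply/setP => y; have := H' y; rewrite !inE negb_and.
have [ym|ym] := eqVneq (y : nat) m; last by move=> _; congr (_ && _); move: ym; clear; lia.
by rewrite ym ltnn andbF => /negPf.
Qed.

(** Among the intervals that have two nonloops and connectivity at most one above the
    minimum, a shortest one has no third nonloop. If it is independent, any two
    consecutive elements of it will do. Otherwise it contains a corner, and the
    interval of [corner_split], or its intersection with the given one, is
    shorter; submodularity bounds the connectivity of intersections. *)
Lemma reduction_pair_iv : noncrossing M -> degenerate_corners M ->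
  (forall x, ~~ loop M x -> ~~ coloop M x) ->
  forall m (i j : nat), #|nonloops (segment n i j)| <= m -> 2 <= #|nonloops (segment n i j)| ->
  connectivity M (segment n i j) <= (rk M setT).+1 ->
  tight_pair.
Proof.
move=> nc dc ncl; elim=> [|m IHm] i j cm c2 cX; first by move: cm c2; clear; lia.
set k := rk M setT in cX IHm *.
pose X := segment n i j.
have nlX x : (x \in nonloops X) = (i <= x < j) && ~~ loop M x by rewrite !inE.
(* an interval inside [X] that misses the nonloop [z] of [X] is shorter *)
have IH (i' j' : nat) b c z : b \in nonloops X -> c \in nonloops X -> b != c -> i' <= b < j' -> i' <= c < j' ->
    z \in nonloops X -> ~~ (i' <= z < j') -> i <= i' -> j' <= j -> connectivity M (segment n i' j') <= k.+1 ->
    tight_pair.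
  move=> bX cX' bc bi ci zX zi ii jj cn.
  have sub : nonloops (segment n i' j') \subset nonloops X :\ z.
    apply/subsetP => y; rewrite in_setD1 nlX !inE => /andP[yi ->]; rewrite andbT.
    apply/andP; split; first by apply: contraNneq zi => <-.
    by move: yi ii jj; clear; lia.
  apply: (IHm i' j') => //.
    rewrite -ltnS; apply: leq_trans _ cm; rewrite (cardsD1 z (nonloops X)) zX ltnS.
    exact: subset_leq_card.
  have <- : #|[set b; c]| = 2 by rewrite cards2 bc.
  apply/subset_leq_card/set2_sub; rewrite !inE ?bi ?ci.
    by move: bX; rewrite nlX => /andP[].
  by move: cX'; rewrite nlX => /andP[].
have [e2|ne2] := eqVneq #|nonloops X| 2.
  have /cards2P[x [y [xy eX]]] : #|nonloops X| == 2 by rewrite e2.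
  have {}fin b c : b < c -> nonloops X = [set b; c] ->
      tight_pair.
    move=> bc eXbc.
    have bX : b \in nonloops X by rewrite eXbc !inE eqxx.
    have cX' : c \in nonloops X by rewrite eXbc !inE eqxx orbT.
    exists b, c; split.
    - apply/andP; split => //; apply/forallP => z; apply/implyP => bzc; apply: contraT => lz.
      have : z \in nonloops X by move: bX cX'; rewrite !nlX lz andbT => /andP[h _] /andP[h' _]; move: h h' bzc; clear; lia.
      by rewrite eXbc !inE -!val_eqE /=; move: bzc; clear; lia.
    - by move: bX; rewrite nlX => /andP[].
    - by move: cX'; rewrite nlX => /andP[].
    - by rewrite -eXbc (@conn_eq_loops _ M _ X) // => u lu; rewrite inE lu andbT.
  have [lt|ge] := ltnP x y; first exact: fin lt eX.
  apply: (fin y x); last by rewrite eX setUC.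
  by move: xy ge; rewrite -val_eqE /=; clear; lia.
have c3 : 2 < #|nonloops X| by move: c2 ne2; rewrite -/X; clear; lia.
have third b c : b != c -> b \in nonloops X -> c \in nonloops X -> exists2 z, z \in nonloops X & (z != b) && (z != c).
  move=> bc bX cX'; have : 0 < #|nonloops X :\: [set b; c]|.
    rewrite cardsD (setIidPr _) ?set2_sub // cards2 bc.
    by move: c3; clear; lia.
  by case/card_gt0P => z; rewrite in_setD in_set2 negb_or => /andP[h2 h1]; exists z.
have [/existsP[b /existsP[c /and5P[nr bX cX' nb cc]]]|] := boolP [exists b : 'I_n, exists c : 'I_n,
    [&& consecutive M b c, b \in nonloops X, c \in nonloops X, ~~ spans M (segment n i b) b & spans M (b |: segment n i b) c]]; last first.
  move=> H; have iX : nonloops X \in indep M.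
    apply: no_corner_indep => b c nr bX cX' nb; apply: contra H => cc.
    by apply/existsP; exists b; apply/existsP; exists c; apply/and5P; split.
  have [c cX' cne] : exists2 c, c \in nonloops X & nonloops (segment n i c) != set0.
    have [x xX] : exists x, x \in nonloops X by apply/card_gt0P; apply: leq_trans c3.
    have [y yX yx] : exists2 y, y \in nonloops X & y != x.
      have : 0 < #|nonloops X :\ x|.
        by have e := cardsD1 x (nonloops X); rewrite xX add1n in e; rewrite -ltnS -e; apply: leq_trans c3.
      by case/card_gt0P => y; rewrite in_setD1 => /andP[]; exists y.
    have mem u v : u \in nonloops X -> u < v -> nonloops (segment n i v) != set0.
      move=> uX uv; apply/set0Pn; exists u; move: uX; rewrite nlX !inE => /andP[h ->]; rewrite andbT.
      by move: h uv; clear; lia.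
    have [lt|ge] := ltnP x y; first by exists y => //; apply: mem lt.
    exists x => //; apply: (mem y) => //.
    by move: yx ge; rewrite -val_eqE /=; clear; lia.
  case/set0Pn: cne => y yi.
  have [b [bi nr _]] := near_prev yi.
  have bX : b \in nonloops X.
    move: bi cX'; rewrite !inE => /andP[h ->] /andP[h1 _]; move: h h1; clear; lia.
  have bc : b != c by case/andP: nr => bc _; rewrite -val_eqE /=; move: bc; clear; lia.
  exists b, c; split => //.
  - by move: bX; rewrite nlX => /andP[].
  - by move: cX'; rewrite nlX => /andP[].
  have r1 : rk M X = #|nonloops X| by rewrite -rk_nl rk_indep.
  have r2 : rk M (nonloops X :\: [set b; c]) + 2 = #|nonloops X|.
    rewrite rk_indep; last by apply: indepS iX _; apply: subsetDl.
    by rewrite -(cardsID [set b; c] (nonloops X)) (setIidPr _) ?set2_sub // cards2 bc addnC.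
  have r3 : rk M (~: [set b; c]) <= rk M (~: X) + rk M (nonloops X :\: [set b; c]).
    rewrite -(@rk_eq_loops _ M (~: X :|: (nonloops X :\: [set b; c])) (~: [set b; c])) ?rkU_le // => u lu.
    rewrite in_setU in_setD nlX lu andbT !in_setC.
    have -> : (i <= u < j) = (u \in X) by rewrite inE.
    case: (boolP (u \in X)) => [uX|uX] /=; first by rewrite andbT.
    apply/esym; apply: contra uX; rewrite !inE => /orP[] /eqP->.
      by move: bX; rewrite nlX => /andP[].
    by move: cX'; rewrite nlX => /andP[].
  have r4 : rk M [set b; c] <= 2 by apply: leq_trans (rk_le_card _ _) _; rewrite cards2 bc.
  have ar (a d : nat) : 2 + (a + d) <= d + 2 + a by clear; lia.
  apply: leq_trans (leq_add r4 r3) (leq_trans _ cX).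
  by rewrite -/X /connectivity r1 -r2 ar.
have [bi lb] : i <= b < j /\ ~~ loop M b by move: bX; rewrite nlX => /andP[].
have [ci lc] : i <= c < j /\ ~~ loop M c by move: cX'; rewrite nlX => /andP[].
have bc : b < c by case/andP: nr.
have bnc : b != c by rewrite -val_eqE /=; move: bc; clear; lia.
have gap z : ~~ loop M z -> z <= b \/ c <= z.
  move=> lz; have [?|lt1] := leqP z b; [by left|]; have [?|lt2] := leqP c z; [by right|].
  by rewrite (near_loop nr lt1 lt2) in lz.
have rep := corner_replace nc nr nb cc.
have [M' dg] := dc b c nr lb lc (ncl b lb) rep.
have [B [bB cB bB']] := coloopN_basis lc (ncl b lb) bnc.
have [E [cE bE [cn cnb cnc] shape]] := corner_split nc nr dg bB cB bB'.
have [z0 z0X z0bc] := third b c bnc bX cX'.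
have [z0b z0c] : (z0 : nat) <> b /\ (z0 : nat) <> c.
  by case/andP: z0bc => h1 h2; split=> /val_inj e; [rewrite e eqxx in h1 | rewrite e eqxx in h2].
have z0i : i <= z0 < j by move: z0X; rewrite nlX => /andP[].
have lz0 : ~~ loop M z0 by move: z0X; rewrite nlX => /andP[].
(* the interval of the splitting may have one nonloop only; then it is extended
   to the other element of the corner *)
have candR (j' : nat) : c < j' <= j -> connectivity M (segment n c j') <= k.+1 -> connectivity M (segment n b j') <= k.+1 ->
    tight_pair.
  move=> cj c1 c2'; have [/existsP[z /andP[zX zo]]|] := boolP [exists z, (z \in nonloops X) && ~~ (b <= z < j')].
    by apply: (IH b j' b c z) => //; move: cj bc bi; clear; lia.
  move=> /existsPn H; have := H z0; rewrite z0X negbK => z0j.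
  have cz0 : c <= z0 by case: (gap z0 lz0) => // h; move: h z0j z0b; clear; lia.
  apply: (IH c j' c z0 b) => //; try (move: cj bc bi z0j cz0; clear; lia).
  by apply/eqP => e; apply: z0c; rewrite e.
have candL (j' : nat) : i <= j' <= b -> connectivity M (segment n j' b.+1) <= k.+1 -> connectivity M (segment n j' c.+1) <= k.+1 ->
    tight_pair.
  move=> bj c1 c2'; have [/existsP[z /andP[zX zo]]|] := boolP [exists z, (z \in nonloops X) && ~~ (j' <= z < c.+1)].
    by apply: (IH j' c.+1 b c z) => //; move: bj bc bi ci; clear; lia.
  move=> /existsPn H; have := H z0; rewrite z0X negbK => z0j.
  have bz0 : z0 <= b by case: (gap z0 lz0) => // h; move: h z0j z0c; clear; lia.
  apply: (IH j' b.+1 b z0 c) => //; try (move: bj bc bi ci z0j bz0; clear; lia).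
  by apply/eqP => e; apply: z0b; rewrite e.
have iv_bU (j' : nat) : connectivity M (b |: segment n c j') = connectivity M (segment n b j') \/ j' <= c.
  have [h|h] := leqP j' c; [by right|left]; apply: conn_eq_loops => y ly.
  rewrite !inE -val_eqE /=; have := gap y ly; move: h bc; clear; lia.
have iv_cU (j' : nat) : j' <= b -> connectivity M (c |: segment n j' b.+1) = connectivity M (segment n j' c.+1).
  move=> h; apply: conn_eq_loops => y ly.
  rewrite !inE -val_eqE /=; have := gap y ly; move: h bc; clear; lia.
have cnc' : connectivity M (c |: ~: E) <= k.+1.
  by rewrite -connC setCU setCK setIC -setDE.
have cn' : connectivity M (~: E) <= k.+1 by rewrite connC.
(* the end of the splitting lies outside the interval: one of the two parts into
   which the corner cuts the interval has small connectivity *)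
have mid : (forall y, ~~ loop M y -> y \in X -> (y \in E) = (c <= y)) ->
    tight_pair.
  move=> HE.
  have [ge|lt] := leqP k.+1 (connectivity M (X :|: ~: E)).
    apply: (candL i); first by move: bi; clear; lia.
      have -> : connectivity M (segment n i b.+1) = connectivity M (X :&: ~: E).
        apply: conn_eq_loops => y ly; rewrite !in_setI in_setC.
        have [yX|yX] := boolP (y \in X); first rewrite HE //; move: yX; rewrite !inE /=;
          have := gap y ly; move: bi bc; clear; lia.
      exact: conn_uncross (leq_add cX (leq_trans cn' ge)).
    have -> : connectivity M (segment n i c.+1) = connectivity M (X :&: (c |: ~: E)).
      apply: conn_eq_loops => y ly; rewrite !in_setI in_setU1 in_setC -val_eqE /=.
      have [yX|yX] := boolP (y \in X); first rewrite HE //; move: yX; rewrite !inE /=;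
          have := gap y ly; move: bi ci bc; clear; lia.
    have eXE : X :|: (c |: ~: E) = X :|: ~: E.
      by rewrite setUCA (setUidPr _) // sub1set inE; rewrite !inE ci.
    by apply: conn_uncross; rewrite eXE; apply: leq_add cX (leq_trans cnc' ge).
  apply: (candR j); first by move: ci; clear; lia.
    have -> : connectivity M (segment n c j) = connectivity M (E :&: (X :|: ~: E)).
      apply: conn_eq_loops => y ly; rewrite !in_setI in_setU in_setC.
      have [yX|yX] := boolP (y \in X); first rewrite HE //; move: yX; rewrite !inE /=; last case: (y \in E);
          have := gap y ly; move: bi ci bc; clear; lia.
    apply: conn_uncross.
    have -> : E :|: (X :|: ~: E) = setT by rewrite setUCA setUCr setUT.
    by rewrite connT; apply: leq_add cn (ltnSE lt).
  have -> : connectivity M (segment n b j) = connectivity M ((b |: E) :&: (X :|: ~: E)).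
    apply: conn_eq_loops => y ly; rewrite !in_setI in_setU1 in_setU in_setC -val_eqE /=.
    have [yX|yX] := boolP (y \in X); first rewrite HE //; move: yX; rewrite !inE /=; last case: (y \in E);
        have := gap y ly; move: bi ci bc; clear; lia.
  apply: conn_uncross.
  have -> : (b |: E) :|: (X :|: ~: E) = setT by rewrite -setUA [E :|: _]setUCA setUCr !setUT.
  by rewrite connT; apply: leq_add cnb (ltnSE lt).
case: shape => [[j' cj' eE]|[j' jb eE]].
  have [jj|jj] := leqP j' j.
    apply: (candR j'); rewrite ?cj' //; first by rewrite -eE.
    case: (iv_bU j') => [<-|h]; first by rewrite -eE.
    by move: cj' h; clear; lia.
  by apply: mid => y ly yX; rewrite eE; move: yX; rewrite !inE; move: jj; clear; lia.
have [ii|ii] := leqP i j'.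
  apply: (candL j'); rewrite ?ii //; first by rewrite -eE.
  by rewrite -iv_cU // -eE.
apply: mid => y ly yX.
have -> : (y \in E) = (y \notin ~: E) by rewrite inE negbK.
by rewrite eE; move: yX; rewrite !inE; have := gap y ly; move: ii bc; clear; lia.
Qed.

(** The whole ground set is an interval of minimal connectivity. The pair found in
    it has connectivity at most one above the minimum, so it is parallel or in
    series. *)
Lemma reduction_pair : noncrossing M -> degenerate_corners M ->
  (exists x, ~~ loop M x) -> (forall x, ~~ loop M x -> ~~ coloop M x) ->
  exists b c, [/\ consecutive M b c, ~~ loop M b, ~~ loop M c &
    (rk M [set b; c] <= 1) || (rk M (~: [set b; c]) < rk M setT)].
Proof.
move=> nc dc [x lx] ncl.
have c2 : 2 <= #|nonloops (segment n 0 n)|.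
  rewrite ltnNge; apply/negP => le1; case/negP: (ncl x lx).
  rewrite /coloop (_ : rk M (~: [set x]) = 0).
    rewrite lt0n; apply: contra lx; rewrite loop_rk -!leqn0 => e; apply: leq_trans e; apply: rkS; exact: subsetT.
  have e1 : nonloops (segment n 0 n) = [set x].
    apply/esym/eqP; rewrite eqEcard cards1 le1 andbT sub1set nlP lx andbT inE /=; exact: ltn_ord.
  rewrite -rk_nl -(rk0 M); congr (rk M _); apply/setP => y; rewrite nlP !inE.
  by have /setP/(_ y) := e1; rewrite nlP !inE /= ltn_ord /= => ->; rewrite andNb.
have [|b [c [nr lb lc cn]]] := @reduction_pair_iv nc dc ncl _ 0 n (leqnn _) c2.
  by have -> : segment n 0 n = setT; [apply/setP => y; rewrite !inE /= ltn_ord | rewrite connT leqnSn].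
exists b, c; split => //; case: leqP => //= h; last by rewrite orbT.
rewrite orbF -(leq_add2r (rk M setT)).
by apply: leq_trans (leq_add (leqnn _) h) _; rewrite add1n.
Qed.

End Reduction.

(** * One-element extensions *)

Section Extensions.
Variable T : finType.
Implicit Types (M N : matroid T) (S X Y : {set T}) (e f x : T).

(** [e] is a loop of [M0] that becomes a coloop, an element parallel to [f], or an
    element in series with [f]. Keeping deleted and contracted elements as loops
    leaves the ground set, and with it the order, unchanged. *)
Definition col_ext M0 M e : Prop := forall S, (S \in indep M) = (S :\ e \in indep M0).
Definition par_ext M0 M e f : Prop := forall S, (S \in indep M) =
  if e \in S then (f \notin S) && (f |: S :\ e \in indep M0) else S \in indep M0.
Definition ser_ext M0 M e f : Prop := forall S, (S \in indep M) =
  ((if e \in S then S :\ e else S :\ f) \in indep M0).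

Lemma rk_loopU M e X : loop M e -> rk M (e |: X) = rk M X.
Proof. by move=> l; apply/clE/loop_cl. Qed.

Lemma rk_eqI M X m : (forall S, S \in indep M -> S \subset X -> #|S| <= m) ->
  (exists S, [/\ S \in indep M, S \subset X & m <= #|S|]) -> rk M X = m.
Proof.
move=> H [S [iS sS le]]; apply/eqP; rewrite eqn_leq rk_le //=.
by apply: leq_trans le _; apply: card_le_rk.
Qed.

Lemma card_setD1_le x S : #|S| <= #|S :\ x|.+1.
Proof. by rewrite (cardsD1 x S); case: (x \in S). Qed.

Lemma rk_col M0 M e X : loop M0 e -> col_ext M0 M e -> rk M X = rk M0 X + (e \in X).
Proof.
move=> l H; apply: rk_eqI => [S|].
  rewrite H => iS sS; rewrite (cardsD1 e S) addnC leq_add //.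
    by apply: card_le_rk => //; apply: subset_trans sS; apply: subD1set.
  by case: (boolP (e \in S)) => // /(subsetP sS) ->.
have [S [iS sS <-]] := rk_wit M0 X; have eS := loop_notin l iS.
have [eX|eX] := boolP (e \in X); last first.
  by exists S; rewrite H addn0 (setD1_id eS).
exists (e |: S); rewrite H setU1K // subUset sub1set eX sS cardsU1 eS; split=> //; by rewrite addnC.
Qed.

Lemma rk_par M0 M e f X : loop M0 e -> e != f -> par_ext M0 M e f ->
  rk M X = rk M0 (if e \in X then f |: X else X).
Proof.
move=> l ef H; have [eX|eX] := boolP (e \in X); last first.
  have sub S : S \subset X -> e \notin S by move=> sS; apply: contra eX; apply: subsetP.
  apply: rk_eqI => [S|].
    by rewrite H => + sS; rewrite (negPf (sub S sS)) => iS; apply: card_le_rk.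
  by have [S [iS sS <-]] := rk_wit M0 X; exists S; rewrite H (negPf (sub S sS)).
apply: rk_eqI => [S|].
  rewrite H => + sS; have [eS|eS] := boolP (e \in S); last first.
    by move=> iS; apply: card_le_rk => //; apply: subset_trans sS _; apply: subsetUr.
  case/andP => fS iS; rewrite (cardsD1 e S) eS.
  have <- : #|f |: S :\ e| = true + #|S :\ e| by rewrite cardsU1 !inE (negPf fS) andbF.
  apply: card_le_rk => //; apply: setUS; apply: subset_trans sS; exact: subD1set.
have [S [iS sS <-]] := rk_wit M0 (f |: X); have eS := loop_notin l iS.
have [fS|fS] := boolP ((f \in S) && (f \notin X)); last first.
  exists S; rewrite H (negPf eS); split => //.
  apply/subsetP => y yS; have := subsetP sS y yS; rewrite !inE => /orP[/eqP ey|//].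
  by move: fS; rewrite -ey yS negbK.
have /andP[fS' fX] := fS.
exists (e |: S :\ f).
have eSf : e \notin S :\ f by rewrite !inE (negPf eS) andbF.
have fn : f \notin e |: S :\ f by rewrite !inE eqxx (eq_sym f) (negPf ef).
split.
- by rewrite H setU11 fn setU1K // setD1K.
- apply/subsetP => y; rewrite !inE => /orP[/eqP->//|/andP[yf yS]].
  by have := subsetP sS y yS; rewrite !inE (negPf yf).
- by rewrite cardsU1 eSf (cardsD1 f S) fS'.
Qed.

Lemma rk_ser M0 M e f X : loop M0 e -> e != f -> ser_ext M0 M e f ->
  rk M X = if e \in X then (rk M0 X).+1 else
           if f \in X then (rk M0 (X :\ f)).+1 else rk M0 X.
Proof.
move=> l ef H; have [eX|eX] := boolP (e \in X).
  apply: rk_eqI => [S|].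
    rewrite H => iS sS.
    case: ifP iS => eS iS; apply: leq_trans (card_setD1_le _ _) _; rewrite ltnS; apply: card_le_rk iS _;
    by apply: subset_trans sS; apply: subD1set.
  have [S [iS sS <-]] := rk_wit M0 X; have eS := loop_notin l iS.
  exists (e |: S); rewrite H setU11 setU1K // subUset sub1set eX sS cardsU1 eS; by split.
have sub S : S \subset X -> e \notin S by move=> sS; apply: contra eX; apply: subsetP.
have [fX|fX] := boolP (f \in X).
  apply: rk_eqI => [S|].
    rewrite H => + sS; rewrite (negPf (sub S sS)) => iS.
    by apply: leq_trans (card_setD1_le f _) _; rewrite ltnS; apply: card_le_rk iS _; apply: setSD.
  have [S [iS sS <-]] := rk_wit M0 (X :\ f); have eS := loop_notin l iS.
  have fS : f \notin S by apply/negP => /(subsetP sS); rewrite !inE eqxx.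
  exists (f |: S); rewrite H !inE (negPf ef) (negPf eS) /= setU1K // subUset sub1set fX cardsU1 fS.
  by split => //; apply: subset_trans sS _; apply: subD1set.
apply: rk_eqI => [S|].
  rewrite H => + sS; rewrite (negPf (sub S sS)) setD1_id; last by apply: contra fX; apply: subsetP.
  by move=> iS; apply: card_le_rk.
have [S [iS sS <-]] := rk_wit M0 X; exists S; rewrite H (negPf (sub S sS)) setD1_id //.
by apply: contra fX; apply: subsetP.
Qed.

Lemma isb_col_ext M0 M e B : loop M0 e -> col_ext M0 M e -> is_basis M0 B = (e \notin B) && is_basis M (e |: B).
Proof.
move=> l ext; have [eB|eB] /= := boolP (e \in B).
  by apply/negbTE/negP => /isb_indep /(loop_notin l); rewrite eB.
by rewrite /is_basis ext (rk_col _ l ext) inE addn1 setU1K // cardsU1 eB.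
Qed.

Lemma isb_par_ext M0 M e f B : loop M0 e -> e != f -> par_ext M0 M e f ->
  is_basis M0 B = (e \notin B) && is_basis M B.
Proof.
move=> l ef ext; have [eB|eB] /= := boolP (e \in B).
  by apply/negbTE/negP => /isb_indep /(loop_notin l); rewrite eB.
by rewrite /is_basis ext (rk_par _ l ef ext) inE setUT (negPf eB).
Qed.

Lemma isb_ser_ext M0 M e f B : loop M0 e -> e != f -> ser_ext M0 M e f ->
  is_basis M0 B = (e \notin B) && is_basis M (e |: B).
Proof.
move=> l ef ext; have [eB|eB] /= := boolP (e \in B).
  by apply/negbTE/negP => /isb_indep /(loop_notin l); rewrite eB.
by rewrite /is_basis ext setU11 (rk_ser _ l ef ext) inE setU1K // cardsU1 eB.
Qed.

Lemma deletion M e : exists M0, forall S, (S \in indep M0) = (e \notin S) && (S \in indep M).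
Proof.
apply: matroid_ex => [|A B /andP[eA iA] sBA|A B /andP[eA iA] /andP[eB iB] lt].
- by rewrite inE indep0.
- by rewrite (indepS iA sBA) andbT; apply: contra eA; apply: subsetP.
have [x xBA ix] := indep_exchange iA iB lt; exists x; rewrite // ix !inE negb_or eA !andbT.
by move: xBA; rewrite inE => /andP[_ xB]; apply: contraNneq eB => ->.
Qed.

Lemma contraction M e : ~~ loop M e ->
  exists M0, forall S, (S \in indep M0) = (e \notin S) && (e |: S \in indep M).
Proof.
rewrite negbK => ie; apply: matroid_ex => [|A B /andP[eA iA] sBA|A B /andP[eA iA] /andP[eB iB] lt].
- by rewrite inE setU0.
- by rewrite (indepS iA (setUS _ sBA)) andbT; apply: contra eA; apply: subsetP.
have [|x xBA ix] := indep_exchange iA iB; first by rewrite !cardsU1 eA eB.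
move: xBA; rewrite !inE negb_or -andbA => /and3P[xe xA /orP[/eqP ex|xB]]; first by rewrite ex eqxx in xe.
by exists x; rewrite ?inE ?xA // negb_or (eq_sym e) xe eA setUCA.
Qed.

Lemma indepU1_cl M x S Z : ~~ spans M Z x -> S \subset Z -> (x |: S \in indep M) = (S \in indep M).
Proof.
move=> ncl sS; apply/idP/idP => [iS|iS]; first by apply: indepS iS _; apply: subsetUr.
have ncs : ~~ spans M S x by apply: contra ncl; apply: clS.
by rewrite indepU1 //; apply: contra ncs; apply: mem_cl.
Qed.

Lemma coloopE M e : coloop M e = ~~ spans M (~: [set e]) e.
Proof. by rewrite /coloop /spans setUCr ltn_neqAle eq_sym rkS ?subsetT ?andbT. Qed.

Lemma col_ext_ex M e : coloop M e -> exists M0,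
  [/\ loop M0 e, col_ext M0 M e & forall S, (S \in indep M0) = (e \notin S) && (S \in indep M)].
Proof.
rewrite coloopE => co; have [M0 H] := deletion M e; exists M0; split=> //.
  by rewrite /loop H inE eqxx.
move=> S; rewrite H setD11 /=; have [eS|eS] := boolP (e \in S); last by rewrite setD1_id.
rewrite -{1}(setD1K eS) (indepU1_cl co) //.
by apply/subsetP => y; rewrite !inE => /andP[].
Qed.

Lemma par_ext_ex M e f : ~~ loop M e -> ~~ loop M f -> e != f -> rk M [set e; f] <= 1 ->
  exists M0, [/\ loop M0 e, ~~ loop M0 f, par_ext M0 M e f &
    forall S, (S \in indep M0) = (e \notin S) && (S \in indep M)].
Proof.
move=> le lf ef r1; have [M0 H] := deletion M e; exists M0; split=> //.
- by rewrite /loop H inE eqxx.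
- by rewrite /loop H inE ef /=; apply: lf.
have rke : rk M [set e] = 1 by apply/eqP; rewrite eqn_leq rk1_le lt0n -loop_rk.
have rkf : rk M [set f] = 1 by apply/eqP; rewrite eqn_leq rk1_le lt0n -loop_rk.
have ce : spans M [set f] e by rewrite /spans rkf eqn_leq r1 -rkf rkS ?subsetUr.
have cf : spans M [set e] f by rewrite /spans rke setUC eqn_leq r1 -rke rkS ?subsetUl.
have tr x y S : spans M [set x] y -> spans M S x -> spans M S y.
  by move=> cxy cx; apply: cl_trans cxy => z; rewrite inE => /eqP ->.
move=> S; rewrite !H; case: (boolP (e \in S)) => [eS|eS] //=.
have enot : e \notin S :\ e by rewrite setD11.
have [fS|fS] /= := boolP (f \in S).
  apply/negbTE/negP => /indepS /(_ (set2_sub eS fS)); rewrite indep_rk cards2 ef => /eqP e2.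
  by rewrite e2 in r1.
have fnot : f \notin S :\ e by rewrite !inE (negPf fS) andbF.
rewrite !inE (negPf ef) eqxx /=.
have [iSe|niSe] := boolP (S :\ e \in indep M); last first.
  apply/idP/idP => h; case/negP: niSe; apply: indepS h _; [exact: subD1set|exact: subsetUr].
rewrite -{1}(setD1K eS) !indepU1 //; congr (~~ _); apply/idP/idP; exact: tr.
Qed.

Lemma ser_ext_ex M e f : ~~ loop M e -> ~~ coloop M e -> ~~ coloop M f -> e != f ->
  rk M (~: [set e; f]) < rk M setT ->
  exists M0, [/\ loop M0 e, ser_ext M0 M e f &
    forall S, (S \in indep M0) = (e \notin S) && (e |: S \in indep M)].
Proof.
move=> le; rewrite /coloop -!leqNgt => ce cf ef r1.
have [M0 H] := contraction le; exists M0; split=> //; first by rewrite /loop H inE eqxx.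
have nce : ~~ spans M (~: [set e; f]) e.
  rewrite /spans (_ : e |: _ = ~: [set f]); first by apply: contraL r1 => /eqP <-; rewrite -leqNgt.
  by apply/setP => y; rewrite !inE; case: eqP => [->|//]; rewrite ef.
have ncf : ~~ spans M (~: [set e; f]) f.
  rewrite /spans (_ : f |: _ = ~: [set e]); first by apply: contraL r1 => /eqP <-; rewrite -leqNgt.
  by apply/setP => y; rewrite !inE; case: (y =P f) => [->|_]; rewrite ?orbF // eq_sym ef.
move=> S; case: ifP => eS; rewrite H; first by rewrite setD11 setD1K.
have sub : S :\ f \subset ~: [set e; f].
  apply/subsetP => y; rewrite !inE negb_or => /andP[-> yS]; rewrite andbT.
  by apply: contraFneq eS => <-.
rewrite !inE eS andbF /= (indepU1_cl nce sub).
have [fS|fS] := boolP (f \in S); last by rewrite setD1_id.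
by rewrite -{1}(setD1K fS) (indepU1_cl ncf sub).
Qed.

End Extensions.

(** * Ranks of cyclic intervals *)

Section Arcs.
Variable n : nat.
Implicit Types (M N P : matroid 'I_n) (B S X Y : {set 'I_n}) (b c e f x y : 'I_n).

Definition cyc_arc (i : 'I_n) (m : nat) : {set 'I_n} := [set x | cyc_pos i x < m].

(** Equality of Grassmann necklaces, by [envelope_classE]. *)
Definition arc_equiv M N : Prop := forall i m, rk M (cyc_arc i m) = rk N (cyc_arc i m).

Lemma cyc_posE (i x : 'I_n) : cyc_pos i x = if i <= x then x - i else x + n - i.
Proof.
have [ltx lti] := (ltn_ord x, ltn_ord i); rewrite /cyc_pos; case: leqP => h.
  by rewrite addnC -addnBA // modnDl modn_small //; apply: leq_ltn_trans ltx; apply: leq_subr.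
by rewrite modn_small //; move: h ltx lti; clear; lia.
Qed.

Lemma cyc_pos_inj (i : 'I_n) : injective (cyc_pos i).
Proof.
move=> x y; rewrite !cyc_posE => e; apply: val_inj => /=.
by move: e (ltn_ord x) (ltn_ord y) (ltn_ord i); clear; case: (leqP i x); case: (leqP i y); lia.
Qed.

Lemma cyc_pos_lt (i x : 'I_n) : cyc_pos i x < n.
Proof. by rewrite /cyc_pos ltn_mod; apply: leq_ltn_trans (ltn_ord x). Qed.

Lemma arcT (i : 'I_n) : cyc_arc i n = setT.
Proof. by apply/setP => x; rewrite !inE cyc_pos_lt. Qed.

Lemma arc1 (i : 'I_n) : cyc_arc i 1 = [set i].
Proof.
apply/setP => x; rewrite !inE ltnS leqn0; apply/eqP/eqP => [e|->].
  by apply: (@cyc_pos_inj i); rewrite e cyc_posE leqnn subnn.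
by rewrite cyc_posE leqnn subnn.
Qed.

Lemma arc_interval (i j : 'I_n) x : i <= j -> (x \in cyc_arc i (j - i).+1) = (i <= x <= j).
Proof.
move=> ij; rewrite inE cyc_posE; move: ij (ltn_ord x) (ltn_ord i) (ltn_ord j).
by clear; case: (leqP i x); lia.
Qed.

Lemma arc_interval_compl (i j : 'I_n) : i <= j ->
  ~: cyc_arc i (j - i).+1 = cyc_arc (ordS j) (n - (j - i).+1).
Proof.
move=> ij; apply/setP => x; rewrite inE arc_interval // inE cyc_posE /=.
move: (ltn_ord x) (ltn_ord i) (ltn_ord j).
have [nj|nj] := eqVneq j.+1 n; first by rewrite nj modnn leq0n subn0; move: nj ij; clear; lia.
rewrite modn_small; first by move: ij nj; clear; case: (leqP j.+1 x); lia.
by have := ltn_ord j; move: nj; clear; lia.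
Qed.

Definition between b c y : bool := b < y < c.

Lemma arc_minus (i : 'I_n) m b c y : b < c -> b \in cyc_arc i m -> c \notin cyc_arc i m ->
  ~~ between b c y -> (y \in cyc_arc i m :\ b) = (y \in cyc_arc i (cyc_pos i b)).
Proof.
rewrite !inE !cyc_posE -val_eqE /between /=.
move: (ltn_ord b) (ltn_ord c) (ltn_ord y) (ltn_ord i); clear.
by case: (leqP i b); case: (leqP i c); case: (leqP i y); lia.
Qed.

Lemma arc_plus (i : 'I_n) m b c y : b < c -> b \in cyc_arc i m -> c \notin cyc_arc i m ->
  ~~ between b c y -> (y \in c |: cyc_arc i m) = (y \in cyc_arc i (cyc_pos i c).+1).
Proof.
rewrite !inE !cyc_posE -val_eqE /between /=.
move: (ltn_ord b) (ltn_ord c) (ltn_ord y) (ltn_ord i); clear.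
by case: (leqP i b); case: (leqP i c); case: (leqP i y); lia.
Qed.

(** Up to the elements between [b] and [c], the arcs that contain [b] but not
    [c] all end in [b], and are therefore nested. *)
Lemma arc_nested (i i' : 'I_n) m m' b c : b < c ->
  b \in cyc_arc i m -> c \notin cyc_arc i m -> b \in cyc_arc i' m' -> c \notin cyc_arc i' m' ->
  (forall y, ~~ between b c y -> y \in cyc_arc i m -> y \in cyc_arc i' m') \/
  (forall y, ~~ between b c y -> y \in cyc_arc i' m' -> y \in cyc_arc i m).
Proof.
move=> bc b1 c1 b2 c2.
have [h|h] := leqP (cyc_pos i b) (cyc_pos i' b); [left|right] => y;
  move: bc b1 c1 b2 c2 h; rewrite !inE !cyc_posE /between;
  move: (ltn_ord b) (ltn_ord c) (ltn_ord y) (ltn_ord i) (ltn_ord i'); clear;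
  case: (leqP i b); case: (leqP i c); case: (leqP i y);
  case: (leqP i' b); case: (leqP i' c); case: (leqP i' y); lia.
Qed.

Lemma near_between M b c y : consecutive M b c -> ~~ loop M y -> ~~ between b c y.
Proof. by move=> nr; apply: contra => /andP[]; apply: near_loop. Qed.

Lemma arc_equiv_loop M N x : arc_equiv M N -> loop M x = loop N x.
Proof. by move=> H; rewrite !loop_rk -!arc1 H. Qed.

Lemma arc_equiv_T M N : arc_equiv M N -> rk M setT = rk N setT.
Proof.
move=> H; case: (set_0Vmem [set: 'I_n]) => [->|[i _]]; first by rewrite !rk0.
by rewrite -(arcT i) H.
Qed.

Lemma near_arc_equiv M N b c : arc_equiv M N -> consecutive M b c -> consecutive N b c.
Proof.
by move=> H; apply: near_sub => x; rewrite (arc_equiv_loop _ H).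
Qed.

Lemma rk_arc_minus M (i : 'I_n) m b c : consecutive M b c -> b \in cyc_arc i m -> c \notin cyc_arc i m ->
  rk M (cyc_arc i m :\ b) = rk M (cyc_arc i (cyc_pos i b)).
Proof.
move=> nr bX cX; apply: rk_eq_loops => y ly; apply: arc_minus bX cX _; first by case/andP: nr.
exact: near_between nr ly.
Qed.

Lemma rk_arc_plus M (i : 'I_n) m b c : consecutive M b c -> b \in cyc_arc i m -> c \notin cyc_arc i m ->
  rk M (c |: cyc_arc i m) = rk M (cyc_arc i (cyc_pos i c).+1).
Proof.
move=> nr bX cX; apply: rk_eq_loops => y ly; apply: arc_plus bX cX _; first by case/andP: nr.
exact: near_between nr ly.
Qed.

Lemma rk_near_pair M b c : consecutive M b c -> rk M [set b; c] = rk M (cyc_arc b (c - b).+1).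
Proof.
move=> nr; have bc : b < c by case/andP: nr.
apply: rk_eq_loops => y ly; have := near_between nr ly.
rewrite arc_interval ?(ltnW bc) // !inE -!val_eqE /between /=; move: bc; clear; lia.
Qed.

Lemma rk_near_pairC M b c : consecutive M b c ->
  rk M (~: [set b; c]) = rk M (cyc_arc (ordS c) (n - (c - b).+1)).
Proof.
move=> nr; have bc : b < c by case/andP: nr.
rewrite -arc_interval_compl ?(ltnW bc) //.
apply: rk_eq_loops => y ly; have := near_between nr ly.
rewrite !in_setC arc_interval ?(ltnW bc) // !inE -!val_eqE /between /=; move: bc; clear; lia.
Qed.

Lemma arc_equiv_coloop M N x : arc_equiv M N -> coloop M x = coloop N x.
Proof.
move=> H; rewrite /coloop (arc_equiv_T H).
have e : [set x] = cyc_arc x (x - x).+1 by rewrite subnn arc1.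
by rewrite e arc_interval_compl // H.
Qed.

(** * Series-parallel matroids *)

(** With the flag set, the two elements of each series or parallel pair have to be
    consecutive up to loops. *)
Inductive series_parallel (c : bool) : matroid 'I_n -> Prop :=
| sp_loops M : (forall x, loop M x) -> series_parallel c M
| sp_col M0 M e : loop M0 e -> col_ext M0 M e -> series_parallel c M0 -> series_parallel c M
| sp_par M0 M e f : loop M0 e -> ~~ loop M0 f -> (c -> consecutive M0 e f) ->
    par_ext M0 M e f -> series_parallel c M0 -> series_parallel c M
| sp_ser M0 M e f : loop M0 e -> e != f -> ~~ coloop M e -> (c -> consecutive M0 f e) ->
    ser_ext M0 M e f -> series_parallel c M0 -> series_parallel c M.

Lemma sp_weaken M : series_parallel true M -> series_parallel false M.
Proof.
elim=> {M} [M H|M0 M e l H _|M0 M e f l lf _ H _|M0 M e f l ef co _ H _].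
- exact: sp_loops.
- exact: (sp_col l H).
- by apply: (sp_par l lf _ H).
- by apply: (sp_ser l ef co _ H).
Qed.

Lemma par_near M0 M e f : loop M0 e -> e != f -> consecutive M0 e f -> par_ext M0 M e f -> consecutive M e f.
Proof.
move=> l ef nr H; have lt : e < f by case/andP: nr.
rewrite /consecutive lt; apply/forallP => x; apply/implyP => /andP[ex xf].
have lx := near_loop nr ex xf; rewrite loop_rk (rk_par _ l ef H) inE.
have -> : (e == x) = false by apply/negbTE; rewrite -val_eqE /= neq_ltn ex.
by rewrite -loop_rk.
Qed.

Lemma ser_near M0 M e f : loop M0 e -> e != f -> consecutive M0 f e -> ser_ext M0 M e f -> consecutive M f e.
Proof.
move=> l ef nr H; have lt : f < e by case/andP: nr.
rewrite /consecutive lt; apply/forallP => x; apply/implyP => /andP[ex xf].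
have lx := near_loop nr ex xf; rewrite loop_rk (rk_ser _ l ef H) !inE.
have -> : (e == x) = false by apply/negbTE; rewrite -val_eqE /= neq_ltn xf orbT.
have -> : (f == x) = false by apply/negbTE; rewrite -val_eqE /= neq_ltn ex.
by rewrite -loop_rk.
Qed.

(** Arc ranks pass from a matroid to its extensions, and back. The only arcs that
    matter contain the first element of the pair but not the second: such an arc
    ends at the first element, so dropping that element or adding the second one
    gives an arc again, up to loops. *)
Section ExtArcs.
Variables (M0 M N0 N : matroid 'I_n) (e f : 'I_n).
Hypotheses (lM : loop M0 e) (lN : loop N0 e).

Lemma col_arc_equiv : col_ext M0 M e -> col_ext N0 N e -> arc_equiv M0 N0 <-> arc_equiv M N.
Proof.
move=> HM HN; split=> H i m; have := H i m; rewrite !(rk_col _ lM HM) !(rk_col _ lN HN).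
  by move=> ->.
exact: addIn.
Qed.

Lemma par_arc_equiv : e != f -> consecutive M0 e f -> consecutive N0 e f ->
  par_ext M0 M e f -> par_ext N0 N e f -> arc_equiv M0 N0 <-> arc_equiv M N.
Proof.
move=> ef nM nN HM HN; split=> H i m.
  rewrite (rk_par _ lM ef HM) (rk_par _ lN ef HN); case: ifP => [eX|_]; last exact: H.
  have [fX|fX] := boolP (f \in cyc_arc i m); first by rewrite (setUidPr _) ?sub1set ?H.
  by rewrite (rk_arc_plus nM eX fX) (rk_arc_plus nN eX fX) H.
have HE j l : e \notin cyc_arc j l -> rk M0 (cyc_arc j l) = rk N0 (cyc_arc j l).
  by move=> /negPf eX; have := H j l; rewrite (rk_par _ lM ef HM) (rk_par _ lN ef HN) eX.
have [eX|eX] := boolP (e \in cyc_arc i m); last exact: HE.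
have [fX|fX] := boolP (f \in cyc_arc i m).
  by have := H i m; rewrite (rk_par _ lM ef HM) (rk_par _ lN ef HN) eX (setUidPr _) ?sub1set.
rewrite -(setD1K eX) !rk_loopU // (rk_arc_minus nM eX fX) (rk_arc_minus nN eX fX).
by apply: HE; rewrite inE ltnn.
Qed.

Lemma ser_arc_equiv : e != f -> consecutive M0 f e -> consecutive N0 f e ->
  ser_ext M0 M e f -> ser_ext N0 N e f -> arc_equiv M0 N0 <-> arc_equiv M N.
Proof.
move=> ef nM nN HM HN; split=> H i m.
  rewrite (rk_ser _ lM ef HM) (rk_ser _ lN ef HN); case: ifP => [eX|eX]; first by rewrite H.
  case: ifP => [fX|_]; last exact: H.
  by rewrite (rk_arc_minus nM fX (negbT eX)) (rk_arc_minus nN fX (negbT eX)) H.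
have HE j l : e \in cyc_arc j l -> rk M0 (cyc_arc j l) = rk N0 (cyc_arc j l).
  by move=> eX; have := H j l; rewrite (rk_ser _ lM ef HM) (rk_ser _ lN ef HN) eX => -[].
have [eX|eX] := boolP (e \in cyc_arc i m); first exact: HE.
have [fX|fX] := boolP (f \in cyc_arc i m).
  rewrite -(rk_loopU _ lM) -(rk_loopU (cyc_arc i m) lN) (rk_arc_plus nM fX eX) (rk_arc_plus nN fX eX).
  by apply: HE; rewrite inE ltnSn.
by have := H i m; rewrite (rk_ser _ lM ef HM) (rk_ser _ lN ef HN) (negPf eX) (negPf fX).
Qed.

End ExtArcs.

(** Arc ranks show which elements are coloops, and which consecutive pairs are
    parallel or in series; so [M] can be reduced along with [P]. *)
Lemma sp_unique P : series_parallel true P -> forall M, arc_equiv M P -> M = P.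
Proof.
elim=> {P} [P H|P0 P e l H _ IH|P0 P e f l lf /(_ isT) nr H _ IH|P0 P e f l ef co /(_ isT) nr H _ IH] M eM.
- apply: rk_eqP => X; have HM x : loop M x by rewrite (arc_equiv_loop _ eM).
  by rewrite !(@rk_loops _ _ set0 X (sub0set _)) ?rk0.
- have cP : coloop P e.
    by rewrite /coloop !(rk_col _ l H) !inE eqxx addn0 addn1 ltnS rkS ?subsetT.
  have [|M0 [lM HM _]] := @col_ext_ex _ M e; first by rewrite (arc_equiv_coloop _ eM).
  have eM0 : M0 = P0 by apply: IH; apply/(col_arc_equiv lM l HM H).
  by apply: matroid_eq => S; rewrite HM H eM0.
- have ef : e != f by apply: contraNneq lf => <-.
  have nrP : consecutive P e f by apply: par_near H.
  have nrM : consecutive M e f by apply: near_arc_equiv nrP => i m; rewrite eM.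
  have r1 : rk M [set e; f] <= 1.
    rewrite (rk_near_pair nrM) eM -(rk_near_pair nrP) (rk_par _ l ef H) !inE eqxx.
    by rewrite setUCA setUid (rk_loopU _ l) rk1_le.
  have lPe : ~~ loop M e.
    by rewrite (arc_equiv_loop _ eM) loop_rk (rk_par _ l ef H) !inE eqxx setUC (rk_loopU _ l) -loop_rk.
  have lPf : ~~ loop M f.
    by rewrite (arc_equiv_loop _ eM) loop_rk (rk_par _ l ef H) !inE (negPf ef) -loop_rk.
  have [M0 [lM lMf HM HM']] := par_ext_ex lPe lPf ef r1.
  have nrM0 : consecutive M0 e f.
    by apply: near_sub nrM => x; rewrite /loop HM'; apply: contra => /andP[].
  have eM0 : M0 = P0 by apply: IH; apply/(par_arc_equiv lM l ef nrM0 nr HM H).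
  by apply: matroid_eq => S; rewrite HM H eM0.
have nrP : consecutive P f e by apply: ser_near H.
have nrM : consecutive M f e by apply: near_arc_equiv nrP => i m; rewrite eM.
have rT : rk P setT = (rk P0 setT).+1 by rewrite (rk_ser _ l ef H) inE.
have r1 : rk M (~: [set e; f]) < rk M setT.
  rewrite setUC (rk_near_pairC nrM) eM -(rk_near_pairC nrP) (arc_equiv_T eM) rT.
  by rewrite (rk_ser _ l ef H) !inE !eqxx orbT /= ltnS rkS ?subsetT.
have lMe : ~~ loop M e by rewrite (arc_equiv_loop _ eM) loop_rk (rk_ser _ l ef H) !inE eqxx.
have cMe : ~~ coloop M e by rewrite (arc_equiv_coloop _ eM).
have cMf : ~~ coloop M f.
  rewrite (arc_equiv_coloop _ eM) /coloop rT (rk_ser _ l ef H) !inE ef -leqNgt ltnS.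
  move: co; rewrite /coloop rT (rk_ser _ l ef H) !inE eqxx eq_sym ef /= -leqNgt ltnS.
  move/leq_trans; apply; apply: rkS; rewrite setDE; exact: subsetIr.
have [M0 [lM HM HM']] := ser_ext_ex lMe cMe cMf ef r1.
have nrM0 : consecutive M0 f e.
  apply: near_sub nrM => x; rewrite /loop HM'; apply: contra => /andP[_ i1].
  by apply: indepS i1 _; apply: subsetUr.
have eM0 : M0 = P0 by apply: IH; apply/(ser_arc_equiv lM l ef nrM0 nr HM H).
by apply: matroid_eq => S; rewrite HM H eM0.
Qed.

End Arcs.

(** * Weak images of series-parallel matroids *)

Section WeakImages.
Variable n : nat.
Implicit Types (M P N : matroid 'I_n) (B S X Y : {set 'I_n}) (e f a b x : 'I_n).

Definition relabels (g : 'I_n -> 'I_n) N M : Prop := forall S, (S \in indep N) = (g @: S \in indep M).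

Lemma relabel_ex (g : 'I_n -> 'I_n) M : injective g -> exists N, relabels g N M.
Proof.
move=> gi; apply: matroid_ex => [|A B iA sBA|A B iA iB lt].
- by rewrite imset0 indep0.
- by apply: indepS iA _; apply: imsetS.
have [|y] := indep_exchange iA iB; first by rewrite !card_imset.
rewrite inE => /andP[yA /imsetP[x xB ey]] iy; exists x; last by rewrite imsetU1 -ey.
by rewrite inE xB andbT; apply: contra yA => xA; rewrite ey imset_f.
Qed.

Section Relabel.
Variables (g : 'I_n -> 'I_n) (gK : involutive g).

Lemma relabels_sym N M : relabels g N M -> relabels g M N.
Proof. by move=> H S; rewrite H -imset_comp (eq_imset _ gK) imset_id. Qed.

Let gI := inv_inj gK.

Lemma mem_invol S x : (x \in g @: S) = (g x \in S).
Proof. by rewrite -{1}(gK x) mem_imset. Qed.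

Lemma invol_setD1 S x : g @: (S :\ x) = (g @: S) :\ g x.
Proof. by apply/setP => y; rewrite !inE !mem_invol !inE (can2_eq gK gK). Qed.

Lemma relabels_rk N M X : relabels g N M -> rk N X = rk M (g @: X).
Proof.
move=> H; apply: rk_eqI => [S|].
  by rewrite H => iS sS; rewrite -(card_imset S gI); apply: card_le_rk => //; apply: imsetS.
have [S [iS sS <-]] := rk_wit M (g @: X); exists (g @: S); rewrite card_imset //.
have eS : g @: (g @: S) = S by rewrite -imset_comp (eq_imset _ gK) imset_id.
rewrite H eS; split=> //; have -> : X = g @: (g @: X) by rewrite -imset_comp (eq_imset _ gK) imset_id.
exact: imsetS.
Qed.

Lemma invol_setT : g @: setT = setT.
Proof. by apply/setP => x; rewrite mem_invol !inE. Qed.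

Lemma relabels_isb N M B : relabels g N M -> is_basis N B = is_basis M (g @: B).
Proof. by move=> H; rewrite /is_basis H (relabels_rk _ H) invol_setT card_imset. Qed.

Lemma relabels_loop N M x : relabels g N M -> loop N x = loop M (g x).
Proof. by move=> H; rewrite !loop_rk (relabels_rk _ H) imset_set1. Qed.

Lemma relabels_coloop N M x : relabels g N M -> coloop N x = coloop M (g x).
Proof.
move=> H; rewrite /coloop !(relabels_rk _ H) invol_setT.
suff -> : g @: (~: [set x]) = ~: [set g x] by [].
by apply/setP => y; rewrite !inE mem_invol !inE (can2_eq gK gK).
Qed.

Lemma sp_relabel M : series_parallel false M -> forall N, relabels g N M -> series_parallel false N.
Proof.
elim=> {M} [M lo|M0 M e l ext _ IH|M0 M e f l lf _ ext _ IH|M0 M e f l ef co _ ext _ IH] N H.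
- by apply: sp_loops => x; rewrite (relabels_loop _ H).
- have [N0 H0] := relabel_ex M0 gI; apply: (@sp_col _ _ N0 N (g e)); last exact: IH.
    by rewrite (relabels_loop _ H0) gK.
  by move=> S; rewrite H ext H0 invol_setD1 gK.
- have [N0 H0] := relabel_ex M0 gI; apply: (@sp_par _ _ N0 N (g e) (g f)) => //; last exact: IH.
  + by rewrite (relabels_loop _ H0) gK.
  + by rewrite (relabels_loop _ H0) gK.
  by move=> S; rewrite H ext !H0 !mem_invol imsetU1 invol_setD1 !gK.
have [N0 H0] := relabel_ex M0 gI; apply: (@sp_ser _ _ N0 N (g e) (g f)) => //; last exact: IH.
- by rewrite (relabels_loop _ H0) gK.
- by rewrite (inj_eq gI).
- by rewrite (relabels_coloop _ H) gK.
by move=> S; rewrite H ext H0 mem_invol; case: ifP; rewrite invol_setD1 gK.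
Qed.

End Relabel.

Lemma basis_in M X : ~~ (rk M X < rk M setT) -> exists2 B, is_basis M B & B \subset X.
Proof.
rewrite -leqNgt => le; have [B [iB sB eB]] := rk_wit M X; exists B => //.
by apply: isbI iB _; rewrite eB.
Qed.

Lemma tperm_swap e f S : e != f -> f \notin tperm e f @: S -> e \notin S.
Proof. by move=> ef; rewrite (mem_invol (@tpermK _ e f)) tpermR. Qed.

Lemma imset_tperm_id e f S : (e \in S) = (f \in S) -> tperm e f @: S = S.
Proof.
move=> ef; apply/setP => x; rewrite (mem_invol (@tpermK _ e f)).
by case: tpermP => [->|->|//].
Qed.

Lemma imset_tperm_swap e f S : e != f -> e \in S -> f \notin S -> tperm e f @: S = f |: S :\ e.
Proof.
move=> ef eS fS; apply/setP => x; rewrite (mem_invol (@tpermK _ e f)) !inE.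
case: tpermP => [->|->|/eqP xe /eqP xf]; first by rewrite (negPf fS) (negPf ef) eqxx.
  by rewrite eS eqxx.
by rewrite (negPf xf) xe.
Qed.

(** A parallel or series pair of [P] stays one in the weak image [M] unless one of its
    elements becomes a loop or a coloop; the transposition of the pair arranges that
    this is the element by which [P] is reduced. *)
Lemma sp_weak_image P : series_parallel false P -> forall M, rk M setT = rk P setT ->
  (forall B, is_basis M B -> is_basis P B) -> series_parallel false M.
Proof.
elim=> {P} [P lo|P0 P e l ext _ IH|P0 P e f l lf _ ext _ IH|P0 P e f l ef co _ ext _ IH] M rM sub.
- apply: sp_loops => x; rewrite loop_rk -leqn0.
  have <- : rk M setT = 0 by rewrite rM (@rk_loops _ _ set0 setT) ?sub0set ?rk0.
  by apply: rkS; apply: subsetT.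
- have cM : coloop M e.
    apply: contraT => /basis_in[B bB sB].
    have cP : coloop P e by rewrite /coloop !(rk_col _ l ext) !inE eqxx addn0 addn1 ltnS rkS ?subsetT.
    have := card_le_rk (isb_indep (sub B bB)) sB.
    by rewrite (isb_card bB) rM leqNgt; move: cP; rewrite /coloop => ->.
  have [M0 [l0 ext0 _]] := col_ext_ex cM; apply: (sp_col l0 ext0); apply: IH.
    by move: rM; rewrite (rk_col _ l0 ext0) (rk_col _ l ext) !inE !addn1 => -[].
  move=> B; rewrite (isb_col_ext _ l0 ext0) (isb_col_ext _ l ext) => /andP[-> bB].
  exact: sub.
- have ef : e != f by apply: contraNneq lf => <-.
  have rP : rk P setT = rk P0 setT by rewrite (rk_par _ l ef ext) inE setUT.
  have caseE N : rk N setT = rk P setT -> (forall B, is_basis N B -> e \notin B) ->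
      (forall B, is_basis N B -> is_basis P B) -> series_parallel false N.
    move=> rN nN subN; apply: IH; first by rewrite rN rP.
    by move=> B bB; rewrite (isb_par_ext _ l ef ext) nN ?subN.
  have [le|le] := boolP (loop M e).
    by apply: caseE => // B /isb_indep; apply: loop_notin le.
  have [lMf|lMf] := boolP (loop M f).
    have [N HN] := relabel_ex M (@perm_inj _ (tperm e f)).
    have K : involutive (tperm e f) by apply: tpermK.
    have NB B : is_basis N B -> f \notin tperm e f @: B.
      by rewrite (relabels_isb K _ HN) => /isb_indep; apply: loop_notin lMf.
    apply: (sp_relabel K _ (relabels_sym K HN)); apply: caseE.
    + by rewrite (relabels_rk K _ HN) invol_setT.
    + by move=> B /NB; apply: tperm_swap.
    move=> B bN; have fB := NB B bN; have eB := tperm_swap ef fB.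
    have b1 : is_basis P (tperm e f @: B) by apply: sub; rewrite -(relabels_isb K _ HN).
    have [fB'|fB'] := boolP (f \in B); last first.
      by move: b1; rewrite imset_tperm_id // (negPf eB) (negPf fB').
    have fe : f != e by rewrite eq_sym.
    move: b1; rewrite tpermC imset_tperm_swap // => b1.
    have : is_basis P0 B; last by rewrite (isb_par_ext _ l ef ext) => /andP[].
    have eBf : e \notin B :\ f by rewrite !inE (negPf eB) andbF.
    apply: isbI.
      have := isb_indep b1; rewrite ext setU11 !inE eqxx (negPf fe) /= setU1K // setD1K //.
    by rewrite -rP -(isb_card b1) cardsU1 eBf (cardsD1 f B) fB'.
  have r1 : rk M [set e; f] <= 1.
    rewrite leqNgt; apply/negP => r2.
    have i2 : [set e; f] \in indep M by rewrite indep_rk eqn_leq rk_le_card cards2 ef.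
    have [B bB sB] := indep_sub_basis i2.
    have := isb_indep (sub B bB); rewrite ext (subsetP sB) ?inE ?eqxx //.
    by rewrite (subsetP sB) ?inE ?eqxx ?orbT.
  have [M0 [l0 lf0 ext0 _]] := par_ext_ex le lMf ef r1.
  apply: (sp_par l0 lf0 _ ext0) => //; apply: IH.
    by rewrite -rP -rM (rk_par _ l0 ef ext0) inE setUT.
  move=> B; rewrite (isb_par_ext _ l0 ef ext0) (isb_par_ext _ l ef ext) => /andP[-> bB].
  exact: sub.
have rP : rk P setT = (rk P0 setT).+1 by rewrite (rk_ser _ l ef ext) inE.
have caseE N : rk N setT = rk P setT -> coloop N e -> (forall B, is_basis N B -> is_basis P B) -> series_parallel false N.
  move=> rN cN subN; have [N0 [l0 ext0 _]] := col_ext_ex cN; apply: (sp_col l0 ext0); apply: IH.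
    by move: rN; rewrite rP (rk_col _ l0 ext0) inE addn1 => -[].
  move=> B; rewrite (isb_col_ext _ l0 ext0) (isb_ser_ext _ l ef ext) => /andP[-> bB].
  exact: subN.
have [cMe|cMe] := boolP (coloop M e); first exact: caseE.
have [cMf|cMf] := boolP (coloop M f).
  have [N HN] := relabel_ex M (@perm_inj _ (tperm e f)).
  have K : involutive (tperm e f) by apply: tpermK.
  apply: (sp_relabel K _ (relabels_sym K HN)); apply: caseE.
  - by rewrite (relabels_rk K _ HN) invol_setT.
  - by rewrite (relabels_coloop K _ HN) tpermL.
  move=> B; rewrite (relabels_isb K _ HN) => bM.
  have b1 := sub _ bM.
  have eB : e \in B.
    have : f \in tperm e f @: B.
      apply: contraT => fB; have := card_le_rk (isb_indep bM) (X := ~: [set f]).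
      have -> : tperm e f @: B \subset ~: [set f].
        by apply/subsetP => y yB; rewrite !inE; apply: contraNneq fB => ey; rewrite -[X in X \in _]ey.
      by move/(_ isT); rewrite (isb_card bM) leqNgt; move: cMf; rewrite /coloop => ->.
    by rewrite (mem_invol K) tpermR.
  have [fB|fB] := boolP (f \in B); first by move: b1; rewrite imset_tperm_id // eB fB.
  move: b1; rewrite imset_tperm_swap // => b1.
  have fBe : f \notin B :\ e by rewrite !inE (negPf fB) andbF.
  apply: isbI; last by rewrite -(isb_card b1) cardsU1 fBe (cardsD1 e B) eB.
  have := isb_indep b1; rewrite !ext eB !inE eqxx (negPf ef) /=.
  by rewrite setU1K.
have avoid B : is_basis M B -> e \notin B -> f \notin B -> False.
  move=> bB eB fB; have := isb_indep (sub B bB); rewrite ext (negPf eB) setD1_id // => iB.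
  by have := card_le_rk iB (subsetT _); rewrite (isb_card bB) rM rP ltnn.
have r1 : rk M (~: [set e; f]) < rk M setT.
  apply: contraT => /basis_in[B bB /subsetP sB]; exfalso; apply: (avoid B) => //; apply/negP => /sB;
  by rewrite !inE eqxx ?orbT.
have le : ~~ loop M e.
  apply/negP => le; case/negP: cMf; apply: contraT => /basis_in[B bB /subsetP sB]; exfalso.
  apply: (avoid B) => //; first exact: loop_notin le (isb_indep bB).
  by apply/negP => /sB; rewrite !inE eqxx.
have [M0 [l0 ext0 _]] := ser_ext_ex le cMe cMf ef r1.
apply: (sp_ser l0 ef cMe _ ext0) => //; apply: IH.
  by move: rM; rewrite rP (rk_ser _ l0 ef ext0) inE => -[].
move=> B; rewrite (isb_ser_ext _ l0 ef ext0) (isb_ser_ext _ l ef ext) => /andP[-> bB].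
exact: sub.
Qed.

End WeakImages.

(** * Grassmann necklaces and ranks of arcs *)

Section Necklace.
Variable n : nat.
Implicit Types (M N P : matroid 'I_n) (B S X Y : {set 'I_n}) (i x y : 'I_n).

(** The basis found by the greedy algorithm along the order that starts at [i]. *)
Definition greedy M i : {set 'I_n} := [set x | ~~ spans M (cyc_arc i (cyc_pos i x)) x].

Lemma arc_pos_S i x : cyc_arc i (cyc_pos i x).+1 = x |: cyc_arc i (cyc_pos i x).
Proof.
apply/setP => y; rewrite !inE ltnS leq_eqVlt; congr (_ || _).
by apply/eqP/eqP => [/cyc_pos_inj|->].
Qed.

Lemma greedy_arc M i m :
  greedy M i :&: cyc_arc i m \in indep M /\ rk M (cyc_arc i m) = #|greedy M i :&: cyc_arc i m|.
Proof.
elim: m => [|m [iG eG]].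
  have -> : cyc_arc i 0 = set0 by apply/setP => x; rewrite !inE.
  by rewrite setI0 cards0 rk0 indep0.
have [x /eqP xm|no] := pickP (fun x => cyc_pos i x == m); last first.
  suff -> : cyc_arc i m.+1 = cyc_arc i m by [].
  by apply/setP => x; rewrite !inE ltnS leq_eqVlt no.
rewrite -xm arc_pos_S xm.
have xa : x \notin cyc_arc i m by rewrite inE xm ltnn.
have [xG|xG] := boolP (x \in greedy M i); last first.
  have -> : greedy M i :&: (x |: cyc_arc i m) = greedy M i :&: cyc_arc i m.
    by apply/setP => y; rewrite !in_setI in_setU1; case: (y =P x) => [->|]; rewrite ?(negPf xG).
  by move: xG; rewrite inE negbK xm => /clE ->.
have -> : greedy M i :&: (x |: cyc_arc i m) = x |: (greedy M i :&: cyc_arc i m).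
  by apply/setP => y; rewrite in_setU1 !in_setI in_setU1; case: (y =P x) => [->|]; rewrite ?xG.
have xn : x \notin greedy M i :&: cyc_arc i m by rewrite in_setI (negPf xa) andbF.
move: xG; rewrite inE xm => ncl; rewrite clN // eG cardsU1 xn; split=> //.
by rewrite indepU1 //; apply: contra ncl; apply: clS; apply: subsetIr.
Qed.

Lemma greedy_isb M i : is_basis M (greedy M i).
Proof.
have [] := greedy_arc M i n; rewrite arcT setIT => iG eG.
by rewrite /is_basis iG eG eqxx.
Qed.

Lemma count_cyc_word i B m : count (fun z => z < m) (cyc_word i B) = #|B :&: cyc_arc i m|.
Proof.
rewrite /cyc_word count_sort count_map cardE -size_filter.
apply/perm_size/uniq_perm => [||x]; [exact/filter_uniq/enum_uniq|exact: enum_uniq|].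
by rewrite mem_filter !mem_enum !inE /= andbC.
Qed.

Lemma cyc_word_inj i : injective (fun B => cyc_word i B).
Proof.
move=> B B' e; apply/setP => x.
have : perm_eq [seq cyc_pos i x | x <- enum B] [seq cyc_pos i x | x <- enum B'].
  rewrite -(perm_sort leq) perm_sym -(perm_sort leq) perm_sym.
  by rewrite [sort _ _]e perm_refl.
move=> /perm_mem /(_ (cyc_pos i x)).
by rewrite !(mem_map (@cyc_pos_inj _ i)) !mem_enum.
Qed.

(** Pointwise larger counting functions mean pointwise smaller entries. *)
Lemma lexi_count (s s' : seq nat) : sorted leq s -> sorted leq s' -> size s = size s' ->
  (forall m, count (fun z => z < m) s' <= count (fun z => z < m) s) ->
  ((s : seqlexi nat) <= (s' : seqlexi nat))%O.
Proof.
elim: s s' => [|x s IHs] [|y s'] //= ps ps' [es] H.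
have xs z : z \in s -> x <= z by apply/allP; apply: order_path_min ps; apply: leq_trans.
have ys z : z \in s' -> y <= z by apply/allP; apply: order_path_min ps'; apply: leq_trans.
have xy : x <= y.
  rewrite leqNgt; apply/negP => yx; have := H y.+1; rewrite ltnSn.
  have -> : (x < y.+1) = false by rewrite ltnS leqNgt yx.
  suff -> : count (fun z => z < y.+1) s = 0 by [].
  apply/eqP; rewrite -leqn0 leqNgt -has_count; apply/hasPn => z /xs xz.
  by rewrite -ltnNge ltnS; apply: leq_trans xz.
rewrite Order.SeqLexiOrder.lexi_cons; apply/andP; split; first exact: xy.
apply/implyP => yx; have exy : x = y by apply/eqP; rewrite eqn_leq xy; apply: yx.
apply: IHs => //; [exact: path_sorted ps|exact: path_sorted ps'|].
by move=> m; have := H m; rewrite exy leq_add2l.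
Qed.

Lemma greedy_lexi M i B : is_basis M B -> (cyc_word i (greedy M i) <= cyc_word i B)%O.
Proof.
move=> bB; apply: lexi_count; rewrite ?sort_sorted //; try exact: leq_total.
  by rewrite !size_sort !size_map -!cardE (isb_card bB) (isb_card (greedy_isb M i)).
move=> m; rewrite !count_cyc_word; have [_ <-] := greedy_arc M i m.
apply: card_le_rk; last exact: subsetIr.
by apply: indepS (isb_indep bB) _; apply: subsetIl.
Qed.

Lemma necklace_entryE M i : necklace_entry M i = greedy M i.
Proof.
rewrite /necklace_entry; case: pickP => [B /andP[bB /forall_inP HB]|H] /=.
  rewrite basesE in bB; apply: (@cyc_word_inj i); apply: Order.POrderTheory.le_anti.
  by rewrite HB ?basesE ?greedy_isb ?greedy_lexi.
have := H (greedy M i); rewrite basesE greedy_isb /= => /negP[].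
by apply/forall_inP => B; rewrite basesE; apply: greedy_lexi.
Qed.

(** Necklace entries are greedy bases. The greedy basis from [i] on and the ranks of
    the arcs that start at [i] determine each other. *)
Lemma envelope_classE M P : (M \in envelope_class P) <-> arc_equiv M P.
Proof.
rewrite inE; split=> [/eqP /ffunP e i m|H].
  have := e i; rewrite !ffunE !necklace_entryE => eG.
  by have [_ ->] := greedy_arc M i m; have [_ ->] := greedy_arc P i m; rewrite eG.
apply/eqP/ffunP => i; rewrite !ffunE !necklace_entryE; apply/setP => x.
by rewrite !inE /spans -arc_pos_S !H.
Qed.

End Necklace.

Import Order.TTheory GRing.Theory Num.Theory.
Local Open Scope ring_scope.

(** * Column matroids *)

Section ColumnMatroid.
Variables (F : fieldType) (m n : nat).
Implicit Types (A : 'M[F]_(m, n)) (S X Y : {set 'I_n}) (x c : 'cV[F]_n).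

Definition supported x S : Prop := forall j, j \notin S -> x j 0 = 0.

Lemma mulmx_colE A x : A *m x = \sum_j x j 0 *: col j A.
Proof.
apply/matrixP => i k; rewrite (ord1 k) !mxE summxE; apply: eq_bigr => j _.
by rewrite !mxE mulrC.
Qed.

Lemma col_indepP A S : reflect (forall x, supported x S -> A *m x = 0 -> x = 0)
  (S \in col_indep A).
Proof.
have e1 (k : 'I_#|S| -> F) : \sum_i k i *: [seq col j A | j <- enum S]`_i =
    \sum_i k i *: col (enum_val i) A.
  apply: eq_bigr => i _; rewrite (nth_map (enum_val i)) ?nth_enum_rank //; last by rewrite -cardE.
  by congr (_ *: col _ A); apply/esym/enum_val_nth.
rewrite inE; apply: (iffP idP) => [fr x xS Ax|H].
  have sz : size [seq col j A | j <- enum S] == #|S| by rewrite size_map -cardE.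
  have /freeP/(_ (fun i => x (enum_val i) 0)) K : free (Tuple sz) by [].
  have {}K : forall i : 'I_#|S|, x (enum_val i) 0 = 0.
    apply: K; rewrite e1 -(big_enum_val (fun j => x j 0 *: col j A)) /= -[RHS]Ax mulmx_colE.
    rewrite [RHS](bigID (mem S)) /= [X in _ + X]big1 ?addr0 // => j jS.
    by rewrite xS ?scale0r.
  apply/colP => j; rewrite mxE; have [jS|/xS //] := boolP (j \in S).
  by rewrite -(enum_rankK_in jS jS) K.
have sz : size [seq col j A | j <- enum S] == #|S| by rewrite size_map -cardE.
suff : free (Tuple sz) by [].
apply/freeP => k; rewrite e1 => k0 i.
pose x : 'cV[F]_n := \col_j (if insub (index j (enum S)) is Some r then k r else 0).
have xe (r : 'I_#|S|) : x (enum_val r) 0 = k r.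
  rewrite mxE (enum_val_nth (enum_val r)) index_uniq ?enum_uniq -?cardE //.
  by rewrite insubT //= => p; congr k; apply: val_inj.
suff x0 : x = 0 by rewrite -xe x0 mxE.
apply: H => [j jS|].
  by rewrite mxE insubN // cardE index_mem mem_enum.
rewrite mulmx_colE (bigID (mem S)) /= [X in _ + X]big1 ?addr0 => [|j jS].
  rewrite (big_enum_val (fun j => x j 0 *: col j A)) /=; apply: etrans k0.
  by apply: eq_bigr => r _; rewrite xe.
by rewrite mxE insubN ?scale0r // cardE index_mem mem_enum.
Qed.

Definition inspan A X (v : 'cV[F]_m) : Prop := exists2 c, supported c X & v = A *m c.

Lemma inspan0 A X : inspan A X 0.
Proof. by exists 0; rewrite ?mulmx0 // => j _; rewrite mxE. Qed.

Lemma inspanD A X u v : inspan A X u -> inspan A X v -> inspan A X (u + v).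
Proof.
case=> c sc -> [d sd ->]; exists (c + d); rewrite ?mulmxDr // => j jX.
by rewrite mxE sc // sd // addr0.
Qed.

Lemma inspanZ A X a v : inspan A X v -> inspan A X (a *: v).
Proof. by case=> c sc ->; exists (a *: c); rewrite ?scalemxAr // => j jX; rewrite mxE sc // mulr0. Qed.

Lemma inspanB A X u v : inspan A X u -> inspan A X v -> inspan A X (u - v).
Proof. by move=> hu hv; apply: inspanD hu _; rewrite -scaleN1r; apply: inspanZ. Qed.

Lemma inspan_sum A X (I : finType) (P : pred I) (f : I -> 'cV[F]_m) :
  (forall i, P i -> inspan A X (f i)) -> inspan A X (\sum_(i | P i) f i).
Proof. by move=> H; elim/big_ind: _ => //; [exact: inspan0|exact: inspanD]. Qed.

Lemma inspan_col A X j : j \in X -> inspan A X (col j A).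
Proof.
move=> jX; exists (delta_mx j 0); rewrite ?colE // => i iX; rewrite mxE.
by case: eqP iX => [->|]; rewrite ?jX.
Qed.

Lemma inspan_trans A X Y v : (forall j, j \in X -> inspan A Y (col j A)) ->
  inspan A X v -> inspan A Y v.
Proof.
move=> H [c sc ->]; rewrite mulmx_colE; apply: inspan_sum => j _.
have [/H|/sc ->] := boolP (j \in X); first exact: inspanZ.
by rewrite scale0r; apply: inspan0.
Qed.

Lemma inspanS A X Y v : X \subset Y -> inspan A X v -> inspan A Y v.
Proof. by move=> s; apply: inspan_trans => j /(subsetP s); apply: inspan_col. Qed.

Lemma inspanU1 A X (x : 'I_n) v : inspan A (x |: X) v <-> exists a, inspan A X (v - a *: col x A).
Proof.
split=> [[c sc ->]|[a H]].
  exists (if x \in X then 0 else c x 0); case: ifP => xX.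
    by rewrite scale0r subr0; exists c => // j jX; apply: sc; rewrite !inE negb_or jX andbT; apply: contraNneq jX => ->.
  exists (c - c x 0 *: delta_mx x 0); last by rewrite mulmxBr -scalemxAr -colE.
  move=> j jX; rewrite !mxE eqxx andbT; have [->|jx] := eqVneq j x; first by rewrite mulr1 subrr.
  by rewrite mulr0 subr0 sc // !inE negb_or jx.
rewrite -[v](subrK (a *: col x A)); apply: inspanD.
  by apply: inspanS H; apply: subsetUr.
by apply/inspanZ/inspan_col; rewrite setU11.
Qed.

Lemma mem_spanP A X v : reflect (inspan A X v) (v \in <<[seq col j A | j <- enum X]>>%VS).
Proof.
apply: (iffP idP) => [vX|[c sc ->]].
  rewrite (coord_span (X := in_tuple _) vX); apply: inspan_sum => i _; apply: inspanZ.
  have : [seq col j A | j <- enum X]`_i \in [seq col j A | j <- enum X] by apply: mem_nth.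
  by case/mapP => j; rewrite mem_enum => jX ->; apply: inspan_col.
rewrite mulmx_colE; apply: memv_suml => j _; have [jX|/sc ->] := boolP (j \in X).
  by apply/memvZ/memv_span/map_f; rewrite mem_enum.
by rewrite scale0r mem0v.
Qed.

Lemma clP A X (x : 'I_n) : reflect (inspan A X (col x A)) (spans (col_matroid A) X x).
Proof.
set M := col_matroid A.
have key (y : 'I_n) (Z : {set 'I_n}) : Z \in indep M -> y \notin Z ->
    spans M Z y = (col y A \in <<[seq col j A | j <- enum Z]>>%VS).
  move=> iZ yZ; have := indepU1 iZ yZ; move/(congr1 negb); rewrite negbK => <-.
  rewrite /M /= !inE.
  have -> : free [seq col j A | j <- enum (y |: Z)] = free (col y A :: [seq col j A | j <- enum Z]).
    rewrite -[col y A :: _]/[seq col j A | j <- y :: enum Z].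
    apply/perm_free/perm_map/uniq_perm; rewrite ?enum_uniq //= ?mem_enum ?yZ ?enum_uniq //.
    by move=> z; rewrite inE !mem_enum !inE.
  by move: iZ; rewrite /M /= inE free_cons => ->; rewrite andbT negbK.
suff H : spans M X x <-> inspan A X (col x A) by apply: (iffP idP) => /H.
have [B [iB sB eB]] := rk_wit M X.
have clB j : j \in X -> spans M B j.
  by move=> jX; apply: (rk_cl sB) jX; rewrite -eB rk_indep.
have spB j : j \in X -> inspan A B (col j A).
  move=> jX; have [jB|jB] := boolP (j \in B); first exact: inspan_col.
  by apply/mem_spanP; rewrite -key // clB.
have [xX|xX] := boolP (x \in X); first by split=> _; [apply: inspan_col|apply: mem_cl].
have xB : x \notin B by apply: contra xX; apply: subsetP.
split=> [cx|sx].
  apply: inspanS sB _; apply/mem_spanP; rewrite -key //.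
  exact: cl_trans clB cx.
apply: clS sB _; rewrite key //; apply/mem_spanP; exact: inspan_trans spB sx.
Qed.

(** Provides the linear forms that project along a column, and that exhibit coloops
    and series pairs. *)
Lemma inspan_sep A X (x : 'I_n) : ~~ spans (col_matroid A) X x ->
  exists w : 'rV[F]_m, (w *m A) 0 x = 1 /\ forall j, j \in X -> (w *m A) 0 j = 0.
Proof.
move=> ncl; pose C := \matrix_(i < n, j < m) (if i \in X then A j i else 0).
have [/submxP[D eD]|] := boolP ((col x A)^T <= C)%MS.
  case/clP: ncl; exists (\col_j (if j \in X then D 0 j else 0)).
    by move=> j /negPf jX; rewrite mxE jX.
  apply/colP => i; have /matrixP/(_ 0 i) := eD; rewrite !mxE => ->.
  by apply: eq_bigr => j _; rewrite !mxE; case: ifP; rewrite ?mulr0 ?mul0r // mulrC.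
rewrite submxE => /eqP/matrixP nz.
have [j nj] : exists j, ((col x A)^T *m cokermx C) 0 j != 0.
  apply/existsP; apply: contraT; rewrite negb_exists => /forallP H; case: nz => i j.
  by rewrite (ord1 i) [RHS]mxE; apply/eqP; rewrite -[_ == _]negbK.
set a := (_ *m _) 0 j in nj.
have dual (v : 'cV[F]_m) : (a^-1 *: (col j (cokermx C))^T *m v) 0 0 = a^-1 * (v^T *m cokermx C) 0 j.
  by rewrite -scalemxAl mxE; congr (_ * _); rewrite !mxE; apply: eq_bigr => i _; rewrite !mxE mulrC.
have colw (w : 'rV[F]_m) i : (w *m A) 0 i = (w *m col i A) 0 0.
  by rewrite !mxE; apply: eq_bigr => u _; rewrite !mxE.
exists (a^-1 *: (col j (cokermx C))^T); split=> [|i iX].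
  by rewrite colw dual mulVf.
rewrite colw dual; have -> : (col i A)^T = row i C by apply/rowP => u; rewrite !mxE iX.
by rewrite -row_mul mulmx_coker row0 mxE mulr0.
Qed.

End ColumnMatroid.

(** * Maximal minors *)

Section Minors.
Variables (F : fieldType) (n : nat).
Implicit Types (S I Q : {set 'I_n}) (x y : 'I_n).

Lemma minor_cast k (A : 'M[F]_(k, n)) I (e : k = #|I|) :
  minor A I = \det (colsub (fun i => enum_val (cast_ord e i)) A).
Proof.
move: (e) A; rewrite e => e' A; rewrite /minor conform_mx_id; congr (\det _).
by apply/matrixP => i j; rewrite !mxE cast_ord_id.
Qed.

Lemma minor_neq0 k (A : 'M[F]_(k, n)) I : #|I| = k -> (minor A I != 0) = (I \in col_indep A).
Proof.
move=> e; rewrite (minor_cast A (esym e)).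
pose g (i : 'I_k) : 'I_n := enum_val (cast_ord (esym e) i); rewrite -/g.
have gI i : g i \in I by apply: enum_valP.
have ginj : injective g by move=> i j /enum_val_inj /cast_ord_inj.
have ge y : y \in I -> exists i, g i = y.
  by move=> yI; exists (cast_ord e (enum_rank_in yI y)); rewrite /g cast_ordK enum_rankK_in.
set C := colsub g A.
pose up (v : 'cV[F]_k) : 'cV[F]_n := \sum_i v i 0 *: delta_mx (g i) 0.
have upE v i : up v (g i) 0 = v i 0.
  rewrite summxE (bigD1 i) //= big1 => [|j ji]; rewrite !mxE !eqxx ?mulr1 ?addr0 //.
  by rewrite (inj_eq ginj) eq_sym (negPf ji) mulr0.
have upS v : supported (up v) I.
  move=> j jI; rewrite summxE big1 // => i _; rewrite !mxE.
  by case: eqP jI => [->|_ _]; rewrite ?gI // mulr0.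
have upA v : A *m up v = C *m v.
  rewrite mulmx_sumr [RHS]mulmx_colE; apply: eq_bigr => i _.
  by rewrite -scalemxAr -colE; congr (_ *: _); apply/colP => u; rewrite !mxE.
apply/idP/col_indepP => [dC x xI Ax|H].
  have uC : C \in unitmx by rewrite unitmxE unitfE.
  pose v : 'cV[F]_k := \col_i x (g i) 0.
  have xv : x = up v.
    apply/colP => y; have [/ge[i <-]|yI] := boolP (y \in I); first by rewrite upE mxE.
    by rewrite upS ?xI.
  have v0 : v = 0 by rewrite -(mulKmx uC v) -upA -xv Ax mulmx0.
  by rewrite xv v0 /up big1 // => i _; rewrite mxE scale0r.
rewrite -unitfE -unitmxE -unitmx_tr -row_free_unit -kermx_eq0; apply/eqP/row_matrixP => i.
rewrite row0; apply: trmx_inj; rewrite trmx0; set v := (row i _)^T.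
have Cv : C *m v = 0.
  by apply: trmx_inj; rewrite trmx_mul trmxK -row_mul mulmx_ker row0 trmx0.
have u0 : up v = 0 by apply: H; rewrite ?upA.
by apply/colP => j; rewrite -upE u0 !mxE.
Qed.

Let ltI : rel 'I_n := fun a b => (a < b)%N.

Lemma enum_set_sorted S : sorted ltI (enum S).
Proof.
have e : sorted ltI (enum 'I_n).
  suff : sorted ltn (map val (enum 'I_n)) by rewrite sorted_map.
  by rewrite val_enum_ord iota_ltn_sorted.
rewrite enumT in e; apply: sorted_filter e => a b c; exact: ltn_trans.
Qed.

Lemma enum_set_split S x : x \notin S ->
  enum S = [seq s : 'I_n <- enum S | (s < x)%N] ++ [seq s : 'I_n <- enum S | (x < s)%N] /\
  enum (x |: S) = [seq s : 'I_n <- enum S | (s < x)%N] ++ x :: [seq s : 'I_n <- enum S | (x < s)%N].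
Proof.
move=> xS.
have tr : transitive ltI by move=> a b c; apply: ltn_trans.
have ir : irreflexive ltI by move=> a; apply: ltnn.
have ss := enum_set_sorted S.
have s1 (p : pred 'I_n) : sorted ltI [seq s : 'I_n <- enum S | p s] by apply: sorted_filter.
have all1 : all (fun a : 'I_n => (a < x)%N) [seq s : 'I_n <- enum S | (s < x)%N] by apply: filter_all.
have all2 : all (fun a : 'I_n => (x < a)%N) [seq s : 'I_n <- enum S | (x < s)%N] by apply: filter_all.
split; apply: (irr_sorted_eq tr ir) => //; try exact: enum_set_sorted.
- rewrite sorted_pairwise // pairwise_cat -!sorted_pairwise // !s1 !andbT.
  apply/allrelP => a b; rewrite !mem_filter => /andP[ax _] /andP[xb _].
  exact: ltn_trans ax xb.
- move=> y; rewrite mem_cat [X in _ = X || _]mem_filter [X in _ = _ || X]mem_filter !mem_enum -andb_orl.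
  by case: (ltngtP y x) => // /val_inj ->; rewrite (negPf xS).
- rewrite sorted_pairwise // pairwise_cat /= -!sorted_pairwise // !s1 !andbT.
  apply/andP; split; last exact: all2.
  apply/allrelP => a b; rewrite inE !mem_filter => /andP[ax _] /orP[/eqP -> //|/andP[xb _]].
  exact: ltn_trans ax xb.
- move=> y; rewrite mem_cat inE [X in _ = X || _]mem_filter [X in _ = _ || (_ || X)]mem_filter !mem_enum !inE.
  by case: (ltngtP y x) => [h|h|/val_inj ->]; rewrite ?eqxx ?orbT //= -val_eqE /= ltn_eqF ?gtn_eqF ?h ?orbF //.
Qed.

Lemma nth_bump (T : Type) (d y : T) (a b : seq T) j :
  nth d (a ++ y :: b) (bump (size a) j) = nth d (a ++ b) j.
Proof.
rewrite /bump !nth_cat; case: (leqP (size a) j) => h; last by rewrite h.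
by rewrite add1n ltnNge leqW //= subSn.
Qed.

(** Laplace expansion along the column of [x]; the sign sorts the columns. *)
Lemma minor_linear k (A : 'M[F]_(k, n)) S : #|S|.+1 = k ->
  exists w : 'rV[F]_k, (forall s, s \in S -> (w *m A) 0 s = 0) /\
    forall x, x \notin S -> minor A (x |: S) = (-1) ^+ #|[set s in S | (s < x)%N]| * (w *m A) 0 x.
Proof.
move=> e; move: A; rewrite -e => A {k e}.
pose C := colsub (enum_val : 'I_#|S| -> 'I_n) A.
exists (\row_i ((-1) ^+ i * \det (row' i C))).
have expand (g : 'I_#|S|.+1 -> 'I_n) p x : g p = x -> (forall j, g (lift p j) = enum_val j) ->
    \det (colsub g A) = (-1) ^+ p * ((\row_i ((-1) ^+ i * \det (row' i C))) *m A) 0 x.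
  move=> gp gl; rewrite (expand_det_col _ p) mxE big_distrr; apply: eq_bigr => i _ /=.
  rewrite !mxE gp /cofactor.
  have -> : row' i (col' p (colsub g A)) = row' i C.
    by apply/matrixP => u v; rewrite !mxE gl.
  by rewrite exprD; ring.
split=> [s sS|x xS].
  pose g (i : 'I_#|S|.+1) := if unlift ord0 i is Some j then enum_val j else s.
  have := expand g ord0 s; rewrite /g unlift_none expr0 mul1r => <- //; last first.
    by move=> j; rewrite liftK.
  rewrite -det_tr; apply: (@determinant_alternate _ _ _ ord0 (lift ord0 (enum_rank_in sS s))) => //.
  by move=> j; rewrite !mxE unlift_none liftK enum_rankK_in.
have cI : #|S|.+1 = #|x |: S| by rewrite cardsU1 xS.
rewrite (minor_cast A cI).
have [e1 e2] := enum_set_split xS.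
set a := filter _ _ in e1 e2; set b := filter _ _ in e1 e2.
have sa : size a = #|[set s in S | (s < x)%N]|.
  rewrite cardE; apply/perm_size/uniq_perm => [||s]; [exact/filter_uniq/enum_uniq|exact: enum_uniq|].
  by rewrite mem_filter !mem_enum !inE andbC.
have lp : (size a < #|S|.+1)%N by rewrite ltnS cardE e1 size_cat leq_addr.
rewrite -sa; apply: (expand _ (Ordinal lp)) => [|j].
  by rewrite (enum_val_nth x) e2 /= nth_cat ltnn subnn.
by rewrite !(enum_val_nth x) e2 e1 /= nth_bump.
Qed.

Lemma linear_form_span k (A : 'M[F]_(k, n)) (w : 'rV[F]_k) S x : spans (col_matroid A) S x ->
  (forall s, s \in S -> (w *m A) 0 s = 0) -> (w *m A) 0 x = 0.
Proof.
move=> /clP[c sc ec] H.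
have -> : (w *m A) 0 x = (w *m col x A) 0 0 by rewrite !mxE; apply: eq_bigr => i _; rewrite !mxE.
rewrite ec mulmxA mxE big1 // => j _.
by have [/H ->|/sc ->] := boolP (j \in S); rewrite ?mul0r ?mulr0.
Qed.

End Minors.

Section TotallyNonnegative.
Variables (R : realFieldType) (n : nat).
Implicit Types (Q : {set 'I_n}).

(** Three-term Pluecker relation: up to sign, the minors with all columns but one in
    [Q + p], [Q + q] and [Q + r] are linear forms [wp], [wq], [wr] of the last
    column. The combination [h] of them vanishes on the basis [Q + p + r], hence
    at [s]. Since the chords [pq] and [rs] cross, its signs make the product of the
    minors at [pq] and [rs] a sum of two nonnegative products, of which the one for
    the given bases is positive. *)
Lemma tnn_noncrossing k (A : 'M[R]_(k, n)) : rk (col_matroid A) setT = k ->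
  (forall I : {set 'I_n}, #|I| = k -> 0 <= minor A I) -> noncrossing (col_matroid A).
Proof.
set M := col_matroid A => rM pos Q p q r s [pq pr ps qr] qs rs /and4P[pQ qQ rQ sQ] cr bpr bqs.
pose D x y := minor A (x |: (y |: Q)).
have DC x y : D x y = D y x by rewrite /D setUCA.
have cQ x : x \notin Q -> #|x |: Q| = #|Q|.+1 by move=> h; rewrite cardsU1 h.
have card2 x y : x != y -> x \notin Q -> y \notin Q -> #|x |: (y |: Q)| = #|Q|.+2.
  by move=> xy xQ yQ; rewrite cardsU1 cQ // !inE negb_or xy xQ.
have ek : #|Q|.+2 = k by rewrite -(card2 p r) // (isb_card bpr).
have Dne x y : x != y -> x \notin Q -> y \notin Q -> is_basis M (x |: (y |: Q)) = (D x y != 0).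
  move=> xy xQ yQ; rewrite minor_neq0 ?card2 // /is_basis rM card2 // ek eqxx andbT //.
have Dge x y : x != y -> x \notin Q -> y \notin Q -> 0 <= D x y.
  by move=> xy xQ yQ; apply: pos; rewrite card2.
pose q' (x : 'I_n) := #|[set z in Q | (z < x)%N]|.
have lin y : y \notin Q -> exists w : 'rV[R]_k, [/\ forall z, z \in Q -> (w *m A) 0 z = 0,
    (w *m A) 0 y = 0 & forall x, x != y -> x \notin Q -> (w *m A) 0 x = (-1) ^+ (q' x) * (-1) ^+ (y < x)%N * D x y].
  move=> yQ; have [|w [w0 wx]] := @minor_linear _ _ k A (y |: Q); first by rewrite cQ.
  exists w; split=> [z zQ||x xy xQ]; [by rewrite w0 // !inE zQ orbT|by rewrite w0 ?setU11|].
  rewrite /D wx ?inE ?negb_or ?xy //.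
  have -> : #|[set z in y |: Q | (z < x)%N]| = (q' x + (y < x)%N)%N.
    rewrite /q'; case: ltnP => yx.
      have -> : [set z in y |: Q | (z < x)%N] = y |: [set z in Q | (z < x)%N].
        by apply/setP => z; rewrite !inE; case: (z =P y) => [->|]; rewrite ?yx.
      by rewrite cardsU1 inE (negPf yQ) addnC.
    rewrite addn0; apply: eq_card => z; rewrite !inE; case: (z =P y) => [->|] //.
    by rewrite (negPf yQ) ltnNge yx.
  by rewrite -exprD mulrA -expr2 sqrr_sign mul1r.
have [wp [p0 pp fp]] := lin p pQ; have [wr [r0 rr fr]] := lin r rQ; have [wq [q0 qq fq]] := lin q qQ.
set f := fun w : 'rV[R]_k => w *m A.
pose h := ((f wp 0 r * f wr 0 p) *: wq - (f wq 0 r * f wr 0 p) *: wp) - (f wq 0 p * f wp 0 r) *: wr.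
have hE x : (h *m A) 0 x = f wp 0 r * f wr 0 p * f wq 0 x - f wq 0 r * f wr 0 p * f wp 0 x - f wq 0 p * f wp 0 r * f wr 0 x.
  by rewrite !mulmxBl -!scalemxAl !mxE.
have : (h *m A) 0 s = 0.
  apply: (linear_form_span (isb_cl s bpr)) => z; rewrite !inE => /or3P[/eqP ->|/eqP ->|zQ]; rewrite hE /f.
  - by rewrite pp; ring.
  - by rewrite rr; ring.
  - by rewrite (p0 z zQ) (q0 z zQ) (r0 z zQ); ring.
have [rp rq series_parallel] : [/\ r != p, r != q & s != p] by rewrite ![_ == p]eq_sym [_ == q]eq_sym.
have [sq sr] : s != q /\ s != r by rewrite [_ == q]eq_sym [_ == r]eq_sym.
rewrite hE /f (fp r rp rQ) (fr p pr pQ) (fq s sq sQ) (fq r rq rQ) (fp s series_parallel sQ) (fq p pq pQ) (fr s sr sQ).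
rewrite [D s q]DC [D r q]DC [D r p]DC [D s p]DC [D s r]DC => E.
have [ge1 ge2 ge3 ge4] : [/\ 0 < D p r, 0 < D q s, 0 <= D q r & 0 <= D p s].
  by split; rewrite ?Dge // 1?eq_sym // lt0r -Dne ?Dge // ?bpr ?bqs.
have [ge5 ge6] : 0 <= D p q /\ 0 <= D r s by split; apply: Dge.
have E' : (-1) ^+ (q < s)%N * (-1) * (D q s * D p r) =
   (-1) ^+ (q < r)%N * (-1) ^+ (p < s)%N * (-1) ^+ (r < p)%N * (D q r * D p s) +
   (-1) ^+ (q < p)%N * (-1) ^+ (r < s)%N * (-1) ^+ (p < r)%N * (D p q * D r s) :> R.
  have sg : (-1) ^+ (p < r)%N * (-1) ^+ (r < p)%N = -1 :> R.
    by case: (ltngtP p r) => [_|_|/val_inj epr]; [rewrite mulr1|rewrite mul1r|rewrite epr eqxx in pr].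
  apply/eqP; rewrite -subr_eq0.
  suff : (-1) ^+ q' r * (-1) ^+ q' p * (-1) ^+ q' s * D p r *
      ((-1) ^+ (q < s)%N * (-1) * (D q s * D p r) -
       ((-1) ^+ (q < r)%N * (-1) ^+ (p < s)%N * (-1) ^+ (r < p)%N * (D q r * D p s) +
        (-1) ^+ (q < p)%N * (-1) ^+ (r < s)%N * (-1) ^+ (p < r)%N * (D p q * D r s))) == 0.
    by rewrite !mulf_eq0 !signr_eq0 (gt_eqF ge1).
  move: sg E; move: ((-1) ^+ (p < r)%N) ((-1) ^+ (r < p)%N) ((-1) ^+ (q < s)%N) ((-1) ^+ (q < r)%N).
  move: ((-1) ^+ (p < s)%N) ((-1) ^+ (q < p)%N) ((-1) ^+ (r < s)%N).
  move: ((-1) ^+ q' r) ((-1) ^+ q' p) ((-1) ^+ q' s) => s1 s2 s3 s4 s5 s6 s7 s8 s9 s10 sg E.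
  by rewrite -sg; apply/eqP; apply: etrans E; ring.
have {}E' : 0 < D p q * D r s.
  have x0 : 0 < D q s * D p r by apply: mulr_gt0.
  have y0 : 0 <= D q r * D p s by apply: mulr_ge0.
  move: cr E'; move: (D p q * D r s) (D q s * D p r) (D q r * D p s) x0 y0.
  move: pq pr ps qr qs rs; rewrite -!val_eqE /=; clear.
  case: (ltnP q s); case: (ltnP q r); case: (ltnP p s); case: (ltnP r p); case: (ltnP q p);
    case: (ltnP r s); case: (ltnP p r); rewrite /crossing /within ?expr0 ?expr1
      => h1 h2 h3 h4 h5 h6 h7 n1 n2 n3 n4 n5 n6 x y z x0 y0 cr E;
    (* positions that make the chords not cross are impossible; the others have the right signs *)
    try (exfalso; move: h1 h2 h3 h4 h5 h6 h7 n1 n2 n3 n4 n5 n6 cr; clear; lia);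
    move: x0 y0 E; clear; lra.
by rewrite !Dne //; split; apply: contraTneq E' => ->; rewrite ?mul0r ?mulr0 ltxx.
Qed.

End TotallyNonnegative.

(** * Matrix operations *)

Section MatrixOps.
Variables (F : fieldType) (n : nat).
Implicit Types (S X Y : {set 'I_n}) (e f b c : 'I_n).

Lemma supportedS (x : 'cV[F]_n) S X : S \subset X -> supported x S -> supported x X.
Proof. by move=> s h j jX; apply: h; apply: contra jX; apply: subsetP. Qed.

Lemma supported_delta e S : e \in S -> supported (delta_mx e 0 : 'cV[F]_n) S.
Proof. by move=> eS j jS; rewrite mxE; case: eqP jS => [->|//]; rewrite eS. Qed.

Lemma supportedD (x y : 'cV[F]_n) S : supported x S -> supported y S -> supported (x + y) S.
Proof. by move=> hx hy j jS; rewrite mxE hx ?hy ?addr0. Qed.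

Lemma supportedZ a (x : 'cV[F]_n) S : supported x S -> supported (a *: x) S.
Proof. by move=> hx j jS; rewrite mxE hx ?mulr0. Qed.

Lemma delta_neq0 e : (delta_mx e 0 : 'cV[F]_n) <> 0.
Proof. by move/matrixP/(_ e 0); rewrite !mxE !eqxx => /eqP; rewrite oner_eq0. Qed.

Lemma loop_colP m (A : 'M[F]_(m, n)) e : loop (col_matroid A) e = (col e A == 0).
Proof.
apply/idP/eqP => [l|c0].
  have /clP[c _ ec] : spans (col_matroid A) set0 e by apply: loop_cl.
  have : spans (col_matroid A) set0 e by apply: loop_cl.
  case/clP => d sd ->; suff -> : d = 0 by rewrite mulmx0.
  by apply/colP => j; rewrite sd ?inE // mxE.
apply/negP => /col_indepP H; apply: (@delta_neq0 e); apply: H; last by rewrite -colE.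
by apply: supported_delta; rewrite inE.
Qed.

(** Used to degenerate a corner: the shear keeps the rank of every set that avoids
    [b] or contains [c]. *)
Definition shear m (A : 'M[F]_(m, n)) b c a : 'M[F]_(m, n) :=
  \matrix_(i, j) (if j == b then A i b - a * A i c else A i j).

Section Shear.
Variables (m : nat) (A : 'M[F]_(m, n)) (b c : 'I_n) (a : F).
Hypothesis bc : b != c.
Let A' := shear A b c a.

Lemma shear_mul (x : 'cV[F]_n) : A' *m x = A *m (x - (a * x b 0) *: delta_mx c 0).
Proof.
rewrite mulmxBr -scalemxAr -colE; apply/colP => i; rewrite !mxE.
rewrite (bigD1 b) //= [in RHS](bigD1 b) //= !mxE eqxx.
rewrite mulrBl -!addrA; congr (_ + _); rewrite addrC; congr (_ + _); last by ring.
by apply: eq_bigr => j jb; rewrite mxE (negPf jb).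
Qed.

Lemma shear_col j : j != b -> col j A' = col j A.
Proof. by move=> jb; apply/colP => i; rewrite !mxE (negPf jb). Qed.

Lemma shear_colb : col b A' = col b A - a *: col c A.
Proof. by apply/colP => i; rewrite !mxE eqxx. Qed.

Lemma shear_inspan X v : b \notin X -> inspan A' X v <-> inspan A X v.
Proof.
move=> bX; have jb j : j \in X -> j != b by apply: contraTneq => ->.
have e (x : 'cV[F]_n) : supported x X -> A' *m x = A *m x.
  by move=> sx; rewrite shear_mul sx // mulr0 scale0r subr0.
by split=> -[x sx ->]; exists x; rewrite // e.
Qed.

Lemma shear_indep X : (b \notin X) || (c \in X) -> (X \in col_indep A') = (X \in col_indep A).
Proof.
move=> H.
have tauS (x : 'cV[F]_n) k : supported x X -> supported (x - (k * x b 0) *: delta_mx c 0) X.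
  move=> sx; case/orP: H => [bX|cX]; first by rewrite sx // mulr0 scale0r subr0.
  by rewrite -scaleNr; apply: supportedD sx _; apply/supportedZ/supported_delta.
have tauK (x : 'cV[F]_n) k : x - (k * x b 0) *: delta_mx c 0 = 0 :> 'cV[F]_n -> x = 0.
  move=> h; have xb : x b 0 = 0.
    by have /colP/(_ b) := h; rewrite !mxE (negPf bc) mulr0 subr0.
  by move: h; rewrite xb mulr0 scale0r subr0.
apply/col_indepP/col_indepP => K x sx Ax; apply: (tauK x).
  apply: (K _ (tauS x (- a) sx)); rewrite shear_mul -[RHS]Ax; congr (_ *m _).
  rewrite !mxE (negPf bc) mulr0 subr0 mulNr scaleNr opprK -addrA.
  by rewrite [_ - _]subrr addr0.
by apply: (K _ (tauS x a sx)); rewrite -shear_mul.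
Qed.

Lemma shear_rk X : ~~ loop (col_matroid A) c -> (b \notin X) || (c \in X) ->
  rk (col_matroid A') X = rk (col_matroid A) X.
Proof.
move=> lc H.
have lc' : ~~ loop (col_matroid A') c by rewrite loop_colP (shear_col (j := c)) -?loop_colP // eq_sym.
have good (m1 m2 : nat) (A1 : 'M[F]_(m1, n)) (A2 : 'M[F]_(m2, n)) : ~~ loop (col_matroid A1) c ->
    (forall Y, (b \notin Y) || (c \in Y) -> (Y \in col_indep A1) = (Y \in col_indep A2)) ->
    (rk (col_matroid A1) X <= rk (col_matroid A2) X)%N.
  move=> l1 e.
  have [B [iB sB <- hB]] : exists B, [/\ B \in indep (col_matroid A1), B \subset X,
      #|B| = rk (col_matroid A1) X & (b \notin B) || (c \in B)].
    case/orP: H => [bX|cX].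
      have [B [iB sB eB]] := rk_wit (col_matroid A1) X; exists B; split=> //.
      by apply/orP; left; apply: contra bX; apply: subsetP.
    have [||B [iB cB sB eB]] := @indep_extend _ (col_matroid A1) [set c] X; rewrite ?sub1set //.
      by move: l1; rewrite negbK.
    by exists B; split=> //; rewrite -!sub1set cB orbT.
  by apply: card_le_rk => //=; rewrite -e.
by apply/eqP; rewrite eqn_leq !good // => Y hY; rewrite shear_indep.
Qed.

End Shear.

(** The same [a] removes the [c]-component of [b] over all bases. *)
Lemma corner_degen_of_ratio m (A : 'M[F]_(m, n)) b c a : b != c -> ~~ loop (col_matroid A) c ->
  (forall S, b \notin S -> c \notin S -> is_basis (col_matroid A) (c |: S) ->
     inspan A S (col b A - a *: col c A)) ->
  corner_degen (col_matroid A) (col_matroid (shear A b c a)) b c.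
Proof.
move=> bc lc H; have rT := shear_rk a bc lc (X := setT).
have tT : (b \notin [set: 'I_n]) || (c \in [set: 'I_n]) by rewrite !inE.
split=> [X hX|S bS cS b1 b2].
  by rewrite /is_basis /= shear_indep // rT.
have bcS : is_basis (col_matroid A) (c |: S).
  have := b2; rewrite /is_basis /= shear_indep ?rT //.
  by rewrite !inE negb_or bc bS.
have : spans (col_matroid (shear A b c a)) S b.
  by apply/clP; apply/shear_inspan => //; rewrite shear_colb //; apply: H.
have iS : S \in indep (col_matroid (shear A b c a)).
  by apply: indepS (isb_indep b1) _; apply: subsetUr.
by move: (isb_indep b1); rewrite indepU1 // => /negP.
Qed.

(** [a] is the coefficient of [c] in the expansion of [b] over the basis [c |: S]; it
    is nonzero because [b] can replace [c]. *)
Lemma corner_ratio m (A : 'M[F]_(m, n)) b c :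
  replaces (col_matroid A) b c ->
  forall S, b \notin S -> c \notin S -> is_basis (col_matroid A) (c |: S) ->
  exists2 a, a != 0 & inspan A S (col b A - a *: col c A).
Proof.
move=> rep S bS cS bas; have /clP := isb_cl b bas.
case/inspanU1 => a ha; exists a => //; apply/eqP => a0.
have : spans (col_matroid A) S b by apply/clP; move: ha; rewrite a0 scale0r subr0.
have b1 := isb_indep (rep S bS cS bas).
have iS : S \in indep (col_matroid A) by apply: indepS b1 _; apply: subsetUr.
by move: b1; rewrite indepU1 // => /negP.
Qed.

Definition delcol m (A : 'M[F]_(m, n)) e : 'M[F]_(m, n) := \matrix_(i, j) (if j == e then 0 else A i j).

Lemma delcol_indep m (A : 'M[F]_(m, n)) e S :
  (S \in col_indep (delcol A e)) = (e \notin S) && (S \in col_indep A).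
Proof.
have e0 : delcol A e *m delta_mx e 0 = 0 :> 'cV[F]_m by rewrite -colE; apply/colP => i; rewrite !mxE eqxx.
have ea (x : 'cV[F]_n) : x e 0 = 0 -> delcol A e *m x = A *m x.
  move=> x0; apply/colP => i; rewrite !mxE; apply: eq_bigr => j _; rewrite !mxE.
  by case: eqP => [->|]; rewrite ?x0 ?mulr0.
have [eS|eS] /= := boolP (e \in S).
  apply/col_indepP => H; apply: (@delta_neq0 e); apply: H => //; exact: supported_delta.
by apply/col_indepP/col_indepP => H x sx; [rewrite -ea ?sx //|rewrite ea ?sx //]; apply: H.
Qed.

(** The matrix is the projection of [A] along its column [e] onto the kernel of [w]. *)
Lemma contract_indep m (A : 'M[F]_(m, n)) (w : 'rV[F]_m) e S : (w *m A) 0 e = 1 ->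
  (S \in col_indep (A - col e A *m (w *m A))) = (e \notin S) && (e |: S \in col_indep A).
Proof.
move=> we; set A0 := A - _.
have mulA0 (x : 'cV[F]_n) : A0 *m x = A *m (x - (w *m A *m x) 0 0 *: delta_mx e 0).
  rewrite mulmxBl mulmxBr -scalemxAr -colE; congr (_ - _).
  by rewrite -[LHS]mulmxA [X in _ *m X = _]mx11_scalar mul_mx_scalar.
have wd : (w *m A *m (delta_mx e 0 : 'cV[F]_n)) 0 0 = 1 by rewrite -colE mxE.
have e0 : A0 *m delta_mx e 0 = 0 :> 'cV[F]_m by rewrite mulA0 wd scale1r subrr mulmx0.
have [eS|eS] /= := boolP (e \in S).
  apply/col_indepP => H; apply: (@delta_neq0 e); apply: H => //; exact: supported_delta.
apply/col_indepP/col_indepP => H x sx Ax.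
  have y0 : x - x e 0 *: delta_mx e 0 = 0.
    apply: H => [j jS|].
      rewrite !mxE eqxx andbT; have [->|je] := eqVneq j e; first by rewrite mulr1 subrr.
      by rewrite mulr0 subr0 sx // !inE negb_or je.
    rewrite mulmxBr -scalemxAr e0 scaler0 subr0 mulA0 -mulmxA Ax mulmx0.
    by rewrite [X in X *: _]mxE scale0r subr0.
  have xe : x = x e 0 *: delta_mx e 0 by apply/eqP; rewrite -subr_eq0 y0.
  have : (w *m A *m x) 0 0 = x e 0 by rewrite xe -scalemxAr mxE wd !mxE !eqxx.
  by rewrite -mulmxA Ax mulmx0 mxE => x0; rewrite xe -x0 scale0r.
have y0 : x - (w *m A *m x) 0 0 *: delta_mx e 0 = 0.
  apply: H; last by rewrite -mulA0.
  rewrite -scaleNr; apply: supportedD; first by apply: supportedS sx; apply: subsetUr.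
  by apply/supportedZ/supported_delta; rewrite setU11.
have := y0; have /colP/(_ e) := y0; rewrite !mxE eqxx mulr1 (sx e eS) sub0r => /eqP.
by rewrite oppr_eq0 => /eqP ->; rewrite scale0r subr0.
Qed.

Section MatrixExt.
Variables (m : nat) (A : 'M[F]_(m, n)) (e f : 'I_n).
Hypothesis le : loop (col_matroid A) e.

Lemma col0_mul (x : 'cV[F]_n) a : A *m (x + a *: delta_mx e 0) = A *m x.
Proof. by move: le; rewrite loop_colP mulmxDr -scalemxAr -colE => /eqP ->; rewrite scaler0 addr0. Qed.

Lemma mul_addrow (u : 'rV[F]_n) (x : 'cV[F]_n) :
  (col_mx A u *m x = 0) <-> (A *m x = 0 /\ (u *m x) 0 0 = 0).
Proof.
rewrite mul_col_mx; split=> [/eqP|[-> h]].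
  by rewrite col_mx_eq0 => /andP[/eqP -> /eqP ->]; rewrite mxE.
by rewrite [u *m x]mx11_scalar h raddf0 col_mx0.
Qed.

Lemma matrix_col_ext : exists M : 'M[F]_(m + 1, n), col_ext (col_matroid A) (col_matroid M) e.
Proof.
exists (col_mx A (delta_mx 0 e)) => S /=.
have de (x : 'cV[F]_n) : ((delta_mx 0 e : 'rV[F]_n) *m x) 0 0 = x e 0 by rewrite -rowE mxE.
apply/col_indepP/col_indepP => H x sx => [Ax|/mul_addrow].
  apply: H; first by apply: supportedS sx; apply: subD1set.
  by apply/mul_addrow; rewrite de sx ?setD11.
rewrite de => -[Ax x0]; apply: H => // j; rewrite !inE negb_and negbK => /orP[/eqP -> //|].
exact: sx.
Qed.

Lemma matrix_ser_ext : e != f -> exists M : 'M[F]_(m + 1, n), ser_ext (col_matroid A) (col_matroid M) e f.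
Proof.
move=> ef; exists (col_mx A (delta_mx 0 e + delta_mx 0 f)) => S.
have de (x : 'cV[F]_n) : ((delta_mx 0 e + delta_mx 0 f : 'rV[F]_n) *m x) 0 0 = x e 0 + x f 0.
  by rewrite mulmxDl mxE -!rowE !mxE.
have scale_delta (a : F) i j : (a *: delta_mx i 0 : 'cV[F]_n) j 0 = if j == i then a else 0.
  by rewrite !mxE eqxx andbT; case: eqP; rewrite ?mulr1 ?mulr0.
case: ifP => eS; apply/col_indepP/col_indepP => H x sx.
- move=> Ax; have y0 : x - x f 0 *: delta_mx e 0 = 0.
    apply: H; first rewrite -scaleNr; first apply: supportedD; first by apply: supportedS sx; apply: subD1set.
      by apply/supportedZ/supported_delta.
    apply/mul_addrow; rewrite -scaleNr col0_mul Ax de; split=> //.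
    by rewrite ![(x + _) _ _]mxE !scale_delta eqxx (eq_sym f) (negPf ef) (sx e) ?setD11 // add0r addr0 addNr.
  have := y0; have /colP/(_ e) := y0; rewrite -{1}scaleNr mxE scale_delta eqxx (sx e) ?setD11 // add0r mxE.
  by move/eqP; rewrite oppr_eq0 => /eqP ->; rewrite scale0r subr0.
- case/mul_addrow; rewrite de => Ax xef.
  have y0 : x + (- x e 0) *: delta_mx e 0 = 0.
    apply: H; last by rewrite col0_mul.
    move=> j; rewrite mxE scale_delta !inE; case: eqP => [->|_ /= /sx ->]; rewrite ?subrr ?addr0 //.
  have xf : x f 0 = 0.
    by have /colP/(_ f) := y0; rewrite mxE scale_delta eq_sym (negPf ef) addr0 mxE.
  have xe : x e 0 = 0 by move: xef; rewrite xf addr0.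
  by move: y0; rewrite xe oppr0 scale0r addr0.
- move=> Ax; apply: H; first by apply: supportedS sx; apply: subD1set.
  apply/mul_addrow; rewrite de Ax; split=> //.
  by rewrite !sx ?addr0 // !inE ?eqxx ?eS ?andbF.
case/mul_addrow; rewrite de => Ax; rewrite (sx e) ?eS // add0r => xf.
by apply: H => // j; rewrite !inE negb_and negbK => /orP[/eqP -> //|]; apply: sx.
Qed.

Lemma matrix_par_ext : e != f -> exists M : 'M[F]_(m, n), par_ext (col_matroid A) (col_matroid M) e f.
Proof.
move=> ef; pose M : 'M[F]_(m, n) := \matrix_(i, j) A i (if j == e then f else j).
exists M => S.
have mulM (x : 'cV[F]_n) : M *m x = A *m (x + x e 0 *: delta_mx f 0).
  rewrite mulmxDr -scalemxAr -colE -(col0_mul x (- x e 0)) mulmxDr -scalemxAr -colE.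
  apply/colP => i; rewrite !mxE (bigD1 e) //= [in RHS](bigD1 e) //= !mxE eqxx.
  rewrite [X in _ + X = _](eq_bigr (fun j => A i j * x j 0)); first by ring.
  by move=> j je; rewrite mxE (negPf je).
case: ifP => eS; last first.
  have xe (x : 'cV[F]_n) : supported x S -> M *m x = A *m x.
    by move=> sx; rewrite mulM sx ?eS // scale0r addr0.
  by apply/col_indepP/col_indepP => H x sx; [rewrite -xe //|rewrite xe //]; apply: H.
have [fS|fS] /= := boolP (f \in S).
  apply/col_indepP => H.
  have /colP/(_ e) : delta_mx e 0 - delta_mx f 0 = 0 :> 'cV[F]_n.
    apply: H; first rewrite -scaleN1r; first apply: supportedD; [exact: supported_delta| |].
      by apply/supportedZ/supported_delta.
    rewrite mulM !mxE eqxx (negPf ef) subr0 scale1r subrK -colE.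
    by move: le; rewrite loop_colP => /eqP.
  by rewrite !mxE !eqxx (negPf ef) subr0 => /eqP; rewrite oner_eq0.
have fe : f != e by rewrite eq_sym.
apply/col_indepP/col_indepP => H x sx Ax.
  pose y : 'cV[F]_n := x + x f 0 *: (delta_mx e 0 - delta_mx f 0).
  have xe : x e 0 = 0 by apply: sx; rewrite !inE eqxx (negPf ef).
  have ye : y e 0 = x f 0 by rewrite !mxE !eqxx (negPf ef) xe subr0 mulr1 add0r.
  have y0 : y = 0.
    apply: H.
      move=> j jS; rewrite !mxE !eqxx !andbT.
      have je : j != e by apply: contraNneq jS => ->.
      rewrite (negPf je); have [->|jf] := eqVneq j f; first by rewrite sub0r mulrN1 subrr.
      by rewrite subr0 mulr0 addr0 sx // !inE negb_or jf je.
    rewrite mulM ye -addrA -scalerDr subrK; by rewrite col0_mul.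
  have xf : x f 0 = 0 by rewrite -ye y0 mxE.
  by move: y0; rewrite /y xf scale0r addr0.
pose y : 'cV[F]_n := x + x e 0 *: delta_mx f 0 + (- x e 0) *: delta_mx e 0.
have xf : x f 0 = 0 by apply: sx.
have y0 : y = 0.
  apply: H; last by rewrite col0_mul -mulM.
  move=> j; rewrite !mxE !eqxx !andbT !inE negb_or negb_and negbK => /andP[jf].
  rewrite (negPf jf) mulr0 addr0; have [->|je /=] := eqVneq j e; first by rewrite mulr1 subrr.
  by move=> jS; rewrite mulr0 addr0 sx.
have xe : x e 0 = 0.
  by have /colP/(_ f) := y0; rewrite !mxE !eqxx (negPf fe) !mulr0 mulr1 addr0 xf add0r.
by move: y0; rewrite /y xe oppr0 !scale0r !addr0.
Qed.

End MatrixExt.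
End MatrixOps.

(** * Reduction of noncrossing matroids *)

Section Hereditary.
Variable n : nat.
Implicit Types (M P N : matroid 'I_n) (S X Y : {set 'I_n}) (b c e f : 'I_n).

Definition deletion_of P0 P e : Prop := forall S, (S \in indep P0) = (e \notin S) && (S \in indep P).
Definition contraction_of P0 P e : Prop := forall S, (S \in indep P0) = (e \notin S) && (e |: S \in indep P).

(** What the reduction to loops requires of a class of matroids. The minors are those
    that undo an extension by consecutive elements, since these inherit rigidity. *)
Record hereditary (H : matroid 'I_n -> Prop) : Prop := Hereditary {
  her_corner : forall P, H P -> noncrossing P -> degenerate_corners P;
  her_col : forall P0 P e, H P -> loop P0 e -> col_ext P0 P e -> deletion_of P0 P e -> H P0;
  her_par : forall P0 P e f, H P -> loop P0 e -> e != f -> consecutive P0 e f ->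
    par_ext P0 P e f -> deletion_of P0 P e -> H P0;
  her_ser : forall P0 P e f, H P -> loop P0 e -> e != f -> consecutive P0 f e ->
    ser_ext P0 P e f -> ~~ loop P e -> contraction_of P0 P e -> H P0 }.

Lemma del_loop P0 P e x : deletion_of P0 P e -> loop P x -> loop P0 x.
Proof. by move=> H; rewrite /loop H; apply: contra => /andP[]. Qed.

Lemma con_loop P0 P e x : contraction_of P0 P e -> loop P x -> loop P0 x.
Proof.
move=> H; rewrite /loop H; apply: contra => /andP[_ i1]; apply: indepS i1 _; exact: subsetUr.
Qed.

Lemma noncrossing_del P0 P e : (forall B, is_basis P0 B = (e \notin B) && is_basis P B) -> noncrossing P -> noncrossing P0.
Proof.
move=> H nc Q p q r s d1 d2 d3 d4 cr; rewrite !H !inE !negb_or.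
move=> /andP[/and3P[ep er eQ] b1] /andP[/and3P[eq es _] b2].
by have [-> ->] := nc Q p q r s d1 d2 d3 d4 cr b1 b2; rewrite ep eq er es eQ.
Qed.

Lemma noncrossing_con P0 P e : (forall B, is_basis P0 B = (e \notin B) && is_basis P (e |: B)) -> noncrossing P -> noncrossing P0.
Proof.
move=> H nc Q p q r s d1 d2 d3 /and4P[pQ qQ rQ sQ] cr; rewrite !H !inE !negb_or.
move=> /andP[/and3P[ep er eQ]]; rewrite (setUCA [set e]) (setUCA [set e]) => b1.
move=> /andP[/and3P[eq es _]]; rewrite (setUCA [set e]) (setUCA [set e]) => b2.
have [|b3 b4] := nc (e |: Q) p q r s d1 d2 d3 _ cr b1 b2.
  by rewrite !inE !negb_or pQ qQ rQ sQ !(eq_sym _ e) ep eq er es.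
rewrite !(setUCA [set e]) in b3 b4 *; rewrite b3 b4 ep eq er es eQ.
by [].
Qed.

(** As long as there are nonloops, there is a coloop, or [reduction_pair] finds a
    pair to reduce; noncrossing bases pass to the minor. *)
Lemma sp_of_hereditary (H : matroid 'I_n -> Prop) : hereditary H ->
  forall P, noncrossing P -> H P -> series_parallel true P.
Proof.
move=> her P; move: {2}#|[set x | ~~ loop P x]| (leqnn #|[set x | ~~ loop P x]|) => m.
elim: m P => [|m IHm] P cP nc HP.
  apply: sp_loops => x; apply: contraT => lx.
  by move: cP; rewrite leqn0 cards_eq0 => /eqP/setP/(_ x); rewrite !inE lx.
have dec P0 e : ~~ loop P e -> loop P0 e -> (forall x, loop P x -> loop P0 x) ->
    (#|[set x | ~~ loop P0 x]| <= m)%N.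
  move=> le le0 sub; rewrite -ltnS; apply: leq_trans cP.
  apply: proper_card; apply/properP; split.
    by apply/subsetP => x; rewrite !inE; apply: contra; apply: sub.
  by exists e; rewrite !inE ?le // le0.
have [/existsP[e ce]|] := boolP [exists e, coloop P e].
  have le : ~~ loop P e.
    apply: contraL ce => l; rewrite /coloop -leqNgt -(rk_loopU (~: [set e]) l).
    by apply: rkS; rewrite setUCr.
  have [P0 [l0 ext del]] := col_ext_ex ce.
  have nc0 : noncrossing P0.
    by apply: (@noncrossing_con P0 P e) nc => B; apply: isb_col_ext.
  apply: (sp_col l0 ext); apply: IHm => //.
    by apply: dec le l0 _ => x; apply: del_loop del.
  exact: her_col her _ _ _ HP l0 ext del.
move=> /existsPn nco.
have [/existsP[x lx]|/existsPn all_loops] := boolP [exists x, ~~ loop P x]; last first.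
  by apply: sp_loops => x; have := all_loops x; rewrite negbK.
have [|b [c [nr lb lc]]] := @reduction_pair _ P nc (her_corner her HP nc) (ex_intro _ x lx).
  by move=> y _; apply: nco.
have bc : b != c by case/andP: nr => bc _; rewrite -val_eqE neq_ltn bc.
case/orP => [r1|r1].
  have [P0 [l0 lf ext del]] := par_ext_ex lb lc bc r1.
  have sub y : loop P y -> loop P0 y by apply: del_loop del.
  have nr0 := near_sub sub nr.
  have nc0 : noncrossing P0.
    by apply: (@noncrossing_del P0 P b) nc => B; apply: isb_par_ext ext.
  apply: (sp_par l0 lf (fun _ => nr0) ext); apply: IHm => //.
    exact: dec lb l0 sub.
  exact: her_par her _ _ _ _ HP l0 bc nr0 ext del.
rewrite setUC in r1; rewrite eq_sym in bc.
have [P0 [l0 ext con]] := ser_ext_ex lc (nco c) (nco b) bc r1.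
have sub y : loop P y -> loop P0 y by apply: con_loop con.
have nr0 := near_sub sub nr.
have nc0 : noncrossing P0.
  by apply: (@noncrossing_con P0 P c) nc => B; apply: isb_ser_ext ext.
apply: (sp_ser l0 bc (nco c) (fun _ => nr0) ext); apply: IHm => //.
  exact: dec lc l0 sub.
exact: her_ser her _ _ _ _ HP l0 bc nr0 ext lc con.
Qed.

End Hereditary.

(** * Binary and rigid matroids *)

Section Representable.
Variables (F : fieldType) (n : nat).
Implicit Types (M P N : matroid 'I_n) (S X Y : {set 'I_n}) (b c e f : 'I_n).

Definition representable P : Prop := exists m (A : 'M[F]_(m, n)), col_matroid A = P.

Definition rigid P : Prop := representable P /\
  forall m (A : 'M[F]_(m, n)), arc_equiv (col_matroid A) P -> col_matroid A = P.

Lemma representable_del P0 P e : deletion_of P0 P e -> representable P -> representable P0.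
Proof.
move=> H [m [A eA]]; exists m, (delcol A e); apply: matroid_eq => S.
by rewrite H -eA /= delcol_indep.
Qed.

Lemma representable_con P0 P e : ~~ loop P e -> contraction_of P0 P e -> representable P -> representable P0.
Proof.
move=> le H [m [A eA]]; have [|w [we _]] := @inspan_sep _ _ _ A set0 e.
  by rewrite eA; apply: contra le; rewrite loop_rk /spans setU0 rk0.
exists m, (A - col e A *m (w *m A)); apply: matroid_eq => S.
by rewrite H -eA /= contract_indep.
Qed.

(** [0] serves as ratio when no basis contains [c] without [b]. *)
Lemma corner_of_const_ratio m (A : 'M[F]_(m, n)) b c : b != c -> ~~ loop (col_matroid A) c ->
  replaces (col_matroid A) b c ->
  (forall S S' a a', b \notin S -> c \notin S -> is_basis (col_matroid A) (c |: S) ->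
     b \notin S' -> c \notin S' -> is_basis (col_matroid A) (c |: S') -> a != 0 -> a' != 0 ->
     inspan A S (col b A - a *: col c A) -> inspan A S' (col b A - a' *: col c A) -> a = a') ->
  exists N', corner_degen (col_matroid A) N' b c.
Proof.
move=> bc lc rep const.
have [[S0 [bS0 cS0 b0]]|no] := boolp.pselect (exists S0, [/\ b \notin S0, c \notin S0 & is_basis (col_matroid A) (c |: S0)]).
  have [a a0 ha] := corner_ratio rep bS0 cS0 b0.
  exists (col_matroid (shear A b c a)); apply: corner_degen_of_ratio => // S bS cS bas.
  have [a' a'0 ha'] := corner_ratio rep bS cS bas.
  by rewrite (const S0 S a a').
exists (col_matroid (shear A b c 0)); apply: corner_degen_of_ratio => // S bS cS bas.
by case: no; exists S.
Qed.

(** The ratios of [corner_ratio] are all 1, so every corner is degenerate. *)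
Lemma representable2_hereditary : (forall a : F, a != 0 -> a = 1) -> hereditary representable.
Proof.
move=> F2; split.
- move=> P [m [A <-]] nc b c nr lb lc ncl rep.
  apply: corner_of_const_ratio => //; first by case/andP: nr => bc _; rewrite -val_eqE neq_ltn bc.
  by move=> S S' a a' _ _ _ _ _ _ /F2 -> /F2 ->.
- by move=> P0 P e HP _ _ del; apply: representable_del del HP.
- by move=> P0 P e f HP _ _ _ _ del; apply: representable_del del HP.
- by move=> P0 P e f HP _ _ _ _ le con; apply: representable_con le con HP.
Qed.

(** An arc whose rank is changed by the shear contains [b] but not [c]. As [c] is not in
    the span of the rest of the arc, at most one [a] brings [b - a c] into it. *)
Lemma shear_bad_arc m (A : 'M[F]_(m, n)) b c a : b != c -> ~~ loop (col_matroid A) c ->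
  replaces (col_matroid A) b c ->
  ~ arc_equiv (col_matroid (shear A b c a)) (col_matroid A) ->
  exists i l, [/\ b \in cyc_arc i l, c \notin cyc_arc i l,
    ~ inspan A (cyc_arc i l :\ b) (col c A) & inspan A (cyc_arc i l :\ b) (col b A - a *: col c A)].
Proof.
move=> bc lc rep /boolp.existsNP[i /boolp.existsNP[l ne]]; exists i, l.
set X := cyc_arc i l in ne *; pose Y := X :\ b.
have H0 : ~~ ((b \notin X) || (c \in X)) by apply/negP => h; apply: ne; apply: shear_rk.
move: H0; rewrite negb_or negbK => /andP[bX cX].
have bY : b \notin Y by rewrite setD11.
have cY : c \notin Y by rewrite in_setD1 (negPf cX) andbF.
have rkY : rk (col_matroid (shear A b c a)) Y = rk (col_matroid A) Y by apply: shear_rk; rewrite ?bY.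
have clb : spans (col_matroid (shear A b c a)) Y b <> spans (col_matroid A) Y b.
  move=> e; apply: ne; rewrite -(setD1K bX) -/Y.
  have [h|h] := boolP (spans (col_matroid A) Y b).
    by rewrite (clE h) clE // e.
  by rewrite (clN h) clN ?rkY // e.
have inb : spans (col_matroid (shear A b c a)) Y b <-> inspan A Y (col b A - a *: col c A).
  by split=> [/clP|h]; [|apply/clP]; rewrite shear_colb // shear_inspan.
have ncc : ~ inspan A Y (col c A).
  move=> cc; apply: clb; apply/idP/idP => [/inb h|/clP h].
    by apply/clP; rewrite -[col b A](subrK (a *: col c A)); apply: inspanD h (inspanZ _ cc).
  by apply/inb; apply: inspanB h (inspanZ _ cc).
have ncb : ~~ spans (col_matroid A) Y b.
  apply/negP => cb.
  have [S0 [iS0 sS0 eS0]] := rk_wit (col_matroid A) Y.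
  have clS0 y : y \in Y -> spans (col_matroid A) S0 y by move=> yY; apply: (rk_cl sS0) yY; rewrite -eS0 rk_indep.
  have cS0 : c \notin S0 by apply: contra cY; apply: subsetP.
  have bS0 : b \notin S0 by apply: contra bY; apply: subsetP.
  have icS0 : c |: S0 \in indep (col_matroid A).
    by rewrite indepU1 //; apply/negP => /clP h; apply: ncc; apply: inspanS sS0 h.
  have nib (Z : {set 'I_n}) : Z \in indep (col_matroid A) -> S0 \subset Z -> b \notin Z.
    move=> iZ sZ; apply/negP => bZ.
    have : b |: S0 \in indep (col_matroid A) by apply: indepS iZ _; rewrite subUset sub1set bZ.
    by rewrite indepU1 // (cl_trans clS0 cb).
  have [B bB sB] := indep_sub_basis icS0.
  have cB : c \in B by apply: (subsetP sB); rewrite setU11.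
  have sB' : S0 \subset B by apply: subset_trans sB; apply: subsetUr.
  have bnB := nib B (isb_indep bB) sB'.
  have b1 : is_basis (col_matroid A) (b |: B :\ c).
    by apply: rep; rewrite ?setD11 ?setD1K // !inE (negPf bnB) andbF.
  have := nib _ (isb_indep b1); rewrite setU11 => /(_ _) h.
  have /h : S0 \subset b |: B :\ c.
    apply: subset_trans (subsetUr _ _); apply/subsetP => z zS; rewrite !inE (subsetP sB') // andbT.
    by apply: contraNneq cS0 => <-.
  by [].
split=> //; apply/inb; move: clb; rewrite (negPf ncb).
by case: (spans _ _ _).
Qed.

(** At a corner, the shear by a ratio [a] puts [b] into the span of some [S] with
    [c |: S] a basis, so it changes the matroid; by rigidity it changes the rank of
    some arc, and this arc determines [a]. The arcs for two ratios are nested, so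
    the larger one determines both, and the ratios agree. Rigidity passes to the
    minors because an arc-equivalent representation of the minor extends to one of
    the matroid. *)
Lemma rigid_hereditary : hereditary rigid.
Proof.
split.
- move=> P [[m [A eA]] uni] nc b c nr lb lc ncl rep; move: uni nr lb lc ncl rep; rewrite -{P nc}eA.
  move=> uni nr lb lc ncl rep.
  have bc : (b < c)%N by case/andP: nr.
  have bnc : b != c by rewrite -val_eqE neq_ltn bc.
  apply: corner_of_const_ratio => // S S' a a' bS cS b1 bS' cS' b2 a0 a'0 h h'.
  have bad (Z : {set 'I_n}) t : b \notin Z -> c \notin Z -> is_basis (col_matroid A) (c |: Z) ->
      inspan A Z (col b A - t *: col c A) -> ~ arc_equiv (col_matroid (shear A b c t)) (col_matroid A).
    move=> bZ cZ bas hZ /uni eq.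
    have ib := isb_indep (rep Z bZ cZ bas).
    have iZ : Z \in indep (col_matroid A) by apply: indepS ib _; apply: subsetUr.
    have /negP[] : ~~ spans (col_matroid A) Z b by rewrite -indepU1.
    by rewrite -eq; apply/clP; apply/shear_inspan => //; rewrite shear_colb.
  have [i [l [bX cX nX hX]]] := shear_bad_arc bnc lc rep (bad S a bS cS b1 h).
  have [i' [l' [bX' cX' nX' hX']]] := shear_bad_arc bnc lc rep (bad S' a' bS' cS' b2 h').
  have mono (X X' : {set 'I_n}) v : (forall y, ~~ between b c y -> y \in X -> y \in X') ->
      inspan A (X :\ b) v -> inspan A (X' :\ b) v.
    move=> sub; apply: inspan_trans => y; rewrite !inE => /andP[yb yX].
    have [within|nbtw] := boolP (between b c y).
      have := near_loop nr; case/andP: within => by' yc /(_ _ by' yc).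
      by rewrite loop_colP => /eqP ->; apply: inspan0.
    by apply: inspan_col; rewrite !inE yb sub.
  have fin (X : {set 'I_n}) : inspan A X (col b A - a *: col c A) -> inspan A X (col b A - a' *: col c A) ->
      ~ inspan A X (col c A) -> a = a'.
    move=> g g' nc'; apply/eqP; rewrite -subr_eq0; apply/negPn/negP => d; apply: nc'.
    have -> : col c A = (a - a')^-1 *: ((col b A - a' *: col c A) - (col b A - a *: col c A)).
      have -> : (col b A - a' *: col c A) - (col b A - a *: col c A) = (a - a') *: col c A.
        by rewrite opprB [LHS]addrC addrA subrK -scalerBl.
      by rewrite scalerA mulVf // scale1r.
    by apply: inspanZ; apply: inspanB.
  case: (arc_nested bc bX cX bX' cX') => sub.
    by apply: fin hX' nX' => //; apply: mono hX.
  by apply: fin nX => //; apply: mono hX'.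
- move=> P0 P e [rP uni] l0 ext del; split; first exact: representable_del del rP.
  move=> m A eA; have lA : loop (col_matroid A) e by rewrite (arc_equiv_loop _ eA).
  have [N HN] := matrix_col_ext A e.
  have eN : col_matroid N = P by apply: uni; apply/(col_arc_equiv lA l0 HN ext).
  apply: matroid_eq => S; rewrite del -eN HN.
  have [eS|eS] /= := boolP (e \in S); last by rewrite setD1_id.
  by apply/negbTE/negP => /(loop_notin lA); rewrite eS.
- move=> P0 P e f [rP uni] l0 ef nr ext del; split; first exact: representable_del del rP.
  move=> m A eA; have lA : loop (col_matroid A) e by rewrite (arc_equiv_loop _ eA).
  have nrA : consecutive (col_matroid A) e f by apply: near_arc_equiv nr => i l; rewrite eA.
  have [N HN] := matrix_par_ext lA ef.
  have eN : col_matroid N = P by apply: uni; apply/(par_arc_equiv lA l0 ef nrA nr HN ext).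
  apply: matroid_eq => S; rewrite del -eN HN.
  have [eS|eS] //= := boolP (e \in S).
  by apply/negbTE/negP => /(loop_notin lA); rewrite eS.
move=> P0 P e f [rP uni] l0 ef nr ext le con; split; first exact: representable_con le con rP.
move=> m A eA; have lA : loop (col_matroid A) e by rewrite (arc_equiv_loop _ eA).
have nrA : consecutive (col_matroid A) f e by apply: near_arc_equiv nr => i l; rewrite eA.
have [N HN] := matrix_ser_ext lA ef.
have eN : col_matroid N = P by apply: uni; apply/(ser_arc_equiv lA l0 ef nrA nr HN ext).
apply: matroid_eq => S; rewrite con -eN HN setU11.
have [eS|eS] /= := boolP (e \in S); last by rewrite setU1K.
by apply/negbTE/negP => /(loop_notin lA); rewrite eS.
Qed.

End Representable.

Local Close Scope ring_scope.

(** * Cycle matroids *)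

Lemma memPn_eq (T : finType) (D : {set T}) x y : x \in D -> y \notin D -> (x == y) = false.
Proof. by move=> xD yD; apply/negbTE; apply: contraNneq yD => <-. Qed.

Section EvenSets.
Variables (V E : finType) (en : E -> V * V).
Implicit Types (S D : {set E}) (t f : E) (v : V).

(** The parity of the number of ends of [t] at [v]; a loop is incident to no vertex. *)
Definition incid t v : bool := ((en t).1 == v) (+) ((en t).2 == v).

Definition even_set D : bool := [forall v, ~~ \big[addb/false]_(t in D) incid t v].

Lemma even_setP D : reflect (forall v, \big[addb/false]_(t in D) incid t v = false) (even_set D).
Proof. by apply: (iffP forallP) => H v; [apply/negbTE/H|rewrite H]. Qed.

Definition forest S : Prop := forall D, D \subset S -> even_set D -> D = set0.

End EvenSets.

Section CycleSpace.
Variable G : multigraph.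
Implicit Types (S D C : {set edge G}).

Lemma joinsC (e : edge G) x y : joins e x y = joins e y x.
Proof. by rewrite /joins orbC. Qed.

Lemma joins_incid (e : edge G) x y v : joins e x y -> incid (@ends G) e v = (x == v) (+) (y == v).
Proof. by rewrite /joins /incid => /orP[] /eqP ->; rewrite //= addbC. Qed.

Lemma cycle_even C : is_cycle C -> even_set (@ends G) C.
Proof.
case=> m [v [e [vi ei j ->]]]; apply/even_setP => u.
rewrite big_imset /=; last by move=> i i' _ _; apply: ei.
rewrite (eq_bigr (fun i => (v i == u) (+) (v (ordS i) == u))); last by move=> i _; apply: joins_incid.
rewrite big_split /= [X in _ (+) X](_ : _ = \big[addb/false]_i (v i == u)) ?addbb //.
by rewrite [RHS](reindex (@ordS m.+1)) //; exists (@ord_pred m.+1) => i _; rewrite ?ordSK ?ord_predK.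
Qed.

(** The ends of an edge [t] of [D] are joined by a path in [D :\ t], which [t] closes
    to a cycle: otherwise the component of one end in [D :\ t] would have an odd
    sum of degrees in [D]. *)
Lemma even_cycle D : even_set (@ends G) D -> D != set0 ->
  exists2 C, is_cycle C & C \subset D.
Proof.
move=> /even_setP ev /set0Pn[t tD].
pose e' : rel (vertex G) := fun u w => [exists f in D :\ t, joins f u w].
have sym : connect_sym e'.
  apply: sym_connect_sym => u w; apply: eq_existsb => f; by rewrite joinsC.
case et : (ends t) => [x y].
have [cxy|ncxy] := boolP (connect e' x y); last first.
  pose K := [set v | connect e' x v].
  have : \big[addb/false]_(v in K) \big[addb/false]_(f in D) incid (@ends G) f v = false.
    by rewrite big1 // => v _; apply: ev.
  rewrite exchange_big /=.
  have inK f : \big[addb/false]_(v in K) incid (@ends G) f v = ((ends f).1 \in K) (+) ((ends f).2 \in K).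
    rewrite big_split /=; congr (_ (+) _).
      have [h|h] := boolP ((ends f).1 \in K).
        rewrite (bigD1 _ h) /= eqxx big1 // => v /andP[_ vf]; by rewrite eq_sym (negPf vf).
      by rewrite big1 // => v vK; apply/negbTE; apply: contraNneq h => ->.
    have [h|h] := boolP ((ends f).2 \in K).
      rewrite (bigD1 _ h) /= eqxx big1 // => v /andP[_ vf]; by rewrite eq_sym (negPf vf).
    by rewrite big1 // => v vK; apply/negbTE; apply: contraNneq h => ->.
  rewrite (bigD1 t) //= inK et /= !inE connect0 (negPf ncxy) big1 // => f /andP[fD ft].
  rewrite inK !inE; apply/negbTE; rewrite negb_add; apply/eqP.
  have e12 : e' (ends f).1 (ends f).2.
    by apply/existsP; exists f; rewrite !inE ft fD /joins -surjective_pairing eqxx.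
  by apply: same_connect_r => //; apply: connect1.
case/connectP: cxy => p0 pth0 ey0.
case/shortenP: pth0 ey0 => p pth un _ ey {p0}.
pose m := size p.
pose vs := x :: p.
pose v (i : 'I_m.+1) := nth x vs i.
pose pe u w := odflt t [pick f in D :\ t | joins f u w].
pose e (i : 'I_m.+1) := if i < m then pe (nth x vs i) (nth x vs i.+1) else t.
have peP (i : nat) : i < m -> pe (nth x vs i) (nth x vs i.+1) \in D :\ t /\
    joins (pe (nth x vs i) (nth x vs i.+1)) (nth x vs i) (nth x vs i.+1).
  move=> im; have /(pathP x)/(_ i im) := pth; rewrite -/vs.
  case/existsP => f /andP[fD jf]; rewrite /pe; case: pickP => [g /andP[]//|/(_ f)].
  by rewrite fD jf.
have inj (i j : nat) : i <= m -> j <= m -> nth x vs i = nth x vs j -> i = j.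
  by move=> im jm /eqP; rewrite nth_uniq // => /eqP.
exists [set e i | i : 'I_m.+1]; last first.
  apply/subsetP => _ /imsetP[i _ ->]; rewrite /e; case: ifP => // im.
  by have [] := peP i im; rewrite !inE => /andP[].
exists m, v, e; split=> //.
- by move=> i j ij; apply: val_inj; apply: inj ij; rewrite -ltnS.
- move=> i j; rewrite /e; case: (ltnP i m) => im; case: (ltnP j m) => jm.
  + have [_ ji] := peP i im; have [_ jj] := peP j jm => eij.
    move: ji jj; rewrite -eij => ji jj; apply: val_inj => /=.
    have : (nth x vs i = nth x vs j /\ nth x vs i.+1 = nth x vs j.+1) \/
           (nth x vs i = nth x vs j.+1 /\ nth x vs i.+1 = nth x vs j).
      by case/orP: ji => /eqP e1; case/orP: jj => /eqP; rewrite e1 => -[h1 h2];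
        [left|right|right|left]; split.
    case=> -[h1 h2]; first by apply: inj h1; apply: ltnW.
    have h3 := inj _ _ (ltnW im) jm h1; have h4 := inj _ _ im (ltnW jm) h2.
    by move: h3 h4; clear; lia.
  + by move=> eij; have [] := peP i im; rewrite eij !inE eqxx.
  + by move=> eij; have [] := peP j jm; rewrite -eij !inE eqxx.
  + move=> _; apply: val_inj => /=.
    by have := ltn_ord i; have := ltn_ord j; rewrite !ltnS => h1 h2; apply/eqP; rewrite eqn_leq (leq_trans h2 jm) (leq_trans h1 im).
move=> i; rewrite /e /v; case: (ltnP i m) => im.
  have -> : nat_of_ord (ordS i) = i.+1 by rewrite /= modn_small.
  by have [] := peP i im.
have ei : i = m :> nat by apply/eqP; rewrite eqn_leq im -ltnS ltn_ord.
have -> : nat_of_ord (ordS i) = 0 by rewrite /= ei modnn.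
by rewrite ei nth_last /= -ey /joins et eqxx orbT.
Qed.

Lemma acyclic_forest S : acyclic S <-> forest (@ends G) S.
Proof.
split=> [ac D sD evD|fo C cC].
  apply/eqP; apply: contraT => D0; have [C cC sC] := even_cycle evD D0.
  by have := ac C cC; rewrite (subset_trans sC sD).
apply/negP => sC; have C0 := fo C sC (cycle_even cC).
case: cC => m [v [e [_ _ _ eC]]]; have : e ord0 \in C by rewrite eC; apply: imset_f.
by rewrite C0 inE.
Qed.

End CycleSpace.

Section GraphicMatroids.
Variable n : nat.
Implicit Types (M P : matroid 'I_n) (S D : {set 'I_n}) (e f : 'I_n).

(** Independence in a cycle matroid through even sets of edges, which behave better
    than cycles under adding edges and subdividing them. *)
Definition cycle_presented M : Prop :=
  exists (V : finType) (en : 'I_n -> V * V), forall S, S \in indep M <-> forest en S.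

Lemma presented_graphic M : cycle_presented M -> graphic M.
Proof.
case=> V [en H]; exists (Multigraph en), id; split; first by exists id.
by move=> S; rewrite imset_id; apply: iff_trans (H S) (iff_sym (acyclic_forest (G := Multigraph en) S)).
Qed.

Lemma graphic_presented M : graphic M -> cycle_presented M.
Proof.
case=> G [f [bf H]]; exists (vertex G), (fun t => ends (f t)) => S.
apply: iff_trans (H S) _; apply: iff_trans (acyclic_forest _) _.
have [g fK gK] := bf.
have evf D : even_set (fun t => ends (f t)) D = even_set (@ends G) (f @: D).
  by apply: eq_forallb => v; rewrite big_imset //= => x y _ _; apply: (can_inj fK).
split=> fo D sD evD.
  have : f @: D = set0 by apply: fo; rewrite -?evf // imsetS.
  by move/eqP; rewrite imset_eq0 => /eqP.
have eD : D = f @: (g @: D) by rewrite -imset_comp (eq_imset _ gK) imset_id.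
rewrite eD; have -> : g @: D = set0; last by rewrite imset0.
apply: fo; last by rewrite evf -eD.
have -> : S = g @: (f @: S) by rewrite -imset_comp (eq_imset _ fK) imset_id.
exact: imsetS.
Qed.

Lemma F2_unit (a : 'F_2) : (a != 0 -> a = 1)%R.
Proof. by case: a => [[|[|[]]] //= i] _; apply: val_inj. Qed.

(** The incidence matrix modulo 2: its kernel consists of the even sets. *)
Lemma graphic_representable2 M : graphic M -> representable 'F_2 M.
Proof.
move/graphic_presented => [V [en H]].
pose A : 'M['F_2]_(#|V|, n) := (\matrix_(i, j) (incid en j (enum_val i))%:R)%R.
exists #|V|, A; apply: matroid_eq => S /=.
have F2b (b : bool) : ((b%:R : 'F_2) == 0)%R = ~~ b by case: b.
have F2D (b1 b2 : bool) : ((b1 (+) b2)%:R = b1%:R + b2%:R :> 'F_2)%R by case: b1; case: b2; apply: val_inj.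
have key (x : 'cV['F_2]_n) : (A *m x == 0)%R = even_set en [set j | x j 0 != 0]%R.
  apply/eqP/even_setP => [Ax v|ev].
    have /colP/(_ (enum_rank v)) := Ax; rewrite !mxE => s0; apply/negbTE; rewrite -F2b; apply/eqP.
    rewrite -[RHS]s0 [RHS](bigID (mem [set j | x j 0 != 0]%R)) /= [X in (_ + X)%R]big1 ?addr0.
      rewrite (big_morph (fun b : bool => (b%:R : 'F_2)%R) F2D (erefl _)); apply: eq_bigr => j.
      by rewrite inE !mxE enum_rankK => /F2_unit ->; rewrite mulr1.
    by move=> j; rewrite inE negbK => /eqP ->; rewrite mulr0.
  apply/colP => i; rewrite !mxE (bigID (mem [set j | x j 0 != 0]%R)) /= [X in (_ + X)%R]big1 ?addr0.
    have := ev (enum_val i) => /negbT; rewrite -F2b => /eqP.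
    rewrite (big_morph (fun b : bool => (b%:R : 'F_2)%R) F2D (erefl _)) => e0; rewrite -[RHS]e0.
    by apply: eq_bigr => j; rewrite inE !mxE => /F2_unit ->; rewrite mulr1.
  by move=> j; rewrite inE negbK => /eqP ->; rewrite mulr0.
apply/col_indepP/idP => [K|/H fo x sx /eqP].
  apply/H => D sD evD; pose x : 'cV['F_2]_n := (\col_j (j \in D)%:R)%R.
  have eD : [set j | x j 0 != 0]%R = D by apply/setP => j; rewrite inE mxE F2b negbK.
  have x0 : x = 0%R.
    apply: K => [j jS|]; last by apply/eqP; rewrite key eD.
    have /negPf jD : j \notin D by apply: contra jS; apply: subsetP.
    by rewrite mxE jD.
  by rewrite -eD; apply/setP => j; rewrite !inE x0 mxE eqxx.
rewrite key => ev; have x0 : [set j | x j 0 != 0]%R = set0.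
  apply: fo ev; apply/subsetP => j; rewrite inE; apply: contraR => jS; by rewrite sx.
apply/colP => j; rewrite mxE; apply/eqP/negPn/negP => xj.
by have /setP/(_ j) := x0; rewrite !inE xj.
Qed.

(** A coloop becomes an edge between two new vertices, a parallel element doubles the
    edge [f], and a series element subdivides [f] by the new vertex [None]. *)
Lemma sp_presented c M : series_parallel c M -> cycle_presented M.
Proof.
elim=> {M} [M lo|M0 M e l ext _ [V [en H]]|M0 M e f l lf _ ext _ [V [en H]]|M0 M e f l ef _ _ ext _ [V [en H]]].
- exists unit, (fun _ => (tt, tt)) => S; split=> [iS D sD _|fo].
    apply/setP => x; rewrite inE; apply/negbTE/negP => /(subsetP sD) xS.
    by have := loop_notin (lo x) iS; rewrite xS.
  suff -> : S = set0 by apply: indep0.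
  by apply: fo => //; apply/even_setP => v; rewrite big1.
- pose en' t : (V + bool) * (V + bool) :=
    if t == e then (inr true, inr false) else (inl (en t).1, inl (en t).2).
  exists (V + bool)%type, en' => S; rewrite ext.
  have ev D : even_set en' D = (e \notin D) && even_set en D.
    apply/even_setP/andP => [H'|[eD /even_setP H'] [v|b]].
    + have eD : e \notin D.
        apply/negP => eD; have := H' (inr true).
        rewrite (bigD1 e) //= /incid /en' eqxx /= big1 // => t /andP[_ te]; by rewrite (negPf te).
      split=> //; apply/even_setP => v; apply: etrans (H' (inl v)); apply: eq_bigr => t tD.
      by rewrite /incid /en' (memPn_eq tD eD).
    + apply: etrans (H' v); apply: eq_bigr => t tD.
      by rewrite /incid /en' (memPn_eq tD eD).
    + by rewrite big1 // => t tD; rewrite /incid /en' (memPn_eq tD eD).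
  apply: (iff_trans (H _)); split=> fo D sD.
    rewrite ev => /andP[eD evD]; apply: fo evD.
    apply/subsetP => t tD; rewrite !inE (subsetP sD) // andbT; by apply: contraNneq eD => <-.
  move=> evD; apply: fo; first by apply: subset_trans sD _; apply: subD1set.
  by rewrite ev evD andbT; apply/negP => /(subsetP sD); rewrite !inE eqxx.
- have ef : e != f by apply: contraNneq lf => <-.
  pose en' t := en (if t == e then f else t).
  exists V, en' => S; rewrite ext.
  have ev1 D : e \notin D -> even_set en' D = even_set en D.
    move=> eD; apply: eq_forallb => v; congr (~~ _); apply: eq_bigr => t tD.
    by rewrite /incid /en' (memPn_eq tD eD).
  have ev2 D : e \in D -> f \notin D -> even_set en' D = even_set en (f |: D :\ e).
    move=> eD fD; have fDe : f \notin D :\ e by rewrite !inE (negPf fD) andbF.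
    apply: eq_forallb => v; congr (~~ _); rewrite big_setU1 //= (big_setD1 e) //=.
    rewrite {1}/incid /en' eqxx; congr (_ (+) _); apply: eq_bigr => t.
    by rewrite /incid !inE => /andP[/negPf -> _].
  case: ifP => eS; last first.
    apply: (iff_trans (H _)); split=> fo D sD evD; apply: (fo D sD).
      by rewrite -ev1 //; apply: contraFN eS; apply: subsetP.
    by rewrite ev1 //; apply: contraFN eS; apply: subsetP.
  have [fS|fS] /= := boolP (f \in S).
    split=> // fo; have : e \in [set e; f] by rewrite !inE eqxx.
    rewrite (fo [set e; f]) ?inE //; first exact: set2_sub.
    apply/even_setP => v; rewrite big_setU1 ?inE // big_set1 /incid /en' eqxx.
    by rewrite (eq_sym f) (negPf ef) /= addbb.
  have fSe : f \notin S :\ e by rewrite !inE (negPf fS) andbF.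
  apply: (iff_trans (H _)); split=> fo D sD evD.
    have fD : f \notin D by apply: contra fS; apply: subsetP.
    have [eD|eD] := boolP (e \in D).
      have : f \in f |: D :\ e by rewrite setU11.
      by rewrite (fo (f |: D :\ e)) ?inE // -?ev2 // setUS // setSD.
    apply: fo; last by rewrite -ev1.
    apply/subsetP => t tD; rewrite !inE (subsetP sD) // andbT; apply/orP; right; by apply: contraNneq eD => <-.
  have eD : e \notin D.
    by apply/negP => /(subsetP sD); rewrite !inE eqxx (negPf ef).
  have [fD|fD] := boolP (f \in D).
    have fD' : f \notin e |: D :\ f by rewrite !inE eqxx (eq_sym f) (negPf ef).
    have eDf : e \notin D :\ f by rewrite !inE (negPf eD) andbF.
    have : e \in e |: D :\ f by rewrite setU11.
    rewrite (fo (e |: D :\ f)) ?inE //; last by rewrite ev2 ?setU11 // setU1K // setD1K.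
    rewrite subUset sub1set eS; apply/subsetP => t; rewrite !inE => /andP[tf tD].
    by have := subsetP sD t tD; rewrite !inE (negPf tf) => /andP[].
  apply: fo; last by rewrite ev1.
  apply/subsetP => t tD; have := subsetP sD t tD; rewrite !inE => /orP[/eqP tf|/andP[] //].
  by rewrite tf (negPf fD) in tD.
pose en' t : option V * option V :=
  if t == e then (None, Some (en f).2) else if t == f then (Some (en f).1, None) else (Some (en t).1, Some (en t).2).
exists (option V), en' => S; rewrite ext.
have fe : f != e by rewrite eq_sym.
have ev D : even_set en' D = ((e \in D) == (f \in D)) && even_set en (D :\ e).
  have sum v : \big[addb/false]_(t in D) incid en' t v =
     ((e \in D) && incid en' e v) (+) (((f \in D) && incid en' f v) (+) \big[addb/false]_(t in D :\ e :\ f) incid en' t v).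
    have [eD|eD] /= := boolP (e \in D).
      rewrite (big_setD1 e) //=; congr (_ (+) _).
      have [fD|fD] /= := boolP (f \in D); first by rewrite (big_setD1 f) //= !inE fe.
      by rewrite (setD1_id (S := D :\ e)) // !inE (negPf fD) andbF.
    rewrite (setD1_id eD); have [fD|fD] /= := boolP (f \in D); first by rewrite (big_setD1 f).
    by rewrite (setD1_id fD).
  have iN t : t \in D :\ e :\ f -> incid en' t None = false.
    by rewrite !inE /incid /en' => /and3P[/negPf -> /negPf ->].
  have iS t v : t \in D :\ e :\ f -> incid en' t (Some v) = incid en t v.
    by rewrite !inE /incid /en' => /and3P[/negPf -> /negPf ->].
  have sumN : \big[addb/false]_(t in D) incid en' t None = (e \in D) (+) (f \in D).
    rewrite sum big1 // /incid /en' eqxx (negPf fe) eqxx /= !addbF !andbT //.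
  have sumS v : (e \in D) = (f \in D) -> \big[addb/false]_(t in D) incid en' t (Some v) = \big[addb/false]_(t in D :\ e) incid en t v.
    move=> eqef; rewrite sum (eq_bigr _ (fun t h => iS t v h)) eqef.
    have [fD|fD] /= := boolP (f \in D); last by rewrite (setD1_id (S := D :\ e)) // !inE (negPf fD) andbF.
    rewrite [RHS](big_setD1 f) ?inE ?fe //= addbA; congr (_ (+) _).
    by rewrite /incid /en' eqxx (negPf fe) eqxx /= addbF addbC.
  apply/even_setP/andP => [H'|[/eqP eqef /even_setP H'] [v|]].
  - have eqef : (e \in D) = (f \in D).
      by have := H' None; rewrite sumN; case: (e \in D); case: (f \in D).
    by split; [apply/eqP|apply/even_setP => v; rewrite -sumS ?H'].
  - by rewrite sumS.
  - by rewrite sumN eqef addbb.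
apply: (iff_trans (H _)); case: ifP => eS.
  split=> fo D sD.
    rewrite ev => /andP[/eqP eqef evD].
    have D0 := fo (D :\ e) (setSD _ sD) evD.
    have fD : f \notin D.
      by apply/negP => fD; have : f \in D :\ e; [rewrite !inE fe fD|rewrite D0 inE].
    have eD : e \notin D by rewrite eqef.
    by rewrite -(setD1_id eD).
  move=> evD; have eD : e \notin D by apply/negP => /(subsetP sD); rewrite !inE eqxx.
  have sD' : D \subset S by apply: subset_trans sD _; apply: subD1set.
  have [fD|fD] := boolP (f \in D); last first.
    by apply: fo sD' _; rewrite ev (negPf eD) (negPf fD) (setD1_id eD).
  have : e \in e |: D by rewrite setU11.
  rewrite (fo (e |: D)) ?inE //; first by rewrite subUset sub1set eS.
  by rewrite ev setU11 setU1K // inE fD orbT.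
split=> fo D sD evD.
  move: evD; rewrite ev => /andP[/eqP eqef evD].
  have eD : e \notin D by apply: contraFN eS; apply: subsetP.
  have fD : f \notin D by rewrite -eqef.
  rewrite (setD1_id eD) in evD; apply: fo evD.
  apply/subsetP => t tD; rewrite !inE (subsetP sD) // andbT; by apply: contraNneq fD => <-.
have sD' : D \subset S by apply: subset_trans sD _; apply: subD1set.
have eD : e \notin D by apply: contraFN eS; apply: subsetP.
have fD : f \notin D by apply/negP => /(subsetP sD); rewrite !inE eqxx.
by apply: fo sD' _; rewrite ev (negPf eD) (negPf fD) (setD1_id eD).
Qed.

End GraphicMatroids.

Local Open Scope ring_scope.

(** * Uniqueness of representations up to scaling columns *)

Section Torus.
Variables (F : fieldType) (n : nat).
Implicit Types (M : matroid 'I_n) (S : {set 'I_n}) (e f : 'I_n).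

Definition scale_col (d : 'I_n -> F) (x : 'cV[F]_n) : 'cV[F]_n := \col_i (d i * x i 0).

Definition same_kernel m m' (A : 'M[F]_(m, n)) (A' : 'M[F]_(m', n)) (d : 'I_n -> F) : Prop :=
  forall x : 'cV[F]_n, A *m x = 0 <-> A' *m scale_col d x = 0.

Lemma mulmx_ignore m (A : 'M[F]_(m, n)) e (x y : 'cV[F]_n) : col e A = 0 ->
  (forall i, i != e -> x i 0 = y i 0) -> A *m x = A *m y.
Proof.
move=> c0 H; rewrite !mulmx_colE; apply: eq_bigr => i _.
by have [->|/H ->] := eqVneq i e; rewrite // c0 !scaler0.
Qed.

(** The kernel of [A] in terms of its contraction and the row [w *m A]. *)
Lemma contract_kernel m (A : 'M[F]_(m, n)) (w : 'rV[F]_m) e (x : 'cV[F]_n) :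
  A *m x = 0 <-> ((w *m A *m x) 0 0 = 0 /\ (A - col e A *m (w *m A)) *m x = 0).
Proof.
have E : (A - col e A *m (w *m A)) *m x = A *m x - (w *m A *m x) 0 0 *: col e A.
  by rewrite mulmxBl; congr (_ - _); rewrite -[LHS]mulmxA [X in _ *m X = _]mx11_scalar mul_mx_scalar.
rewrite E; split=> [h|[-> ]]; last by rewrite scale0r subr0.
by rewrite -mulmxA h mulmx0 mxE scale0r subr0.
Qed.

Lemma contract_col m (A : 'M[F]_(m, n)) (w : 'rV[F]_m) e : (w *m A) 0 e = 1 ->
  col e (A - col e A *m (w *m A)) = 0.
Proof.
move=> we; rewrite [LHS]colE mulmxBl -mulmxA -!colE.
have -> : col e (w *m A) = 1%:M by apply/matrixP => i j; rewrite !ord1 !mxE -we mxE.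
by rewrite mulmx1 subrr.
Qed.

Lemma contract_matroid M0 M m (A : 'M[F]_(m, n)) (w : 'rV[F]_m) e : (w *m A) 0 e = 1 ->
  col_matroid A = M -> contraction_of M0 M e -> col_matroid (A - col e A *m (w *m A)) = M0.
Proof.
by move=> we eA H; apply: matroid_eq => S; rewrite H -eA /= contract_indep.
Qed.

Lemma col_ext_contraction M0 M e : loop M0 e -> col_ext M0 M e -> contraction_of M0 M e.
Proof.
move=> l ext S; rewrite ext; have [eS|eS] /= := boolP (e \in S); last by rewrite setU1K.
by apply/negbTE/negP => /(loop_notin l); rewrite eS.
Qed.

Lemma ser_ext_contraction M0 M e f : loop M0 e -> ser_ext M0 M e f -> contraction_of M0 M e.
Proof.
move=> l ext S; rewrite ext setU11; have [eS|eS] /= := boolP (e \in S); last by rewrite setU1K.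
by apply/negbTE/negP => /(loop_notin l); rewrite eS.
Qed.

Lemma par_ext_deletion M0 M e f : loop M0 e -> par_ext M0 M e f -> deletion_of M0 M e.
Proof.
move=> l ext S; rewrite ext; have [eS|eS] //= := boolP (e \in S).
by apply/negbTE/negP => /(loop_notin l); rewrite eS.
Qed.

Lemma sum_supp2 (u : 'rV[F]_n) (x : 'cV[F]_n) e f : e != f ->
  (forall j, j \in ~: [set e; f] -> u 0 j = 0) -> (u *m x) 0 0 = u 0 e * x e 0 + u 0 f * x f 0.
Proof.
move=> ef H; rewrite mxE (bigD1 e) //= (bigD1 f) 1?eq_sym //= big1 ?addr0 // => j /andP[je jf].
by rewrite H ?mul0r // !inE negb_or je jf.
Qed.

(** Representations of a series-parallel matroid differ by row operations and by
    scaling columns: each reduction step leaves one scalar to adjust. *)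
Lemma sp_same_kernel c M : series_parallel c M -> forall m m' (A : 'M[F]_(m, n)) (A' : 'M[F]_(m', n)),
  col_matroid A = M -> col_matroid A' = M ->
  exists d : 'I_n -> F, (forall i, d i != 0) /\ same_kernel A A' d.
Proof.
elim=> {M} [M lo|M0 M e l ext _ IH|M0 M e f l lf _ ext _ IH|M0 M e f l ef co _ ext _ IH] m m' A A' eA eA'.
- exists (fun _ => 1); split=> [i|x]; first exact: oner_neq0.
  have z k (B : 'M[F]_(k, n)) (y : 'cV[F]_n) : col_matroid B = M -> B *m y = 0.
    move=> eB; rewrite mulmx_colE big1 // => i _; have := lo i; rewrite -eB loop_colP => /eqP ->.
    by rewrite scaler0.
  by rewrite (z _ _ _ eA) (z _ _ _ eA').
- have con := col_ext_contraction l ext.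
  have ncl : ~~ spans M (~: [set e]) e.
    by rewrite /spans !(rk_col _ l ext) !inE eqxx addn0 addn1 (rk_loopU _ l) neq_ltn ltnSn orbT.
  have sep k (B : 'M[F]_(k, n)) : col_matroid B = M -> exists w : 'rV[F]_k,
      (w *m B) 0 e = 1 /\ forall y : 'cV[F]_n, (w *m B *m y) 0 0 = y e 0.
    move=> eB; have [|w [we w0]] := @inspan_sep _ _ _ B (~: [set e]) e; first by rewrite eB.
    exists w; split=> // y; rewrite mxE (bigD1 e) //= we mul1r big1 ?addr0 // => j je.
    by rewrite w0 ?mul0r // !inE.
  have [w [we wk]] := sep _ A eA; have [w' [we' wk']] := sep _ A' eA'.
  have [d [d0 K]] := IH _ _ _ _ (contract_matroid we eA con) (contract_matroid we' eA' con).
  exists d; split=> // x; rewrite (contract_kernel A w e) (contract_kernel A' w' e) K wk wk' mxE.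
  split=> -[h1 h2]; split=> //; first by rewrite h1 mulr0.
  by move/eqP: h1; rewrite mulf_eq0 (negPf (d0 e)) => /eqP.
- have ef : e != f by apply: contraNneq lf => <-.
  have fe : f != e by rewrite eq_sym.
  have del := par_ext_deletion l ext.
  have mdel k (B : 'M[F]_(k, n)) : col_matroid B = M -> col_matroid (delcol B e) = M0.
    by move=> eB; apply: matroid_eq => S; rewrite del -eB /= delcol_indep.
  have rf : rk M0 [set f] = 1%N by apply/eqP; rewrite eqn_leq rk1_le lt0n -loop_rk.
  have cle : spans M [set f] e.
    rewrite /spans !(rk_par _ l ef ext) !inE eqxx (negPf ef) /= (setUCA [set f]) setUid.
    by rewrite (rk_loopU _ l).
  have nle : ~~ loop M e by rewrite loop_rk (rk_par _ l ef ext) inE eqxx setUC (rk_loopU _ l) rf.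
  have par k (B : 'M[F]_(k, n)) : col_matroid B = M -> exists2 a, a != 0 & col e B = a *: col f B.
    move=> eB; have /clP[x sx ex] : spans (col_matroid B) [set f] e by rewrite eB.
    have ex' : col e B = x f 0 *: col f B.
      rewrite ex mulmx_colE (bigD1 f) //= big1 ?addr0 // => j jf; by rewrite sx ?inE // scale0r.
    exists (x f 0) => //; apply: contra nle => /eqP x0.
    by rewrite -eB loop_colP ex' x0 scale0r.
  have ker k (B : 'M[F]_(k, n)) a (x : 'cV[F]_n) : col e B = a *: col f B ->
      B *m x = delcol B e *m (x + (a * x e 0) *: delta_mx f 0).
    move=> ea; rewrite mulmxDr -scalemxAr -colE.
    have -> : col f (delcol B e) = col f B by apply/colP => i; rewrite !mxE (negPf fe).
    rewrite mulrC -scalerA -ea mulmx_colE [in RHS]mulmx_colE (bigD1 e) //= [in RHS](bigD1 e) //=.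
    have -> : col e (delcol B e) = 0 by apply/colP => i; rewrite !mxE eqxx.
    rewrite scaler0 add0r addrC; congr (_ + _); apply: eq_bigr => j je; congr (_ *: _).
    by apply/colP => i; rewrite !mxE (negPf je).
  have [a a0 ea] := par _ A eA; have [a' a0' ea'] := par _ A' eA'.
  have [d [d0 K]] := IH _ _ _ _ (mdel _ A eA) (mdel _ A' eA').
  (* the columns [e] and [f] of [A'], scaled by [d'], have the ratio of those of [A] *)
  pose d' i := if i == e then d f * a / a' else d i.
  exists d'; split=> [i|x].
    rewrite /d'; case: ifP => _; last exact: d0.
    by rewrite !mulf_neq0 ?invr_eq0.
  rewrite (ker _ _ _ _ ea) (ker _ _ _ _ ea') K.
  rewrite (mulmx_ignore (e := e) (y := scale_col d' x +
     (a' * scale_col d' x e 0) *: delta_mx f 0)) //.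
    by apply/colP => i; rewrite !mxE eqxx.
  move=> i ie; rewrite !mxE /d' !eqxx (negPf ie) andbT; case: eqP => [->|_]; last by rewrite !mulr0 !addr0.
  by field.
have con := ser_ext_contraction l ext.
have ncl : ~~ spans M (~: [set e; f]) e.
  rewrite /spans !(rk_ser _ l ef ext) !inE !eqxx orbT /= neq_ltn ltnS.
  by apply/orP; right; apply: rkS; apply: subsetUr.
have cle : spans M (~: [set e]) e by move: co; rewrite coloopE negbK.
have sep k (B : 'M[F]_(k, n)) : col_matroid B = M -> exists (w : 'rV[F]_k) a,
    [/\ (w *m B) 0 e = 1, a != 0 & forall y : 'cV[F]_n, (w *m B *m y) 0 0 = y e 0 + a * y f 0].
  move=> eB; have [|w [we w0]] := @inspan_sep _ _ _ B (~: [set e; f]) e; first by rewrite eB.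
  have wy (y : 'cV[F]_n) : (w *m B *m y) 0 0 = y e 0 + (w *m B) 0 f * y f 0.
    by rewrite (sum_supp2 _ ef w0) we mul1r.
  exists w, ((w *m B) 0 f); split=> //.
  have /clP[x sx ex] : spans (col_matroid B) (~: [set e]) e by rewrite eB.
  have := wy x; rewrite -mulmxA -ex sx ?inE ?eqxx // add0r => h.
  apply/eqP => a0; have := oner_neq0 F; rewrite -we.
  have <- : (w *m col e B) 0 0 = (w *m B) 0 e by rewrite !mxE; apply: eq_bigr => i _; rewrite !mxE.
  by rewrite h a0 mul0r eqxx.
have [w [a [we a0 wk]]] := sep _ A eA; have [w' [a' [we' a0' wk']]] := sep _ A' eA'.
have [d [d0 K]] := IH _ _ _ _ (contract_matroid we eA con) (contract_matroid we' eA' con).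
(* the form with coefficients 1 and [a'] at [e] and [f], composed with the scaling
   by [d'], is a multiple of the one with coefficients 1 and [a] *)
pose d' i := if i == e then d f * a' / a else d i.
exists d'; split=> [i|x].
  rewrite /d'; case: ifP => _; last exact: d0.
    by rewrite !mulf_neq0 ?invr_eq0.
rewrite (contract_kernel A w e) (contract_kernel A' w' e) K wk wk'.
rewrite (mulmx_ignore (e := e) (y := scale_col d' x)).
- have -> : scale_col d' x e 0 +
      a' * scale_col d' x f 0 = d f * a' / a * (x e 0 + a * x f 0).
    by rewrite !mxE /d' eqxx eq_sym (negPf ef); field.
  split=> -[h1 h2]; split=> //; first by rewrite h1 mulr0.
  by move/eqP: h1; rewrite !mulf_eq0 invr_eq0 (negPf (d0 f)) (negPf a0) (negPf a0') => /eqP.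
- exact: contract_col.
by move=> i ie; rewrite !mxE /d' (negPf ie).
Qed.

End Torus.

(** * Subspaces and their Pluecker coordinates *)

Section Subspaces.
Variables (F : fieldType) (n : nat).
Implicit Types (V : {vspace 'rV[F]_n}) (I : {set 'I_n}) (d : 'I_n -> F).

Lemma rk_col_matroid m (A : 'M[F]_(m, n)) : rk (col_matroid A) setT = \rank A.
Proof.
have [B [iB _ eB]] := rk_wit (col_matroid A) setT.
pose G : 'M[F]_(#|B|, n) := rowsub enum_val 1%:M.
have GE c (X : 'M[F]_(n, c)) : G *m X = rowsub enum_val X by rewrite [RHS]rowsubE.
have GG : G *m G^T = 1%:M.
  by rewrite GE; apply/matrixP => i j; rewrite !mxE (inj_eq enum_val_inj) eq_sym.
have Gsupp v : supported (G^T *m v) B.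
  move=> j jB; rewrite mxE big1 // => i _; rewrite !mxE.
  by case: eqP jB => [<-|_ _]; rewrite ?enum_valP ?mul0r.
have Gid c : supported c B -> G^T *m (G *m c) = c.
  move=> sc; apply/colP => j; have [jB|jB] := boolP (j \in B); last by rewrite Gsupp ?sc.
  have e (v : 'cV_n) : v j 0 = (G *m v) (enum_rank_in jB j) 0 by rewrite GE mxE enum_rankK_in.
  by rewrite e mulmxA GG mul1mx -e.
have rA : \rank A = \rank (A *m G^T).
  apply/anti_leq/andP; split; last exact: mxrankM_maxl.
  rewrite -mxrank_tr -[X in (_ <= X)%N]mxrank_tr; apply/mxrankS/row_subP => j.
  have /clP[c sc ec] : spans (col_matroid A) B j.
    by apply: (rk_cl (subsetT B)); rewrite ?inE // rk_indep.
  apply/submxP; exists (G *m c)^T.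
  by rewrite -trmx_mul -mulmxA Gid // -ec tr_col.
rewrite rA -eB -mxrank_tr; apply/esym/eqP; rewrite -[_ == _]/(row_free _) -kermx_eq0.
apply/rowV0P => u /sub_kermxP u0.
have v0 : G^T *m u^T = 0.
  move/col_indepP: iB; apply=> //.
  by apply: trmx_inj; rewrite mulmxA trmx_mul trmxK u0 trmx0.
by apply: trmx_inj; rewrite trmx0 -[u^T]mul1mx -GG -mulmxA v0 mulmx0.
Qed.

Lemma row_spaceP k l (A : 'M[F]_(k, n)) (B : 'M[F]_(l, n)) :
  (row_space A <= row_space B)%VS = (A <= B)%MS.
Proof.
apply/idP/submxP => [/row_space_mulmx //|[Q ->]].
apply/span_subvP => _ /mapP[i _ ->].
have -> : row i (Q *m B) = \sum_j Q i j *: row j B.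
  by rewrite row_mul mulmx_sum_row; apply: eq_bigr => j _; rewrite mxE.
by apply: memv_suml => j _; apply/memvZ/memv_span/map_f; rewrite mem_enum.
Qed.

Lemma row_free_space_mx V : row_free (space_mx V).
Proof.
rewrite -kermx_eq0; apply/rowV0P => u /sub_kermxP u0.
have /freeP/(_ (fun i => u 0 i)) K := basis_free (vbasisP V).
apply/rowP => i; rewrite mxE; apply: K; rewrite -[RHS]u0 mulmx_sum_row.
by apply: eq_bigr => j _; rewrite rowK.
Qed.

Lemma rk_space_matroid V : rk (space_matroid V) setT = \dim V.
Proof. by rewrite rk_col_matroid; apply/eqP/row_free_space_mx. Qed.

Lemma minor_mulmx k (Q : 'M[F]_k) (A : 'M[F]_(k, n)) I : #|I| = k ->
  minor (Q *m A) I = \det Q * minor A I.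
Proof.
move=> e; rewrite !(minor_cast _ (esym e)) -det_mulmx; congr (\det _).
by apply/matrixP => i j; rewrite !mxE; apply: eq_bigr => l _; rewrite !mxE.
Qed.

(** The factor is the determinant of the change of basis. *)
Lemma minor_row_space k l (A : 'M[F]_(k, n)) (B : 'M[F]_(l, n)) : k = l ->
  row_free A -> row_space A = row_space B ->
  exists2 c, c != 0 & forall I, #|I| = k -> minor A I = c * minor B I.
Proof.
move=> e; case: l / e B => B fA eAB.
have /submxP[Q eQ] : (A <= B)%MS by rewrite -row_spaceP eAB.
have /submxP[Q' eQ'] : (B <= A)%MS by rewrite -row_spaceP eAB.
have QQ : Q *m Q' = 1%:M.
  by apply: (row_free_inj fA); rewrite mul1mx -mulmxA -eQ' -eQ.
exists (\det Q) => [|I e]; last by rewrite {1}eQ minor_mulmx.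
by rewrite -unitfE -unitmxE; have [] := mulmx1_unit QQ.
Qed.

(** The action of the diagonal torus on subspaces. *)
Definition torus d V : {vspace 'rV[F]_n} := row_space (space_mx V *m diag_mx (\row_i d i)).

Lemma torus_matroid d V : (forall i, d i != 0) -> space_matroid (torus d V) = space_matroid V.
Proof.
move=> nz; rewrite /torus space_matroid_row_space.
set D := diag_mx _; pose D' : 'M_n := diag_mx (\row_i (d i)^-1).
have DE (e : 'I_n -> F) (x : 'cV_n) i : (diag_mx (\row_i e i) *m x) i 0 = e i * x i 0.
  by rewrite mul_diag_mx !mxE.
apply: val_inj; apply/setP => S; apply/col_indepP/col_indepP => H x xS Ax.
  have y0 : D' *m x = 0.
    apply: H => [j /xS xj|]; first by rewrite DE xj mulr0.
    rewrite -Ax -mulmxA; congr (_ *m _); apply/colP => i.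
    by rewrite !DE mulrA mulfV ?mul1r.
  by apply/colP => i; move/colP/(_ i): y0; rewrite DE !mxE => /eqP; rewrite mulf_eq0 invr_eq0 (negPf (nz i)) => /eqP.
have y0 : D *m x = 0.
  by apply: H; rewrite ?mulmxA // => j /xS xj; rewrite DE xj mulr0.
by apply/colP => i; move/colP/(_ i): y0; rewrite DE !mxE => /eqP; rewrite mulf_eq0 (negPf (nz i)) => /eqP.
Qed.

Lemma dim_torus d V : (forall i, d i != 0) -> \dim (torus d V) = \dim V.
Proof. by move=> nz; rewrite -!rk_space_matroid torus_matroid. Qed.

Lemma minor_diag k (A : 'M[F]_(k, n)) d I : #|I| = k ->
  minor (A *m diag_mx (\row_i d i)) I = (\prod_(i in I) d i) * minor A I.
Proof.
move=> e; rewrite !(minor_cast _ (esym e)) mulrC.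
have -> : \prod_(i in I) d i = \det (diag_mx (\row_i d (enum_val (cast_ord (esym e) i)))).
  rewrite det_diag big_enum_val /= (reindex (cast_ord (esym e))) /=.
    by apply: eq_bigr => i _; rewrite mxE.
  by exists (cast_ord e) => i _; rewrite ?cast_ordK ?cast_ordKV.
rewrite -det_mulmx; congr (\det _).
by rewrite !mul_mx_diag; apply/matrixP => i j; rewrite !mxE.
Qed.

Lemma plucker_torus d V : (forall i, d i != 0) ->
  exists2 c, c != 0 & forall I, #|I| = \dim V ->
    plucker (torus d V) I = c * ((\prod_(i in I) d i) * plucker V I).
Proof.
move=> nz; have e := dim_torus V nz.
have [|c c0 H] := minor_row_space e (row_free_space_mx _)
  (_ : _ = row_space (space_mx V *m diag_mx (\row_i d i))); first by rewrite space_mxK.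
by exists c => // I eI; rewrite /plucker H ?e // minor_diag.
Qed.

(** By [sp_same_kernel] the equations of both subspaces agree up to scaling the
    coordinates. *)
Lemma sp_torus c V V' : series_parallel c (space_matroid V) -> space_matroid V' = space_matroid V ->
  exists2 d, (forall i, d i != 0) & V' = torus d V.
Proof.
move=> spV eV; have [d [d0 ker]] := sp_same_kernel spV eV (erefl _).
have nz i : (d i) != 0 by [].
exists d => //.
have sc (x : 'cV_n) : scale_col d x = diag_mx (\row_i d i) *m x.
  by rewrite mul_diag_mx; apply/colP => i; rewrite !mxE.
rewrite /torus; apply/eqP; rewrite -[V' in X in X == _]space_mxK.
have E : \rank (space_mx V') = \rank (space_mx V *m diag_mx (\row_i d i)).
  by rewrite -!rk_col_matroid -[LHS]/(rk (space_matroid V') _) eV -(torus_matroid V nz) space_matroid_row_space.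
have sub : (space_mx V' <= space_mx V *m diag_mx (\row_i d i))%MS.
  rewrite submxE; apply/eqP/matrixP => i j.
  set C := cokermx _; have /ker A0 : space_mx V *m scale_col d (col j C) = 0.
    by rewrite sc mulmxA colE mulmxA mulmx_coker mul0mx.
  by move/colP/(_ i): A0; rewrite colE mulmxA -colE !mxE.
rewrite eqEsubv !row_spaceP sub /=.
by move: (mxrank_leqif_eq sub) => [_]; rewrite E eqxx => /esym/andP[].
Qed.

End Subspaces.

From mathcomp Require Import boolp classical_sets reals mpoly.

(** * The torus action on positroid varieties *)

Section Closure.
Variables (F : fieldType).

Definition mpoly_twist N (D : 'I_N -> F) (p : {mpoly F[N]}) : {mpoly F[N]} :=
  \sum_(m <- msupp p) (p@_m * \prod_i D i ^+ m i) *: 'X_[m].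

Lemma mpoly_twist_homog N (D : 'I_N -> F) p d : p \is d.-homog -> mpoly_twist D p \is d.-homog.
Proof.
move=> /dhomogP hp; rewrite /mpoly_twist big_seq; apply: rpred_sum => m mp.
by apply: dhomogZ; rewrite dhomogX; apply/eqP/hp.
Qed.

Lemma meval_twist N (D v : 'I_N -> F) p : (mpoly_twist D p).@[v] = p.@[fun i => D i * v i].
Proof.
rewrite /mpoly_twist raddf_sum mevalE; apply: eq_bigr => m _ /=.
rewrite mevalZ mevalX -mulrA -big_split; congr (_ * _).
by apply: eq_bigr => i _; rewrite exprMn.
Qed.

Lemma meval_scale N c (v : 'I_N -> F) p d : p \is d.-homog ->
  p.@[fun i => c * v i] = c ^+ d * p.@[v].
Proof.
move=> /dhomogP hp; rewrite !mevalE mulr_sumr big_seq [RHS]big_seq; apply: eq_bigr => m mp.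
rewrite mulrCA; congr (_ * _); have /= <- := hp m mp; rewrite mdegE -prodrXr -big_split.
by apply: eq_bigr => i _; rewrite exprMn.
Qed.

Variable n : nat.
Implicit Types (V : {vspace 'rV[F]_n}) (d : 'I_n -> F).

(** The torus multiplies each Pluecker coordinate by a monomial in [d], and all of them
    by a common scalar, which homogeneous equations do not see. *)
Lemma torus_closed k d (Z : set {vspace 'rV[F]_n}) : (forall i, d i != 0) ->
  zariski_closed k Z -> zariski_closed k [set V | Gr F k n V /\ Z (torus d V)]%classic.
Proof.
move=> nz [S hS eZ].
pose D (i : 'I_#|ksubsets k n|) := \prod_(j in (enum_val i : {set 'I_n})) d j.
have ev p V : S p -> Gr F k n V ->
    plucker_eval p (torus d V) = 0 <-> plucker_eval (mpoly_twist D p) V = 0.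
  move=> /hS[e he] gV; have [c c0 H] := plucker_torus V nz.
  rewrite /plucker_eval meval_twist.
  have -> : p.@[fun i => plucker (torus d V) (enum_val i)] =
      p.@[fun i => c * (D i * plucker V (enum_val i))].
    apply: meval_eq => i; apply: H; rewrite gV.
    by have := enum_valP i; rewrite inE => /eqP.
  rewrite (meval_scale _ _ he); split=> [/eqP|->]; last by rewrite mulr0.
  by rewrite mulf_eq0 expf_eq0 (negPf c0) andbF => /eqP.
exists [set q | exists2 p, S p & q = mpoly_twist D p]%classic.
  by move=> _ [p /hS[e he] ->]; exists e; apply: mpoly_twist_homog.
rewrite predeqE => V; split=> -[gV]; rewrite ?eZ.
  by move=> [_ H]; split=> // _ [p Sp ->]; apply/ev => //; apply: H.
move=> H; split=> //; split=> [|p Sp]; first by rewrite /Gr /= dim_torus.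
by apply/ev => //; apply: H; exists p.
Qed.

Lemma torus_positroid_variety d (P : matroid 'I_n) V : (forall i, d i != 0) ->
  positroid_variety F P V -> positroid_variety F P (torus d V).
Proof.
move=> nz cV Z [cZ sZ].
have [|//] := cV _ (conj (torus_closed nz cZ) _).
move=> W [gW oW]; split=> //; apply: sZ; split; last by rewrite torus_matroid.
by rewrite /Gr /= dim_torus.
Qed.

(** The Pluecker coordinates at non-bases of [P] vanish on the stratum of [P], so they
    vanish on its closure. *)
Lemma positroid_variety_bases (P : matroid 'I_n) V :
  open_positroid_variety F P = matroid_stratum F P -> positroid_variety F P V ->
  \dim V = mrank P /\ forall I, is_basis (space_matroid V) I -> is_basis P I.
Proof.
move=> oP cV.
pose Z : set {vspace 'rV[F]_n} :=
  [set W | Gr F (mrank P) n W /\ forall p, (exists2 i : 'I_#|ksubsets (mrank P) n|,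
     ~~ is_basis P (enum_val i) & p = 'X_i) -> plucker_eval p W = 0]%classic.
have cZ : zariski_closed (mrank P) Z.
  exists [set p | exists2 i : 'I_#|ksubsets (mrank P) n|, ~~ is_basis P (enum_val i) & p = 'X_i]%classic => //.
  by move=> _ [i _ ->]; exists 1%N; rewrite dhomogX /= mdeg1.
have sZ : (open_positroid_variety F P `<=` Z)%classic.
  rewrite oP => W [gW eW]; split=> // _ [i ni ->].
  have ci : #|enum_val i| = \dim W by have := enum_valP i; rewrite inE gW => /eqP.
  rewrite /plucker_eval mevalXU; apply/eqP; apply: contraNT ni.
  rewrite minor_neq0 // => Ii.
  have : is_basis (space_matroid W) (enum_val i) by rewrite /is_basis Ii rk_space_matroid ci eqxx.
  by rewrite eW.
have [gV H] := cV Z (conj cZ sZ); split=> // I bI.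
have cI : #|I| = \dim V by rewrite (isb_card bI) rk_space_matroid.
have kI : I \in ksubsets (mrank P) n by rewrite inE cI gV.
apply: contraT => nI; have := H 'X_(enum_rank_in kI I).
rewrite /plucker_eval mevalXU enum_rankK_in // => H0.
have /negP[] : plucker V I != 0 by rewrite minor_neq0 //; apply: isb_indep bI.
by apply/eqP/H0; exists (enum_rank_in kI I); rewrite // enum_rankK_in.
Qed.

End Closure.

(** * Graphic positroids *)

Theorem theorem4p3 (R : realType) (k n : nat) (P : matroid 'I_n)
    (hk : mrank P = k) (hP : positroid R P) :
  [<-> graphic P;
       envelope_class P = [set P]%SET;
       forall F : fieldType,
         open_positroid_variety F P = matroid_stratum F P;
       is_disjoint_union_of_graphic_strata (positroid_variety R P)].
Proof.
have [A [_ eA pA]] := hP.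
have ncP : noncrossing P.
  by rewrite -eA; apply: tnn_noncrossing pA; rewrite eA mrankE.
tfae.
- move=> gP; have rP := graphic_representable2 gP.
  have spP := sp_of_hereditary (representable2_hereditary n F2_unit) ncP rP.
  apply/setP => M; rewrite finset.in_set1; apply/idP/eqP => [/envelope_classE|->].
    exact: sp_unique.
  by rewrite inE.
- move=> uP F; rewrite predeqE => V; rewrite /open_positroid_variety /matroid_stratum /= uP.
  by split=> -[gV eV]; split=> //; [apply/set1P | apply/set1P].
- move=> oP.
  (* every real representation of a matroid in the class gives a point of the open variety *)
  have rigP : rigid R P.
    split; first by exists (mrank P), A.
    move=> m B eB; have := oP R; rewrite predeqE => /(_ (row_space B))[oB _].
    rewrite -space_matroid_row_space; apply: (proj2 (oB _)); split; last first.
      by apply/envelope_classE; rewrite space_matroid_row_space.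
    by rewrite /Gr /= -rk_space_matroid space_matroid_row_space (arc_equiv_T eB) mrankE.
  have spP := sp_of_hereditary (@rigid_hereditary _ _) ncP rigP.
  (* points of the closure have weak images of [P] as matroids *)
  have spV V : positroid_variety R P V -> series_parallel false (space_matroid V) /\ \dim V = mrank P.
    move=> cV; have [dV K] := positroid_variety_bases (oP R) cV; split=> //.
    by apply: (sp_weak_image (sp_weaken spP)) K; rewrite rk_space_matroid dV mrankE.
  exists [set M | exists2 V, positroid_variety R P V & space_matroid V = M]%classic; split.
  + by move=> _ [V /spV[sV _] <-]; apply/presented_graphic/sp_presented/sV.
  + by move=> M M' _ _ [V [[_ <-] [_ <-]]].
  + rewrite predeqE => V; split=> [cV|[_ [V0 c0 <-] [gV eV]]].
      exists (space_matroid V); first by exists V.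
      by split=> //; rewrite /Gr /= mrankE rk_space_matroid.
    have [d nz ->] := sp_torus (proj1 (spV _ c0)) eV.
    exact: torus_positroid_variety.
- move=> [Ms [gMs _ eV]].
  have : positroid_variety R P (row_space A).
    apply: sub_gen_smallest; split.
      by rewrite /Gr /= -rk_space_matroid space_matroid_row_space eA mrankE.
    by rewrite space_matroid_row_space eA inE.
  rewrite eV => -[M /gMs gM [_ eM]].
  by rewrite -eA -space_matroid_row_space eM.
Qed.
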